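(* Let $d\ge1$ be an integer. For quasi-all nonnegative harmonic functions $h$ in the open unit ball $B_{d+1}$ of $\mathbb R^{d+1}$ (i.e. for all $h$ in some residual subset of $\mathcal H^+(B_{d+1})$), the following holds: for every $\beta\in[0,d]$, $$\dim_{\mathcal H}\big(E(\beta,h)\big)=d-\beta,$$ where $$E(\beta,h)=\Big\{y\in\mathcal S_d:\ \limsup_{r\to1^-}\frac{\log h(ry)}{-\log(1-r)}=\beta\Big\}.$$
   Context: $\mathcal S_d$ is the Euclidean unit sphere of $\mathbb R^{d+1}$ with the metric inherited from the Euclidean norm. $\mathcal H^+(B_{d+1})$ is the set of nonnegative harmonic functions in $B_{d+1}$, endowed with the topology of locally uniform convergence; it is a closed cone in the complete vector space of continuous functions on $B_{d+1}$, hence a Baire space. A subset of a Baire space is residual if it contains a countable intersection of dense open sets. The residual set does not depend on $\beta$. Convention: $\log0=-\infty$. $\dim_{\mathcal H}$ denotes Hausdorff dimension (with $\dim_{\mathcal H}(\varnothing)=0$). *)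

(* Defs.v *)
From mathcomp Require Import all_boot all_order all_algebra.
From mathcomp Require Import all_classical all_reals all_analysis.
From mathcomp Require Import borel_hierarchy.

Set Implicit Arguments.
Unset Strict Implicit.
Unset Printing Implicit Defensive.
Import Order.TTheory GRing.Theory Num.Theory.
Import numFieldNormedType.Exports.

Local Open Scope classical_set_scope.
Local Open Scope ring_scope.

(* The library norm on row vectors is the sup norm.  It induces the usual
   topology, so [compact], [continuous] and ['D_v] can be used unchanged, but
   the ball, the sphere and diameters have to be defined from the Euclidean
   norm. *)
Definition enorm (R : realType) (n : nat) (x : 'rV[R]_n) : R :=
  Num.sqrt (\sum_(i < n) x ord0 i ^+ 2).

Definition unit_ball (R : realType) (d : nat) : set 'rV[R]_d.+1 :=
  [set x | enorm x < 1].

Definition unit_sphere (R : realType) (d : nat) : set 'rV[R]_d.+1 :=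
  [set x | enorm x = 1].

Arguments unit_ball : clear implicits.
Arguments unit_sphere : clear implicits.

Definition partial (R : realType) (d : nat) (i : 'I_d.+1)
    (f : 'rV[R]_d.+1 -> R) : 'rV[R]_d.+1 -> R :=
  'D_(delta_mx ord0 i) f.

(* [partial i f] is total: it has a junk value where the derivative does not
   exist, hence the explicit derivability clauses. *)
Definition C2_on (R : realType) (d : nat) (U : set 'rV[R]_d.+1)
    (f : 'rV[R]_d.+1 -> R) : Prop :=
  forall x, U x ->
    {for x, continuous f} /\
    forall i : 'I_d.+1,
      [/\ derivable f x (delta_mx ord0 i),
          {for x, continuous (partial i f)} &
          forall j : 'I_d.+1,
            derivable (partial i f) x (delta_mx ord0 j) /\
            {for x, continuous (partial j (partial i f))}].

Definition laplacian (R : realType) (d : nat) (f : 'rV[R]_d.+1 -> R)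
    (x : 'rV[R]_d.+1) : R :=
  \sum_(i < d.+1) partial i (partial i f) x.

(* [U] is meant to be open. *)
Definition harmonic_on (R : realType) (d : nat) (U : set 'rV[R]_d.+1)
    (f : 'rV[R]_d.+1 -> R) : Prop :=
  C2_on U f /\ forall x, U x -> laplacian f x = 0.

(* A function on the ball is encoded by its extension by 0, which makes the
   encoding injective.  The ambient function space carries the topology of
   uniform convergence on the compact subsets of the ball, that is, of locally
   uniform convergence in the ball; the subtype [set_type (nonneg_harmonic R d)]
   receives the induced topology. *)
Definition nonneg_harmonic (R : realType) (d : nat) :
    set {family compactly_in (unit_ball R d), 'rV[R]_d.+1 -> R} :=
  [set h | [/\ harmonic_on (unit_ball R d) h,
               forall x, unit_ball R d x -> 0 <= h x &
               forall x, ~ unit_ball R d x -> h x = 0]].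

Arguments nonneg_harmonic : clear implicits.

Definition residual (T : topologicalType) (A : set T) : Prop :=
  exists2 G : set T, Gdelta_dense G & G `<=` A.

Section hausdorff.
Context {R : realType} {n : nat}.
Implicit Types (A : set 'rV[R]_n) (s delta : R).
Local Open Scope ereal_scope.

(* Euclidean diameter; the maximum with 0 gives the empty set diameter 0. *)
Definition ediam A : \bar R :=
  maxe 0 (ereal_sup [set z | exists x y, [/\ A x, A y & z = (enorm (x - y)%R)%:E]]).

Definition hausdorff_premeasure s delta A : \bar R :=
  ereal_inf [set \sum_(0 <= i <oo) poweR (ediam (U i)) s | U in
    [set U : nat -> set 'rV[R]_n |
      A `<=` \bigcup_i U i /\ forall i, ediam (U i) <= delta%:E]].

Definition hausdorff_measure s A : \bar R :=
  ereal_sup [set hausdorff_premeasure s delta A | delta in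
    [set delta : R | (0 < delta)%R]].

(* Only exponents s > 0 are used: this leaves the infimum unchanged, avoids
   the convention on 0 ^ 0, and gives the empty set dimension 0. *)
Definition hausdorff_dim A : \bar R :=
  ereal_inf [set s%:E | s in [set s : R | (0 < s)%R /\ hausdorff_measure s A = 0]].

End hausdorff.

(* [lne 0 = -oo], and the denominator is positive for r near 1. *)
Definition growth_set (R : realType) (d : nat) (beta : R)
    (h : 'rV[R]_d.+1 -> R) : set 'rV[R]_d.+1 :=
  [set y | unit_sphere R d y /\
    (limf_esup (fun r : R => lne (h (r *: y))%:E / (- ln (1 - r))%:E) (1%R : R)^'-
       = beta%:E)%E].

(* Main.v *)
(* Upper bound: testing [laplacian h = 0] against radial functions shows that
   the sum of a nonnegative harmonic [h] over [delta / 4]-separated points of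
   the shell [1 - delta <= |x| <= 1 - delta / 2] is at most [C * delta ^- d].
   Hence at scale [delta] the points y where [h] reaches [delta ^- b] are
   covered by [C * delta `^ (b - d)] balls of radius comparable to [delta].
   The test is a summation by parts on finer and finer lattices, so that no
   Poisson representation and no integral on R^(d+1) is needed.

   Lower bound: a generic [h] dominates, for infinitely many j, a combination
   of Poisson kernels with about [m ^ d] poles on a chart of the sphere, where
   [m = 2 ^ (j ^ 2)], of total mass [2 ^- j].  For [t = d - beta], the growth
   exponent of [h] is at least [beta] at every point that is, infinitely often,
   at distance [m `^ (- (d / t))] from a pole.  Nested cubes show that the set
   of these points has no covering of small cost for the gauge
   [x `^ t * (1 + t^-1 - ln x)], whereas the points of exponent at least
   [beta + 2 ^- k] have dimension less than [t] by the upper bound; so the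
   points of exponent exactly [beta] have dimension at least [t]. *)
Require Import Defs.
From mathcomp Require Import all_boot all_order all_algebra.
From mathcomp Require Import all_classical all_reals all_analysis.
From mathcomp Require Import borel_hierarchy ring lra zify.
Import Order.TTheory GRing.Theory Num.Theory.
Import numFieldNormedType.Exports.
Local Open Scope classical_set_scope.
Local Open Scope ring_scope.

Set Implicit Arguments.
Unset Strict Implicit.
Unset Printing Implicit Defensive.

(** [growth_set] is an exact level set, whereas nested cubes only produce points of exponent at
    least beta. Discarding the larger exponents requires a notion of size that is countably
    subadditive, neglects every set of dimension less than t, and still sees the points close to
    infinitely many poles. The plain power x^t is too coarse for this: at radius m^(-d/t) its cost
    is a multiple of m^(-d), the reciprocal of the number of grid cells, so a cheap cover could
    still spoil a fixed multiple of that number of cells. The logarithm in the gauge gains a factor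
    ln m, which tends to infinity, and yet it is absorbed by x^s for every s < t. One residual set
    must serve all beta. For this reason a comb is dominated down to depth m^(-j), below m^(-d/t)
    for every fixed t once j is large. In the upper bound the radial test functions are prescribed
    through the derivative of their profile with respect to the squared distance. Their Laplacian is
    then explicit, and the plane, with its logarithmic potential, is no special case. *)

Lemma sqr_normr (R : realDomainType) (x : R) : `|x| ^+ 2 = x ^+ 2.
Proof. by rewrite real_normK // num_real. Qed.

(** * Euclidean norm on row vectors *)

Section euclidean.
Context {R : realType} {n : nat}.
Implicit Types x y z : 'rV[R]_n.

Definition esq x : R := \sum_(i < n) x ord0 i ^+ 2.

Lemma esq_ge0 x : 0 <= esq x.
Proof. by apply: sumr_ge0 => i _; exact: sqr_ge0. Qed.

Lemma enormE x : enorm x = Num.sqrt (esq x). Proof. by []. Qed.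

Lemma sqr_enorm x : enorm x ^+ 2 = esq x.
Proof. by rewrite enormE sqr_sqrtr // esq_ge0. Qed.

Lemma enorm_ge0 x : 0 <= enorm x. Proof. exact: sqrtr_ge0. Qed.

Lemma enorm_le x c : 0 <= c -> (enorm x <= c) = (esq x <= c ^+ 2).
Proof. by move=> c0; rewrite -sqr_enorm ler_sqr // nnegrE enorm_ge0. Qed.

Lemma enorm_lt x c : 0 <= c -> (enorm x < c) = (esq x < c ^+ 2).
Proof. by move=> c0; rewrite -sqr_enorm ltr_sqr // nnegrE enorm_ge0. Qed.

Lemma sqr_coord_le x i : x ord0 i ^+ 2 <= esq x.
Proof.
by rewrite /esq (bigD1 i) //= lerDl sumr_ge0 // => j _; exact: sqr_ge0.
Qed.

Lemma coord_le_enorm x i : `|x ord0 i| <= enorm x.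
Proof.
by rewrite -ler_sqr ?nnegrE ?enorm_ge0 // sqr_enorm sqr_normr sqr_coord_le.
Qed.

Lemma esqN x : esq (- x) = esq x.
Proof. by apply: eq_bigr => i _; rewrite mxE sqrrN. Qed.

Lemma enormN x : enorm (- x) = enorm x.
Proof. by rewrite !enormE esqN. Qed.

Lemma enorm_distC x y : enorm (x - y) = enorm (y - x).
Proof. by rewrite -enormN opprB. Qed.

Lemma esqZ a x : esq (a *: x) = a ^+ 2 * esq x.
Proof. by rewrite /esq mulr_sumr; apply: eq_bigr => i _; rewrite mxE exprMn. Qed.

Lemma enormZ a x : enorm (a *: x) = `|a| * enorm x.
Proof. by rewrite !enormE esqZ sqrtrM ?sqr_ge0 // sqrtr_sqr. Qed.

Lemma enorm0 : enorm (0 : 'rV[R]_n) = 0.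
Proof. by rewrite -(scale0r (0 : 'rV[R]_n)) enormZ normr0 mul0r. Qed.

Lemma cauchy_schwarz x y :
  (\sum_(i < n) x ord0 i * y ord0 i) ^+ 2 <= esq x * esq y.
Proof.
have [y0|y0] := eqVneq (esq y) 0.
  have yi i : y ord0 i = 0.
    apply/eqP; rewrite -sqrf_eq0 eq_le sqr_ge0 andbT.
    by rewrite -y0 sqr_coord_le.
  by rewrite y0 mulr0 big1 ?expr0n // => i _; rewrite yi mulr0.
have yp : 0 < esq y by rewrite lt_def y0 esq_ge0.
have key s c : esq (s *: x - c *: y) = s ^+ 2 * esq x -
    2 * s * c * (\sum_(i < n) x ord0 i * y ord0 i) + c ^+ 2 * esq y.
  rewrite /esq !mulr_sumr -sumrB -big_split /=.
  by apply: eq_bigr => i _; rewrite !mxE; ring.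
have := esq_ge0 (esq y *: x - (\sum_(i < n) x ord0 i * y ord0 i) *: y).
rewrite key; move: (\sum_(i < n) _) => c h; rewrite -(ler_pM2l yp); nra.
Qed.

Lemma ler_enormD x y : enorm (x + y) <= enorm x + enorm y.
Proof.
rewrite enorm_le ?addr_ge0 ?enorm_ge0 // sqrrD !sqr_enorm.
have -> : esq (x + y) =
    esq x + 2 * (\sum_(i < n) x ord0 i * y ord0 i) + esq y.
  rewrite /esq mulr_sumr -!big_split /=.
  apply: eq_bigr => i _; rewrite !mxE; ring.
rewrite lerD2r lerD2l -[leRHS]mulr_natl ler_pM2l ?ltr0n //.
apply: le_trans (ler_norm _) _.
rewrite -ler_sqr ?nnegrE ?normr_ge0 ?mulr_ge0 ?enorm_ge0 //.
by rewrite sqr_normr exprMn !sqr_enorm cauchy_schwarz.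
Qed.

Lemma ler_enorm_dist y x z : enorm (x - z) <= enorm (x - y) + enorm (y - z).
Proof. by rewrite -[x - z](subrKA y) ler_enormD. Qed.

Lemma ler_enormB x y : enorm x - enorm y <= enorm (x - y).
Proof. by rewrite lerBlDr -{1}(subrK y x) ler_enormD. Qed.

Lemma enorm_le_coord x c : 0 <= c ->
  (forall i, `|x ord0 i| <= c) -> enorm x <= n%:R * c.
Proof.
move=> c0 xc; rewrite enorm_le ?mulr_ge0 //.
apply: (@le_trans _ _ (\sum_(i < n) c ^+ 2)).
  by apply: ler_sum => i _; rewrite -sqr_normr lerXn2r ?nnegrE.
rewrite sumr_const card_ord -[leLHS]mulr_natl exprMn ler_wpM2r ?sqr_ge0 //.
by rewrite -natrX ler_nat; case: (n) => // k; rewrite expnS leq_pmulr.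
Qed.

End euclidean.

(** * Coverings of small cost *)

Section coverings.
Context {R : realType} {n : nat}.
Implicit Types (A B : set 'rV[R]_n) (g : R -> R) (e : R).

(* Only finite partial sums of the costs are used, and the numbers [d i] are
   positive upper bounds of the diameters, which spares any convention for
   the gauge at 0. *)
Definition coverable g A e := exists (U : nat -> set 'rV[R]_n) (d : nat -> R),
  [/\ forall i, 0 < d i,
      A `<=` \bigcup_i U i,
      forall i x y, U i x -> U i y -> enorm (x - y) <= d i &
      forall M, \sum_(i < M) g (d i) <= e].

Lemma coverable_sub g A B e : A `<=` B -> coverable g B e -> coverable g A e.
Proof.
by move=> AB [U [d [d0 BU Ud s]]]; exists U, d; split => // x /AB /BU.
Qed.

Lemma coverable_le g A e e' : e <= e' -> coverable g A e -> coverable g A e'.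
Proof.
move=> ee [U [d [d0 BU Ud s]]]; exists U, d; split => // M.
exact: le_trans (s M) ee.
Qed.

Lemma sum_half_pow_le (M : nat) : \sum_(i < M) 2^-1 ^+ i.+1 <= 1 :> R.
Proof.
suff -> : \sum_(i < M) 2^-1 ^+ i.+1 = 1 - 2^-1 ^+ M :> R.
  by rewrite lerBlDr lerDl exprn_ge0 // invr_ge0.
elim: M => [|M IH]; first by rewrite big_ord0 expr0 subrr.
by rewrite big_ord_recr /= IH exprS; field.
Qed.

Lemma sum_inj_pair_le (F : nat -> nat -> R) (f : nat -> nat * nat) (M : nat) :
  (forall j i, 0 <= F j i) -> injective f ->
  exists K, \sum_(l < M) F (f l).1 (f l).2 <= \sum_(j < K) \sum_(i < K) F j i.
Proof.
move=> F0 finj; pose K := \max_(l < M) maxn (f l).1 (f l).2.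
have fK (l : 'I_M) : ((f l).1 < K.+1)%N /\ ((f l).2 < K.+1)%N.
  rewrite !ltnS; have := @leq_bigmax_cond _ xpredT (fun l : 'I_M => maxn (f l).1 (f l).2) l isT.
  by rewrite geq_max => /andP.
exists K.+1; rewrite pair_bigA /=.
pose h (l : 'I_M) : 'I_K.+1 * 'I_K.+1 := (inord (f l).1, inord (f l).2).
have hE (l : 'I_M) : f l = ((h l).1 : nat, (h l).2 : nat).
  by have [? ?] := fK l; rewrite /h /= !inordK //; case: (f l).
have hinj : injective h.
  by move=> l l' hl; apply/val_inj/finj; rewrite hE hl -hE.
rewrite (eq_bigr (fun l => F (h l).1 (h l).2)); last by move=> l _; rewrite {1 2}hE.
have -> : \sum_(l < M) F (h l).1 (h l).2 =
    \sum_(p in [set h x | x in predT]%SET) F p.1 p.2.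
  by rewrite big_imset //= => ? ? _ _; exact: hinj.
rewrite [leRHS](bigID [pred p | p \in [set h x | x in predT]%SET]) /=.
by rewrite lerDl sumr_ge0.
Qed.

(** The double family is enumerated by a bijection from [nat] to pairs. A finite stretch of the
    enumeration lies in a square [K] by [K], whose cost is at most the sum of the first [K] numbers
    [c j]. *)
Lemma coverable_bigcup g A (F : nat -> set 'rV[R]_n) (c : nat -> R) e :
  (forall x, 0 < x -> 0 <= g x) ->
  A `<=` \bigcup_j F j -> (forall j, coverable g (F j) (c j)) ->
  (forall M, \sum_(j < M) c j <= e) -> coverable g A e.
Proof.
move=> g0 AF /choice[U /choice[d Ud]] ce.
have /card_esym/ppcard_eqP[f] := card_nat2.
have finj : injective f by move=> x y; apply: inj; rewrite inE.
exists (fun l => U (f l).1 (f l).2), (fun l => d (f l).1 (f l).2); split.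
- by move=> i; case: (Ud (f i).1).
- move=> x /AF[j _ Fx]; have [_ /(_ _ Fx)[i _ Ux] _ _] := Ud j.
  have [l _ fl] : (f @` setT) (j, i) by exact: surj.
  by exists l => //=; rewrite fl.
- by move=> i x y; case: (Ud (f i).1) => _ _ /(_ (f i).2 x y).
- move=> M.
  have [|K] := @sum_inj_pair_le (fun j i => g (d j i)) f M _ finj.
    by move=> j i; case: (Ud j) => /(_ i)/g0.
  move=> /le_trans; apply; apply: le_trans (ce K); apply: ler_sum => j _.
  by case: (Ud j).
Qed.

(** A covering is an infinite sequence with positive [d i], so empty sets are appended after index
    [N]. The extra [e] pays for their sizes [tau i], whose powers are e * 2^(-i-1). *)
Lemma coverable_finite (s : R) (N : nat) (F : nat -> set 'rV[R]_n) (D e : R) :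
  0 < s -> 0 < D -> 0 < e ->
  (forall i x y, F i x -> F i y -> enorm (x - y) <= D) ->
  coverable (fun x => x `^ s) (\bigcup_(i in `I_N) F i) (N%:R * D `^ s + e).
Proof.
move=> s0 D0 e0 FD.
pose tau i := (e * 2^-1 ^+ i.+1) `^ s^-1.
have p0 i : 0 < e * 2^-1 ^+ i.+1 by rewrite mulr_gt0 // exprn_gt0 // invr_gt0.
have tau0 i : 0 < tau i by rewrite powR_gt0.
have tauE i : tau i `^ s = e * 2^-1 ^+ i.+1.
  by rewrite -powRrM mulVf ?gt_eqF // powRr1 // ltW.
exists (fun i => if (i < N)%N then F i else set0),
       (fun i => if (i < N)%N then D else tau i); split.
- by move=> i; case: ifP.
- by move=> x [i /= iN Fx]; exists i => //; rewrite iN.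
- by move=> i x y; case: ifP => // _; apply: FD.
- move=> M.
  apply: (@le_trans _ _ (\sum_(i < M) ((if (i < N)%N then D `^ s else 0)
      + e * 2^-1 ^+ i.+1))).
    apply: ler_sum => i _; case: ifP => _; last by rewrite add0r tauE.
    by rewrite lerDl ltW.
  rewrite big_split /= -mulr_sumr lerD //; last first.
    by rewrite -[leRHS]mulr1 ler_pM2l // sum_half_pow_le.
  rewrite -big_mkcond /=.
  apply: (@le_trans _ _ (\sum_(i < N) D `^ s)); last first.
    by rewrite sumr_const card_ord -[leLHS]mulr_natl.
  rewrite -(big_mkord (fun i => (i < N)%N) (fun=> D `^ s)).
  rewrite -(big_mkord xpredT (fun=> D `^ s)).
  rewrite [leLHS]big_mkcond /=.
  have -> : \sum_(0 <= i < N) D `^ s =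
      \sum_(0 <= i < maxn M N) (if (i < N)%N then D `^ s else 0).
    by rewrite (big_nat_widen 0 N (maxn M N)) ?leq_maxr // big_mkcond.
  rewrite [leRHS](big_cat_nat (leq0n M)) /= ?leq_maxl // lerDl sumr_ge0 // => i _.
  by case: ifP => // _; exact: powR_ge0.
Qed.

End coverings.

(** * Null sets of Hausdorff measures in terms of coverings *)

Section hausdorff_coverings.
Context {R : realType} {n : nat}.
Implicit Types (A : set 'rV[R]_n) (s e d : R).

Lemma ediam_ge0 A : (0 <= ediam A)%E.
Proof. by rewrite /ediam le_max lexx. Qed.

Lemma le_ediam A x y : A x -> A y -> ((enorm (x - y))%:E <= ediam A)%E.
Proof.
move=> Ax Ay; rewrite /ediam le_max; apply/orP; right.
by apply: ereal_sup_ubound; exists x, y.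
Qed.

Lemma ediam_le A d : 0 <= d -> (forall x y, A x -> A y -> enorm (x - y) <= d) ->
  (ediam A <= d%:E)%E.
Proof.
move=> d0 Ad; rewrite /ediam ge_max lee_fin d0 /=.
by apply: ge_ereal_sup => _ [x [y [Ax Ay ->]]]; rewrite lee_fin Ad.
Qed.

Lemma hausdorff_premeasure_ge0 s d A : (0 <= hausdorff_premeasure s d A)%E.
Proof.
apply: le_ereal_inf_tmp => _ [U _ <-].
by apply: nneseries_ge0 => i _ _; exact: poweR_ge0.
Qed.

Lemma coverable_hausdorff_measure0 s A : 0 < s ->
  (forall e, 0 < e -> coverable (fun x => x `^ s) A e) ->
  hausdorff_measure s A = 0%E.
Proof.
move=> s0 cA; apply/eqP; rewrite eq_le; apply/andP; split; last first.
  apply: le_trans (hausdorff_premeasure_ge0 s 1 A) _.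
  by apply: ereal_sup_ubound; exists 1 => //=; exact: ltr01.
apply: ge_ereal_sup => _ [delta /= delta0 <-].
apply/lee_addgt0Pr => e e0; rewrite add0e.
(* A total cost of at most delta^s bounds each single term, hence each [d i] by [delta]: a cheap
   cover is automatically fine. *)
have e'0 : 0 < Num.min e (delta `^ s) by rewrite lt_min e0 powR_gt0.
have [U [d [d0 AU Ud sd]]] := cA _ e'0.
have dU i : (ediam (U i) <= (d i)%:E)%E.
  by apply: ediam_le; [rewrite ltW|exact: Ud].
have dd i : d i <= delta.
  have : d i `^ s <= delta `^ s.
    apply: le_trans (_ : d i `^ s <= Num.min e (delta `^ s)) _.
      apply: le_trans (sd i.+1); rewrite big_ord_recr /= lerDr.
      by rewrite sumr_ge0 // => k _; exact: powR_ge0.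
    by rewrite ge_min lexx orbT.
  apply: contraTT; rewrite -!ltNge => h.
  by rewrite gt0_ltr_powR // nnegrE ltW.
have hU : (forall i, (ediam (U i) <= delta%:E)%E).
  by move=> i; apply: le_trans (dU i) _; rewrite lee_fin.
apply: (@le_trans _ _ (\sum_(0 <= i <oo) poweR (ediam (U i)) s)%E).
  by apply: ereal_inf_lbound; exists U.
apply: (@le_trans _ _ (\sum_(0 <= i <oo) (d i `^ s)%:E)%E).
  apply: lee_nneseries => [i _ _|i _]; first exact: poweR_ge0.
  rewrite -poweR_EFin gt0_ler_poweR ?(ltW s0) // in_itv /= leey andbT ?ediam_ge0 //.
  by rewrite lee_fin ltW.
apply: lime_le; first by apply: is_cvg_nneseries => i _ _; rewrite lee_fin powR_ge0.
apply: nearW => M; rewrite big_mkord sumEFin lee_fin.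
by apply: le_trans (sd M) _; rewrite ge_min lexx.
Qed.

(** The premeasure at scale 1 already vanishes. Diameters in a cheap cover may be 0, so each is
    raised to at least [tau i]; the powers of the [tau i] sum to at most e / 2. *)
Lemma hausdorff_measure0_coverable s A : 0 < s ->
  hausdorff_measure s A = 0%E ->
  forall e, 0 < e -> coverable (fun x => x `^ s) A e.
Proof.
move=> s0 A0 e e0.
have e20 : 0 < e / 2 by rewrite divr_gt0.
have : (hausdorff_premeasure s 1 A < (e / 2)%:E)%E.
  apply: le_lt_trans (_ : _ <= 0)%E _; last by rewrite lte_fin.
  by rewrite -A0; apply: ereal_sup_ubound; exists 1 => //=; exact: ltr01.
move=> /ereal_inf_lt[_ /= [U [AU dU] <-]] sU.
have dfin i : ediam (U i) \is a fin_num.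
  rewrite fin_numE; apply/andP; split.
    by rewrite gt_eqF // (lt_le_trans _ (ediam_ge0 _)) // ltNy0.
  by rewrite lt_eqF // (le_lt_trans (dU i)) // ltry.
pose D i := fine (ediam (U i)).
have DE i : ediam (U i) = (D i)%:E by rewrite /D fineK.
have D0 i : 0 <= D i by rewrite -lee_fin -DE ediam_ge0.
pose tau i := (e / 2 * 2^-1 ^+ i.+1) `^ s^-1.
have p0 i : 0 < e / 2 * 2^-1 ^+ i.+1 by rewrite mulr_gt0 // exprn_gt0 // invr_gt0.
have tau0 i : 0 < tau i by rewrite powR_gt0.
have tauE i : tau i `^ s = e / 2 * 2^-1 ^+ i.+1.
  by rewrite -powRrM mulVf ?gt_eqF // powRr1 // ltW.
exists U, (fun i => Num.max (D i) (tau i)); split => //.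
- by move=> i; rewrite lt_max tau0 orbT.
- by move=> i x y Ux Uy; rewrite le_max -lee_fin -DE le_ediam.
- move=> M.
  apply: (@le_trans _ _ (\sum_(i < M) (D i `^ s + tau i `^ s))).
    apply: ler_sum => i _; rewrite /Num.max; case: ifP => _.
      by rewrite lerDr powR_ge0.
    by rewrite lerDl powR_ge0.
  rewrite big_split /= [leRHS](splitr e) lerD //.
    rewrite -lee_fin -sumEFin; apply: ltW; apply: le_lt_trans sU.
    rewrite -(big_mkord xpredT (fun i => (D i `^ s)%:E)).
    under eq_bigr => i _ do rewrite -poweR_EFin -DE.
    by apply: nneseries_lim_ge => i _ _; exact: poweR_ge0.
  under eq_bigr => i _ do rewrite tauE.
  by rewrite -mulr_sumr -[leRHS]mulr1 ler_pM2l // sum_half_pow_le.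
Qed.

End hausdorff_coverings.

(** * Counting integers and grid indices *)

Section counting.
Context {R : realType}.

Lemma card_ord_itv_ge (K : nat) (a b : R) : 0 <= a -> b < K%:R ->
  b - a - 1 <= #|[set k : 'I_K | a <= k%:R <= b]%SET|%:R.
Proof.
move=> a0 bK; have [ba|ab] := ltP b a.
  by apply: le_trans (ler0n _ _); lra.
have b0 : 0 <= b by apply: le_trans ab.
pose p := Num.truncn a; pose q := Num.truncn b.
have /andP[pa ap] : p%:R <= a < p.+1%:R by apply: Num.Theory.truncn_itv.
have /andP[qb bq] : q%:R <= b < q.+1%:R by apply: Num.Theory.truncn_itv.
have qK : (q < K)%N by rewrite -(@ltr_nat R); apply: le_lt_trans bK.
apply: (@le_trans _ _ (q - p)%:R).
  have pq : (p <= q)%N.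
    by rewrite -ltnS -(@ltr_nat R); apply: le_lt_trans bq; apply: le_trans ab.
  by rewrite natrB // -!natr1 in ap bq *; lra.
rewrite ler_nat -[X in (X <= _)%N]card_ord.
have fK (i : 'I_(q - p)) : (p.+1 + i < K)%N.
  by apply: leq_ltn_trans qK; rewrite addSn -addnS -leq_subRL // ?leq_sub //;
     have := ltn_ord i; rewrite ltn_subRL => /ltnW; lia.
pose f (i : 'I_(q - p)) : 'I_K := Ordinal (fK i).
have finj : injective f.
  by move=> i j /(congr1 val) /= /addnI /val_inj.
rewrite -(card_imset _ finj); apply: subset_leq_card.
apply/fintype.subsetP => _ /imsetP[i _ ->]; rewrite inE /=.
have := ltn_ord i; rewrite ltn_subRL => iq.
apply/andP; split.
  by apply: le_trans (ltW ap) _; rewrite ler_nat leq_addr.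
by apply: le_trans qb; rewrite ler_nat addSn.
Qed.

Lemma card_ord_diam_le (K : nat) (S : {set 'I_K}) (l : R) : 0 <= l ->
  (forall i j : 'I_K, i \in S -> j \in S -> i%:R - j%:R <= l) ->
  #|S|%:R <= l + 1.
Proof.
move=> l0 Sl; have [->|/set0Pn[k kS]] := eqVneq S finset.set0.
  by rewrite cards0 addr_ge0.
pose k0 := [arg min_(i < k in S) (i : nat)].
have [k0S k0min] : k0 \in S /\ forall i, i \in S -> (k0 <= i)%N.
  by rewrite /k0; case: arg_minnP.
pose q := Num.truncn l.
have /andP[ql lq] : q%:R <= l < q.+1%:R by apply: Num.Theory.truncn_itv.
apply: (@le_trans _ _ q.+1%:R); last by rewrite -natr1 lerD2r.
rewrite ler_nat -[X in (_ <= X)%N]card_ord.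
pose f (i : 'I_K) : 'I_q.+1 := inord (i - k0)%N.
have fE i : i \in S -> f i = (i - k0)%N :> nat.
  move=> iS; rewrite inordK // -(@ltr_nat R) natrB ?k0min //.
  exact: le_lt_trans (Sl _ _ iS k0S) lq.
have finj : {in S &, injective f}.
  move=> i j iS jS /(congr1 val); rewrite /= !fE // => ij.
  by apply: val_inj => /=; rewrite -(subnK (k0min _ iS)) ij subnK ?k0min.
by rewrite -(card_in_imset finj) max_card.
Qed.

Lemma card_ffun_prod (T : finType) (K : nat) (S : T -> {set 'I_K}) :
  #|[set f : {ffun T -> 'I_K} | [forall i, f i \in S i]]%SET| =
  (\prod_i #|S i|)%N.
Proof.
rewrite -(@eq_card _ (family (fun i => mem (S i)))) ?card_family.
  by rewrite foldrE big_map big_enum.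
by move=> f; rewrite !inE; apply: eq_forallb => i; rewrite ?inE.
Qed.

End counting.

(** * The gauge with a logarithmic factor *)

Section gauge.
Context {R : realType}.
Implicit Types t s x y : R.

Lemma powR_le1 x t : 0 <= t -> 0 <= x <= 1 -> x `^ t <= 1.
Proof.
move=> t0 /andP[x0 x1]; have h : 1 `^ t = 1 :> R by rewrite powR1.
by rewrite -h ge0_ler_powR // nnegrE.
Qed.

(* The constant [1 + t^-1] makes the gauge increasing on ]0, 1]. *)
Definition gauge t x : R := x `^ t * (1 + t^-1 - ln x).

Lemma gauge_gt0 t x : 0 < t -> 0 < x <= 1 -> 0 < gauge t x.
Proof.
move=> t0 /andP[x0 x1]; rewrite mulr_gt0 ?powR_gt0 //.
have := ln_le0 x1; have : 0 < t^-1 by rewrite invr_gt0.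
lra.
Qed.

Lemma gauge_le t x y : 0 < t -> 0 < x -> x <= y -> y <= 1 ->
  gauge t x <= gauge t y.
Proof.
move=> t0 x0 xy y1; have y0 : 0 < y by exact: lt_le_trans xy.
have t1 : 0 < t^-1 by rewrite invr_gt0.
have lny : ln y <= 0 by exact: ln_le0.
pose u := x / y.
have u0 : 0 < u by rewrite divr_gt0.
have xE : x = u * y by rewrite divfK ?gt_eqF.
(* With v = u^(-t) this is the inequality 1 + ln v <= v. It is paired below with the summand [t^-1]
   of the gauge. *)
have key : u `^ t * (1 - t * ln u) <= 1.
  have v0 : 0 < u `^ (- t) by rewrite powR_gt0.
  have : 1 - t * ln u <= u `^ (- t).
    have := le_ln1Dx (x := u `^ (- t) - 1).
    by rewrite subrKC ln_powR ltrBrDl subrr => /(_ v0); lra.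
  move=> /(ler_wpM2l (powR_ge0 u t)) /le_trans; apply.
  by rewrite powRN divff // gt_eqF // powR_gt0.
have u1 : u `^ t <= 1.
  by rewrite powR_le1 // ?(ltW t0) // (ltW u0) /= ler_pdivrMr // mul1r.
rewrite /gauge xE powRM ?(ltW u0) ?(ltW y0) // lnM ?posrE // mulrAC [leRHS]mulrC.
apply: ler_wpM2r; first exact: powR_ge0.
have -> : u `^ t * (1 + t^-1 - (ln u + ln y)) =
    u `^ t * (1 - ln y) + t^-1 * (u `^ t * (1 - t * ln u)).
  by field; rewrite gt_eqF.
have h1 : u `^ t * (1 - ln y) <= 1 - ln y by rewrite ler_piMl //; lra.
have h2 : t^-1 * (u `^ t * (1 - t * ln u)) <= t^-1 by rewrite ler_piMr // (ltW t1).
lra.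
Qed.

(** Passing from [y] down to [x] divides the gauge by at most (y / x)^d, because t <= d and the
    logarithmic factor only grows. This compares the cost of a set with the number of grid cells
    that it meets. *)
Lemma gauge_ratio t (d : nat) x y : 0 < t <= d%:R -> 0 < x -> x <= y ->
  y <= 1 -> (x / y) ^+ d * gauge t y <= gauge t x.
Proof.
move=> /andP[t0 td] x0 xy y1; have y0 : 0 < y by exact: lt_le_trans xy.
have t1 : 0 < t^-1 by rewrite invr_gt0.
have lny : ln y <= 0 by exact: ln_le0.
have lxy : ln x <= ln y by rewrite ler_ln ?posrE.
have u0 : 0 < x / y by rewrite divr_gt0.
have ux : x / y * y = x by rewrite divfK ?gt_eqF.
rewrite /gauge mulrA; apply: ler_pM.
- by rewrite mulr_ge0 ?exprn_ge0 ?powR_ge0 // ltW.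
- lra.
- rewrite -[in leRHS]ux powRM ?(ltW u0) ?(ltW y0) // ler_wpM2r ?powR_ge0 //.
  rewrite -powR_mulrn ?(ltW u0) // ger_powR // u0 /=.
  by rewrite ler_pdivrMr // mul1r.
- lra.
Qed.

Lemma gauge_le_powR s t : s < t -> 0 < t ->
  exists2 c, 0 < c <= 1 & forall x, 0 < x <= c -> gauge t x <= x `^ s.
Proof.
move=> st t0; pose u := t - s; have u0 : 0 < u by rewrite subr_gt0.
have t1 : 0 < t^-1 by rewrite invr_gt0.
(* Half of the gain [u] in the exponent absorbs the logarithm, by ln v < v at v = x^(-u/2). The
   other half absorbs the constant [b], which dictates the range x <= b^(-2/u). *)
pose b := 1 + t^-1 + 2 / u.
have iu0 : 0 < 2 / u by rewrite divr_gt0.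
have b1 : 1 <= b by rewrite /b; lra.
have b0 : 0 < b by rewrite /b; lra.
have c0 : 0 < b `^ (- (2 / u)) by rewrite powR_gt0.
exists (b `^ (- (2 / u))).
  by rewrite c0 /= powRN invf_le1 ?powR_gt0 // -[leLHS](powRr0 b) ler_powR // (ltW iu0).
move=> x /andP[x0 xc].
have x1 : x <= 1.
  by apply: le_trans xc _; rewrite powRN invf_le1 ?powR_gt0 // -[leLHS](powRr0 b)
     ler_powR // (ltW iu0).
have -> : x `^ s = x `^ t * x `^ (- u).
  by rewrite -powRD ?(gt_eqF x0) ?implybT // /u; congr (_ `^ _); ring.
rewrite /gauge ler_wpM2l ?powR_ge0 //.
have v0 : 0 < x `^ (- (u / 2)) by rewrite powR_gt0.
have v1 : 1 <= x `^ (- (u / 2)).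
  by rewrite powRN invf_ge1 ?powR_gt0 // powR_le1 // ?divr_ge0 ?(ltW u0) //= (ltW x0).
have h : - ln x <= 2 / u * x `^ (- (u / 2)).
  have := ln_sublinear v0; rewrite ln_powR => /ltW h.
  rewrite -ler_pdivrMl // invf_div.
  by apply: le_trans h; rewrite mulNr mulrN.
have h2 : b <= x `^ (- (u / 2)).
  have : x `^ (u / 2) <= b `^ (- (2 / u)) `^ (u / 2).
    by rewrite ge0_ler_powR // ?nnegrE ?divr_ge0 // ?(ltW u0) ?(ltW x0) ?(ltW c0).
  rewrite -powRrM (_ : - (2 / u) * (u / 2) = - 1); last by field; rewrite gt_eqF.
  rewrite (powRN b) powRr1 ?(ltW b0) // (powRN x) => h2.
  by rewrite -(invrK b) lef_pV2 // posrE ?invr_gt0 ?powR_gt0.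
have -> : x `^ (- u) = x `^ (- (u / 2)) * x `^ (- (u / 2)).
  by rewrite -powRD ?(gt_eqF x0) ?implybT //; congr (_ `^ _); field.
apply: le_trans (_ : b * x `^ (- (u / 2)) <= _); last by rewrite ler_wpM2r // (ltW v0).
rewrite {1}/b; nra.
Qed.

End gauge.

(** * Light cubes: one step of the nested construction *)

Section ubiquity.
Context {R : realType} {d : nat}.
Implicit Types (c x : 'rV[R]_d) (w r t : R) (m : nat).

Definition cube c r : set 'rV[R]_d :=
  [set x | forall i, `|x ord0 i - c ord0 i| <= r].

Definition hits (V : set 'rV[R]_d) c r := exists x, V x /\ cube c r x.

Definition grid_point w m (k : {ffun 'I_d -> 'I_m}) : 'rV[R]_d :=
  \row_i (w * (k i)%:R / m%:R).

Lemma grid_pointE w m (k : {ffun 'I_d -> 'I_m}) j :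
  grid_point w k ord0 j = w / m%:R * (k j)%:R.
Proof. by rewrite mxE mulrAC. Qed.

(** The factor 8^d converts the (4 r / s)^d of [card_heavy_large] into the (r / (2 s))^d of
    [card_children_ge]; the factor 4 leaves a quarter of the children to the large sets. *)
Definition eta : R := (8 ^+ d * 4)^-1.

Variables (V : nat -> set 'rV[R]_d) (D : nat -> R) (t : R).
Hypothesis t0d : 0 < t <= d%:R.
Hypothesis D01 : forall i, 0 < D i <= 1.
Hypothesis VD : forall i x y, V i x -> V i y ->
  forall j, `|x ord0 j - y ord0 j| <= D i.

(** The invariant of the construction. By [light_hits_lt] a light cube of radius [r] is hit only by
    sets with [D i < r], so a point lying in light cubes of radii tending to 0 belongs to no
    [V i]. *)
Definition light c r :=
  forall M, \sum_(i < M | `[< hits (V i) c r >]) gauge t (D i) <= eta * gauge t r.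

Let t0 : 0 < t. Proof. by case/andP: t0d. Qed.

Lemma eta01 : 0 < eta < 1.
Proof.
have h : 1 <= 8 ^+ d :> R by rewrite exprn_ege1 // ler1n.
have h4 : 1 < 8 ^+ d * 4 :> R by lra.
by rewrite /eta invr_gt0 invf_lt1 // (lt_trans ltr01 h4) h4.
Qed.

Lemma hits_sub (U : set 'rV[R]_d) c r c' r' :
  cube c' r' `<=` cube c r -> hits U c' r' -> hits U c r.
Proof. by move=> s [x [Ux /s cx]]; exists x. Qed.

Lemma gauge_D_gt0 i : 0 < gauge t (D i).
Proof. exact: gauge_gt0. Qed.

Lemma light_hits_lt c r i : 0 < r <= 1 -> light c r -> hits (V i) c r ->
  gauge t (D i) <= eta * gauge t r /\ D i < r.
Proof.
move=> r01 L h; have gr := gauge_gt0 t0 r01.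
have /andP[eta0 eta1] := eta01.
have gi : gauge t (D i) <= eta * gauge t r.
  apply: le_trans (L i.+1); rewrite (bigD1 ord_max) /=; last by apply/asboolP.
  by rewrite lerDl sumr_ge0 // => k _; rewrite ltW // gauge_D_gt0.
split=> //; rewrite ltNge; apply/negP => rD.
have /andP[Di0 Di1] := D01 i.
have := gauge_le t0 (proj1 (andP r01)) rD Di1.
by move=> /le_trans /(_ gi); rewrite leNgt gtr_pMl // eta1.
Qed.

(** Two grid points whose cubes meet the same set differ in each coordinate by at most D i + 2 r,
    and r is at most a quarter of the spacing s = w / m. This leaves at most D i / s + 3 / 2 indices
    per coordinate. *)
Lemma card_hit_le w m r (X : {set {ffun 'I_d -> 'I_m}}) i :
  0 < w -> (0 < m)%N -> 0 <= r -> r <= w / m%:R / 4 ->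
  (forall k, k \in X -> hits (V i) (grid_point w k) r) ->
  #|X|%:R <= (D i / (w / m%:R) + 3 / 2) ^+ d.
Proof.
move=> w0 m0 r0 rw Xh; have /andP[Di0 _] := D01 i.
have mR : 0 < m%:R :> R by rewrite ltr0n.
pose s := w / m%:R; have s0 : 0 < s by rewrite divr_gt0.
have Xd k k' : k \in X -> k' \in X -> forall j : 'I_d,
    (k j)%:R - (k' j)%:R <= D i / s + 1 / 2.
  move=> /Xh[x [Vx cx]] /Xh[x' [Vx' cx']] j.
  have := VD Vx Vx' j; have := cx j; have := cx' j; rewrite !grid_pointE.
  rewrite -/s !ler_distl => /andP[h1 h2] /andP[h3 h4] /andP[h5 h6].
  rewrite -(ler_pM2l s0) [leRHS]mulrDr [s * (D i / s)]mulrC divfK ?gt_eqF //.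
  move: rw; rewrite -/s; lra.
pose S j : {set 'I_m} := [set k j | k : {ffun 'I_d -> 'I_m} in X]%SET.
have S1 j : #|S j|%:R <= D i / s + 3 / 2 :> R.
  have l0 : 0 <= D i / s + 1 / 2 by rewrite addr_ge0 // divr_ge0 // ltW.
  apply: le_trans (card_ord_diam_le l0 _) _; last by lra.
  by move=> _ _ /imsetP[k kX ->] /imsetP[k' k'X ->]; exact: Xd.
apply: (@le_trans _ _ (\prod_(j < d) #|S j|)%:R).
  rewrite ler_nat -card_ffun_prod; apply: subset_leq_card.
  apply/fintype.subsetP => k kX; rewrite inE; apply/forallP => j.
  by apply/imsetP; exists k.
rewrite natr_prod -[X in _ ^+ X]card_ord -prodr_const.
by apply: ler_prod => j _; rewrite ler0n S1.
Qed.

Lemma card_hit_small w m r (X : {set {ffun 'I_d -> 'I_m}}) i :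
  0 < w -> (0 < m)%N -> 0 <= r -> r <= w / m%:R / 4 -> D i < w / m%:R / 2 ->
  (forall k, k \in X -> hits (V i) (grid_point w k) r) ->
  (#|X| <= 1)%N.
Proof.
move=> w0 m0 r0 rw Dw Xh.
have mR : 0 < m%:R :> R by rewrite ltr0n.
apply/card_le1_eqP => k k' kX k'X; apply/ffunP => j; apply/val_inj/eqP => /=.
suff H a b : a \in X -> b \in X -> (a j <= b j)%N.
  by rewrite eqn_leq !H.
move: kX k'X => _ _ /Xh[x [Vx cx]] /Xh[x' [Vx' cx']].
pose s := w / m%:R; have s0 : 0 < s by rewrite divr_gt0.
rewrite leqNgt; apply/negP; rewrite -(ltr_nat R) => ab.
have {}ab : (b j)%:R + 1 <= (a j)%:R :> R by rewrite natr1 ler_nat -(ltr_nat R).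
have := VD Vx Vx' j; have := cx j; have := cx' j; rewrite !grid_pointE.
rewrite -/s !ler_distl => /andP[h1 h2] /andP[h3 h4] /andP[h5 h6].
move: ab rw Dw; rewrite -(ler_pM2l s0) -/s; lra.
Qed.

Lemma card_children_ge w m c r : 0 < w -> (0 < m)%N -> 0 < r ->
  2 * (w / m%:R) <= r ->
  (forall i, r <= c ord0 i <= w - r) ->
  (r / (2 * (w / m%:R))) ^+ d <=
  #|[set k : {ffun 'I_d -> 'I_m} |
      [forall i, `|grid_point w k ord0 i - c ord0 i| <= r / 2]]%SET|%:R.
Proof.
move=> w0 m0 r0 wr cr.
have mR : 0 < m%:R :> R by rewrite ltr0n.
pose s := w / m%:R; have s0 : 0 < s by rewrite divr_gt0.
pose S i := [set k : 'I_m | (c ord0 i - r / 2) / s <= k%:R <=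
   (c ord0 i + r / 2) / s]%SET.
have -> : [set k : {ffun 'I_d -> 'I_m} |
      [forall i, `|grid_point w k ord0 i - c ord0 i| <= r / 2]]%SET =
    [set k : {ffun 'I_d -> 'I_m} | [forall i, k i \in S i]]%SET.
  apply/setP => k; rewrite !inE; apply: eq_forallb => i; rewrite !inE grid_pointE.
  by rewrite -/s ler_distl ler_pdivrMr // ler_pdivlMr // [s * _]mulrC.
rewrite card_ffun_prod natr_prod -[X in _ ^+ X]card_ord -prodr_const.
apply: ler_prod => i _; apply/andP; split.
  by rewrite divr_ge0 ?(ltW r0) // mulr_ge0 // ltW.
have /andP[c1 c2] := cr i.
(* Each coordinate has at least r / s - 1 admissible indices, and this is at least r / (2 s) because
   r >= 2 s. *)
apply: le_trans (card_ord_itv_ge _ _); last 2 first.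
- by rewrite divr_ge0 ?(ltW s0) //; lra.
- rewrite ltr_pdivrMr // /s [m%:R * _]mulrC divfK ?gt_eqF //; lra.
rewrite -mulrBl -/s (_ : _ - (c ord0 i - r / 2) = r); last by field.
rewrite invfM mulrA mulrAC; have : 2 <= r / s by rewrite ler_pdivlMr.
by move: (r / s) => z ?; lra.
Qed.

Lemma exists_outside (T : finType) (N A B : {set T}) :
  #|A|%:R + #|B|%:R < #|N|%:R :> R -> exists k, [/\ k \in N, k \notin A & k \notin B].
Proof.
rewrite -natrD ltr_nat => h.
have /subsetPn[k kN] : ~~ (N \subset A :|: B).
  apply: contraL h => /subset_leq_card h; rewrite -leqNgt.
  by apply: leq_trans h _; rewrite cardsU leq_subr.
by rewrite inE negb_or => /andP[kA kB]; exists k.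
Qed.

(** Volume count for the sets of size at least half the spacing s. Such a set meets at most (4 D i /
    s)^d children, which by [gauge_ratio] is at most (4 r / s)^d / gauge t r times its own cost;
    lightness of the parent bounds the sum of the costs. *)
Lemma card_heavy_large w m c r r' (X : {set {ffun 'I_d -> 'I_m}}) :
  0 < w -> (0 < m)%N -> 0 <= r' -> r' <= w / m%:R / 4 -> 0 < r <= 1 ->
  light c r ->
  (forall k, k \in X -> cube (grid_point w k) r' `<=` cube c r) ->
  (forall k, k \in X -> exists2 i, w / m%:R / 2 <= D i &
     hits (V i) (grid_point w k) r') ->
  #|X|%:R <= (r / (2 * (w / m%:R))) ^+ d / 4.
Proof.
move=> w0 m0 r'0 r'w r01 L Xsub Xhit.
have mR : 0 < m%:R :> R by rewrite ltr0n.
have [r0 _] := andP r01.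
pose s := w / m%:R; have s0 : 0 < s by rewrite divr_gt0.
have gr := gauge_gt0 t0 r01.
(* Each spoiled child is charged to a single large set that hits it, which partitions [X]. *)
have /choice[iota iotaP] : forall k, exists i, k \in X ->
    s / 2 <= D i /\ hits (V i) (grid_point w k) r'.
  move=> k; have [/Xhit[i h1 h2]|_] := boolP (k \in X); first by exists i.
  by exists 0%N.
pose M := (\max_(k in X) iota k).+1.
pose Y (i : 'I_M) := [set k in X | iota k == i]%SET.
have YE : #|X| = (\sum_(i < M) #|Y i|)%N.
  have iM k : k \in X -> (iota k < M)%N.
    by move=> kX; rewrite ltnS; apply: (leq_bigmax_cond (F := iota)).
  rewrite -sum1_card (partition_big (fun k => inord (iota k) : 'I_M) xpredT) //=.
  apply: eq_bigr => i _; rewrite -sum1_card; apply: eq_bigl => k.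
  rewrite !inE; have [kX|//] := boolP (k \in X) => /=.
  by rewrite -val_eqE /= inordK ?iM.
have Ybound (i : 'I_M) : #|Y i|%:R <= if `[< hits (V i) c r >] then
    (4 * r / s) ^+ d / gauge t r * gauge t (D i) else 0.
  have [->|/set0Pn[k]] := eqVneq (Y i) finset.set0.
    rewrite cards0; case: ifP => // _; rewrite mulr_ge0 ?ltW ?gauge_D_gt0 //.
    by rewrite divr_gt0 // exprn_gt0 // divr_gt0 // mulr_gt0.
  rewrite inE => /andP[kX /eqP ki].
  have [Di hk] := iotaP k kX; rewrite ki in Di hk.
  have hc : hits (V i) c r := hits_sub (Xsub k kX) hk.
  rewrite asboolT //.
  have [_ Dr] := light_hits_lt r01 L hc.
  have /andP[Di0 _] := D01 i.
  apply: le_trans (card_hit_le (i := i) w0 m0 r'0 r'w _) _.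
    by move=> k'; rewrite inE => /andP[k'X /eqP <-]; case: (iotaP k' k'X).
  apply: (@le_trans _ _ ((4 * D i / s) ^+ d)).
    rewrite lerXn2r ?nnegrE //.
    - by rewrite addr_ge0 // divr_ge0 // ltW.
    - by rewrite divr_ge0 // ?mulr_ge0 // ltW.
    (* As D i / s is at least 1 / 2, the summand 3 / 2 is at most 3 D i / s. *)
    - rewrite -/s -mulrA; have : 1 / 2 <= D i / s by rewrite ler_pdivlMr // mulrC mul1r.
      by move: (D i / s) => z; lra.
  have -> : 4 * D i / s = 4 * r / s * (D i / r) by field; rewrite !gt_eqF.
  have r1 : r <= 1 by case/andP: r01.
  rewrite exprMn -!mulrA ler_wpM2l //.
    by rewrite exprn_ge0 // mulr_ge0 // mulr_ge0 // ?invr_ge0 ltW.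
  by rewrite ler_pdivlMl // mulrC (gauge_ratio t0d Di0 (ltW Dr)).
rewrite YE natr_sum; apply: le_trans (ler_sum _ (fun i _ => Ybound i)) _.
rewrite -big_mkcond /= -mulr_sumr.
have h : 0 <= (4 * r / s) ^+ d / gauge t r.
  by rewrite divr_ge0 ?(ltW gr) // exprn_ge0 // divr_ge0 ?(ltW s0) // mulr_ge0 // ltW.
apply: le_trans (ler_wpM2l h (L M)) _.
rewrite mulrACA mulVf ?gt_eqF // mulr1 /eta.
rewrite (_ : 4 * r / s = 8 * (r / (2 * s))); last by field; rewrite gt_eqF.
move: (r / _) => z.
by rewrite exprMn invfM mulrACA divff ?mul1r // gt_eqF // exprn_gt0.
Qed.

(** A set smaller than half the spacing hits at most one child. The costs that make different
    children heavy therefore come from different sets and fit together into the budget of the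
    parent. *)
Lemma card_heavy_small w m c r r' (X : {set {ffun 'I_d -> 'I_m}}) :
  0 < w -> (0 < m)%N -> 0 < r' -> r' <= w / m%:R / 4 -> light c r ->
  (forall k, k \in X -> cube (grid_point w k) r' `<=` cube c r) ->
  (forall k, k \in X -> exists M, eta * gauge t r' <
     \sum_(i < M | (D i < w / m%:R / 2) &&
       `[< hits (V i) (grid_point w k) r' >]) gauge t (D i)) ->
  #|X|%:R * gauge t r' <= gauge t r.
Proof.
move=> w0 m0 r'0 r'w L Xsub Xheavy.
have /andP[eta0 _] := eta01.
pose F (k : {ffun 'I_d -> 'I_m}) M := \sum_(i < M | (D i < w / m%:R / 2) &&
       `[< hits (V i) (grid_point w k) r' >]) gauge t (D i).
have Fmono (k : {ffun 'I_d -> 'I_m}) M M' : (M <= M')%N -> F k M <= F k M'.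
  move=> MM; rewrite /F.
  rewrite -!(big_mkord (fun i => (D i < w / m%:R / 2) &&
       `[< hits (V i) (grid_point w k) r' >]) (fun i => gauge t (D i))).
  rewrite [leRHS](big_cat_nat (leq0n M)) //= lerDl sumr_ge0 // => i _.
  by rewrite ltW // gauge_D_gt0.
have /choice[mu muP] : forall k, exists M, k \in X -> eta * gauge t r' < F k M.
  move=> k; have [/Xheavy[M h]|_] := boolP (k \in X); first by exists M.
  by exists 0%N.
pose M := \max_(k in X) mu k.
have XM k : k \in X -> eta * gauge t r' <= F k M.
  move=> kX; apply: le_trans (ltW (muP k kX)) _; apply: Fmono.
  exact: (leq_bigmax_cond (F := mu)).
rewrite -(ler_pM2l eta0); apply: le_trans (L M).
rewrite mulrCA [leLHS]mulrC.
apply: (@le_trans _ _ (\sum_(k in X) F k M)).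
  rewrite mulr_natr -sumr_const; exact: ler_sum.
rewrite /F; under eq_bigr do rewrite big_mkcond.
rewrite exchange_big /= [leRHS]big_mkcond; apply: ler_sum => i _.
have gi := gauge_D_gt0 i.
case: ifPn => [hc|/asboolPn hc]; last first.
  rewrite big1 // => k kX; case: ifPn => // /andP[_ /asboolP hk].
  by exfalso; apply: hc; exact: hits_sub (Xsub k kX) hk.
have [Ds|Ds] := boolP (D i < w / m%:R / 2); last by rewrite big1 //= ltW.
rewrite /= -big_mkcondr /=.
pose Y := [set k in X | `[< hits (V i) (grid_point w k) r' >]]%SET.
have Y1 : (#|Y| <= 1)%N.
  apply: (card_hit_small w0 m0 (ltW r'0) r'w Ds) => k.
  by rewrite inE => /andP[_ /asboolP].
apply: (@le_trans _ _ (\sum_(k in Y) gauge t (D i))).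
  by rewrite le_eqVlt; apply/orP; left; apply/eqP/eq_bigl => k; rewrite inE.
by rewrite sumr_const -[leLHS]mulr_natl ler_piMl ?(ltW gi) // lern1.
Qed.

(** There are at least (r / (2 s))^d children, with s = w / m. Large sets spoil at most a quarter of
    this number and small sets less than three quarters. For the second count, r'^t = b^t m^(-d)
    alone would only allow a fixed multiple of m^d spoiled children; the logarithm in the gauge
    divides this by ln m, and the last hypothesis asks [m] to be large enough to profit from it. *)
Lemma light_child w m c r b (r' := b * m%:R `^ (- (d%:R / t))) :
  0 < w <= 1 -> (0 < m)%N -> 0 < b <= w / 4 -> 0 < r <= 1 ->
  (forall i, r <= c ord0 i <= w - r) -> light c r ->
  2 * (w / m%:R) <= r -> r' <= r / 2 ->
  gauge t r < 3 / 4 * (r / (2 * w)) ^+ d * b `^ t * ln m%:R ->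
  exists k : {ffun 'I_d -> 'I_m},
    [/\ cube (grid_point w k) r' `<=` cube c r,
      light (grid_point w k) r' &
      forall i, r' <= grid_point w k ord0 i <= w - r'].
Proof.
move=> /andP[w0 w1] m0 /andP[b0 bw] r01 cr L wr r'r big.
have [r0 r1] := andP r01.
have [_ td] := andP t0d.
have mR : 0 < m%:R :> R by rewrite ltr0n.
have m1 : 1 <= m%:R :> R by rewrite ler1n.
have mp0 : 0 < m%:R `^ (- (d%:R / t)) :> R by rewrite powR_gt0.
have r'0 : 0 < r' by rewrite mulr_gt0.
(* Since t <= d, the power m^(-d/t) is at most 1 / m. *)
have r'w : r' <= w / m%:R / 4.
  rewrite mulrAC /r' ler_pM // ?(ltW b0) ?(ltW mp0) //.
  rewrite -(powR_inv1 (ltW mR)) ler_powR // lerN2.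
  by rewrite ler_pdivlMr // mul1r.
have r'1 : r' <= 1 by lra.
have gr' : b `^ t * m%:R ^- d * ln m%:R <= gauge t r'.
  rewrite /gauge /r' powRM ?(ltW b0) ?(ltW mp0) // -powRrM mulNr divfK ?gt_eqF //.
  rewrite powR_invn ?(ltW mR) // ler_wpM2l //.
    by rewrite mulr_ge0 ?powR_ge0 // invr_ge0 exprn_ge0 // ltW.
  rewrite lnM ?posrE // ln_powR.
  have lc : ln b <= 0 by apply: ln_le0; lra.
  have lm : 0 <= ln m%:R :> R by exact: ln_ge0.
  have : ln m%:R <= d%:R / t * ln m%:R :> R.
    by rewrite -[leLHS]mul1r ler_wpM2r // ler_pdivlMr // mul1r.
  have : 0 < t^-1 by rewrite invr_gt0.
  lra.
pose N := [set k : {ffun 'I_d -> 'I_m} |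
      [forall i, `|grid_point w k ord0 i - c ord0 i| <= r / 2]]%SET.
have NE k : k \in N -> forall i, `|grid_point w k ord0 i - c ord0 i| <= r / 2.
  by rewrite inE => /forallP.
have Nsub k : k \in N -> cube (grid_point w k) r' `<=` cube c r.
  move=> /NE kN x kx i; have := kN i; have := kx i.
  rewrite !ler_distl => /andP[h1 h2] /andP[h3 h4].
  by clear -h1 h2 h3 h4 r'r; apply/andP; split; lra.
pose A := [set k in N | `[< exists2 i, w / m%:R / 2 <= D i &
     hits (V i) (grid_point w k) r' >]]%SET.
pose B := [set k in N | `[< exists M, eta * gauge t r' <
     \sum_(i < M | (D i < w / m%:R / 2) &&
       `[< hits (V i) (grid_point w k) r' >]) gauge t (D i) >]]%SET.
have cardA : #|A|%:R <= (r / (2 * (w / m%:R))) ^+ d / 4.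
  apply: (card_heavy_large w0 m0 (ltW r'0) r'w r01 L) => k;
    rewrite inE => /andP[kN]; first by move=> _; exact: Nsub.
  by move/asboolP.
have cardB : #|B|%:R * gauge t r' <= gauge t r.
  apply: (card_heavy_small w0 m0 r'0 r'w L) => k;
    rewrite inE => /andP[kN]; first by move=> _; exact: Nsub.
  by move/asboolP.
have cardN := card_children_ge w0 m0 r0 wr cr.
have [k [kN kA kB]] : exists k, [/\ k \in N, k \notin A & k \notin B].
  apply: exists_outside; apply: lt_le_trans cardN.
  have B34 : #|B|%:R < 3 / 4 * (r / (2 * (w / m%:R))) ^+ d.
    have g0 : 0 < gauge t r' by rewrite gauge_gt0 // r'0.
    rewrite -(ltr_pM2r g0); apply: le_lt_trans cardB _.
    apply: lt_le_trans big _.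
    rewrite (_ : r / (2 * (w / m%:R)) = r / (2 * w) * m%:R); last first.
      by field; rewrite !gt_eqF.
    have z0 : 0 < r / (2 * w) by rewrite divr_gt0 // mulr_gt0.
    have zd0 : 0 < (r / (2 * w)) ^+ d by rewrite exprn_gt0.
    have md0 : 0 < m%:R ^+ d :> R by rewrite exprn_gt0.
    rewrite [X in _ <= _ * X * _]exprMn; move: zd0 md0 gr'.
    move: ((r / (2 * w)) ^+ d) (m%:R ^+ d) (gauge t r') (b `^ t) (ln _) => Z Y g p q Z0 Y0 gr'.
    have -> : 3 / 4 * Z * p * q = 3 / 4 * (Z * Y) * (p * Y^-1 * q).
      by field; rewrite gt_eqF.
    by rewrite ler_wpM2l // mulr_ge0 // mulr_ge0 // ltW.
  lra.
exists k; split; first exact: Nsub.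
  (* As [k] is not in [A], only small sets hit this child; its full sum is then the one bounded
     because [k] is not in [B]. *)
  move=> M; move: kB; rewrite inE kN /= => /asboolPn/forallNP/(_ M)/negP.
  rewrite -leNgt => /(le_trans _); apply; rewrite le_eqVlt; apply/orP; left.
  apply/eqP/eq_bigl => i; have [Di|Di] //= := ltP; apply/asboolPn => hk.
  by move: kA; rewrite inE kN /= => /asboolPn; apply; exists i.
move=> i; have := NE k kN i; have /andP[u1 u2] := cr i.
rewrite ler_distl => /andP[u3 u4]; clear -u1 u2 u3 u4 r'r; apply/andP; split; lra.
Qed.

End ubiquity.

(** * Points near infinitely many grids and outside a cheap cover *)

Section ubiquity_theorem.
Context {R : realType} {d : nat}.

Lemma nested_cubes (u : nat -> 'rV[R]_d * R) : (forall k, 0 <= (u k).2) ->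
  (forall k, cube (u k.+1).1 (u k.+1).2 `<=` cube (u k).1 (u k).2) ->
  exists x, forall k, cube (u k).1 (u k).2 x.
Proof.
move=> u0 usub.
pose lo k i := (u k).1 ord0 i - (u k).2.
pose hi k i := (u k).1 ord0 i + (u k).2.
have step k i : lo k i <= lo k.+1 i /\ hi k.+1 i <= hi k i.
  (* Moving all coordinates of the centre by the same amount up to the radius turns inclusion of
     cubes into inclusion of coordinate intervals. *)
  have corner e : `|e| <= (u k.+1).2 -> lo k i <= (u k.+1).1 ord0 i + e <= hi k i.
    move=> he; have /usub/(_ i) : cube (u k.+1).1 (u k.+1).2 ((u k.+1).1 + const_mx e).
      by move=> j; rewrite !mxE addrAC subrr add0r.
    by rewrite !mxE ler_distl.
  split.
    by have /andP[] : lo k i <= (u k.+1).1 ord0 i + - (u k.+1).2 <= hi k i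
      by apply: corner; rewrite normrN ger0_norm.
  by have /andP[] : lo k i <= (u k.+1).1 ord0 i + (u k.+1).2 <= hi k i
    by apply: corner; rewrite ger0_norm.
have lohi k l i : lo k i <= hi l i.
  have lo_mono : {homo lo^~ i : k l / (k <= l)%N >-> k <= l}.
    by apply: homo_leq => [x|x y z|j]; [exact: lexx|exact: le_trans|case: (step j i)].
  have hi_mono : {homo hi^~ i : k l / (k <= l)%N >-> l <= k}.
    apply: homo_leq => [x|y x z xy yz|j]; [exact: lexx| |by case: (step j i)].
    exact: le_trans yz xy.
  apply: le_trans (lo_mono _ _ (leq_maxl k l)) _.
  apply: le_trans (hi_mono _ _ (leq_maxr k l)).
  by rewrite /lo /hi lerD2l; have := u0 (maxn k l); lra.
pose x : 'rV[R]_d := \row_i sup [set lo k i | k in setT].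
exists x => k i; rewrite mxE ler_distl.
have ub l : ubound [set lo k i | k in setT] (hi l i).
  by move=> _ [j _ <-]; exact: lohi.
apply/andP; split.
  apply: ub_le_sup; first by exists (hi 0%N i); exact: ub.
  by exists k.
apply: ge_sup; last exact: ub.
by exists (lo 0%N i), 0%N.
Qed.

Lemma exists_half_pow_lt (e : R) : 0 < e -> exists k, 2^-1 ^+ k < e.
Proof.
move=> e0; exists (Num.truncn e^-1).+1.
rewrite exprVn invf_plt ?posrE ?exprn_gt0 //.
apply: lt_trans (Num.Theory.truncnS_gt _) _.
by rewrite -natrX ltr_nat ltn_expl.
Qed.

(** Iteration of [light_child]. The admissible scales are imposed by [P] and only known to be
    unbounded, so each step waits for one that is fine enough for the current cube. The limit point
    lies in all the cubes, and it avoids every [V i] because the radius at step k is at most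
    2^(-k). *)
Lemma ubiquity (V : nat -> set 'rV[R]_d) (D : nat -> R) (t w b : R)
    (P : nat -> Prop) :
  0 < t <= d%:R -> (forall i, 0 < D i <= 1) ->
  (forall i x y, V i x -> V i y -> forall j, `|x ord0 j - y ord0 j| <= D i) ->
  0 < w <= 1 -> 0 < b <= w / 4 -> (forall N, exists2 m, (N <= m)%N & P m) ->
  (forall M, \sum_(i < M) gauge t (D i) <= @eta R d * gauge t (w / 2)) ->
  exists x : 'rV[R]_d, [/\ forall i, 0 <= x ord0 i <= w, forall i, ~ V i x &
    forall N, exists m (k : {ffun 'I_d -> 'I_m}), [/\ (N <= m)%N, P m &
      cube (grid_point w k) (b * m%:R `^ (- (d%:R / t))) x]].
Proof.
move=> t0d D01 VD w01 bw Pinf sumD.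
have [t0 td] := andP t0d; have [w0 w1] := andP w01; have [b0 bw4] := andP bw.
pose ok (s : 'rV[R]_d * R) := [/\ 0 < s.2 <= 1,
  forall i, s.2 <= s.1 ord0 i <= w - s.2 & light V D t s.1 s.2].
pose step N (s s' : 'rV[R]_d * R) := exists m (k : {ffun 'I_d -> 'I_m}),
  [/\ (N <= m)%N, P m, s' = (grid_point w k, b * m%:R `^ (- (d%:R / t))),
    cube s'.1 s'.2 `<=` cube s.1 s.2 & s'.2 <= s.2 / 2].
have child N s : ok s -> exists2 s', ok s' & step N s s'.
  case: s => c r [/= r01 cr L]; have [r0 r1] := andP r01.
  pose Z := 3 / 4 * (r / (2 * w)) ^+ d * b `^ t.
  have Z0 : 0 < Z.
    by rewrite !mulr_gt0 ?powR_gt0 // exprn_gt0 // divr_gt0 // mulr_gt0.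
  (* The three summands ensure m >= N, a mesh fine enough for the radius to halve, and Z ln m >
     gauge t r as [light_child] demands. *)
  have [m Nm Pm] := Pinf (N + (Num.truncn (2 / r)).+1 +
    (Num.truncn (expR (gauge t r / Z))).+1)%N.
  have m2r : 2 / r < m%:R.
    apply: lt_le_trans (Num.Theory.truncnS_gt _) _; rewrite ler_nat.
    by apply: leq_trans Nm; rewrite -addnA addnCA leq_addr.
  have mexp : expR (gauge t r / Z) < m%:R.
    apply: lt_le_trans (Num.Theory.truncnS_gt _) _; rewrite ler_nat.
    by apply: leq_trans Nm; rewrite leq_addl.
  have mR : 0 < m%:R :> R by apply: lt_trans mexp; exact: expR_gt0.
  have m0 : (0 < m)%N by rewrite -(ltr_nat R).
  have m1 : 1 <= m%:R :> R by rewrite ler1n.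
  have mr : 2 < r * m%:R by rewrite -ltr_pdivrMl // mulrC.
  have mp0 : 0 < m%:R `^ (- (d%:R / t)) :> R by rewrite powR_gt0.
  have mp1 : m%:R `^ (- (d%:R / t)) <= m%:R^-1 :> R.
    rewrite -(powR_inv1 (ltW mR)) ler_powR // lerN2.
    by rewrite ler_pdivlMr // mul1r.
  have mi : 2 * m%:R^-1 <= r :> R by rewrite ler_pdivrMr // ltW.
  have mi0 : 0 < m%:R^-1 :> R by rewrite invr_gt0.
  have r'r : b * m%:R `^ (- (d%:R / t)) <= r / 2 by nra.
  have [] // := @light_child R d V D t t0d D01 VD w m c r b w01 m0 bw r01 cr L.
  - nra.
  - rewrite -ltr_pdivrMl //.
    rewrite mulrC -[ltLHS]expRK ltr_ln ?posrE ?expR_gt0 //.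
  move=> k [ksub kL kw].
  exists (grid_point w k, b * m%:R `^ (- (d%:R / t))).
    split=> //=; rewrite mulr_gt0 //=; nra.
  exists m, k; split => //.
  by apply: leq_trans Nm; rewrite -addnA leq_addr.
have /choice[f fP] : forall Ns : nat * ('rV[R]_d * R), exists s',
    ok Ns.2 -> ok s' /\ step Ns.1 Ns.2 s'.
  move=> [N s] /=; have [oks|nok] := pselect (ok s); last by exists s.
  by have [s' h1 h2] := child N s oks; exists s'.
pose u := fix u k := if k is k'.+1 then f (k', u k') else (const_mx (w / 2), w / 2).
have uok k : ok (u k).
  elim: k => [|k IH] /=; last by case: (fP (k, u k) IH).
  split => /=; first by apply/andP; split; lra.
    by move=> i; rewrite mxE; apply/andP; split; lra.
  move=> M; apply: le_trans (sumD M); rewrite big_mkcond /=; apply: ler_sum => i _.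
  by case: ifP => // _; rewrite ltW // gauge_gt0.
have ustep k : step k (u k) (u k.+1) by case: (fP (k, u k) (uok k)).
have [x xu] : exists x, forall k, cube (u k).1 (u k).2 x.
  apply: nested_cubes => k; first by case: (uok k) => /andP[/ltW].
  by case: (ustep k) => m [kk [_ _ _]].
have ur k : (u k).2 <= 2^-1 ^+ k.
  elim: k => [|k IH]; first by rewrite expr0 /=; lra.
  by case: (ustep k) => m [kk [_ _ _ _]] h; apply: le_trans h _; rewrite exprSr ler_pM2r.
exists x; split.
- by move=> i; have := xu 0%N i; rewrite /= mxE ler_distl => /andP[? ?]; apply/andP; split; lra.
- move=> i Vix; have /andP[Di0 _] := D01 i.
  have [k kD] := exists_half_pow_lt Di0.
  have [r01 _ L] := uok k.
  have [_ Dr] := light_hits_lt t0d D01 r01 L (i := i) (ex_intro _ x (conj Vix (xu k))).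
  have := lt_le_trans Dr (ur k); lra.
- move=> N; have [m [k [Nm Pm uE _ _]]] := ustep N.
  by exists m, k; split => //; have := xu N.+1; rewrite uE.
Qed.
End ubiquity_theorem.

(** * One-variable calculus *)

Section calculus.
Context {R : realType}.
Implicit Types f F : R -> R.

Lemma mvt f f' (a b : R) : a <= b ->
  (forall x, a <= x <= b -> is_derive x 1 f (f' x)) ->
  exists2 c, a <= c <= b & f b - f a = f' c * (b - a).
Proof.
move=> ab df.
have dfx x : x \in `]a, b[ -> is_derive x 1 f (f' x).
  by rewrite in_itv /= => /andP[ax xb]; apply: df; rewrite !ltW.
have cf : {within `[a, b], continuous f}.
  apply: derivable_within_continuous => x; rewrite in_itv /= => xab.
  by have [] := df x xab.
have [c] := MVT_segment ab dfx cf.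
by rewrite in_itv /= => cab fab; exists c.
Qed.

(** Two mean value steps: first for f'(t) - c t on the interval from -x to x, then for f(t) + f(-t)
    - c t^2 on the interval from 0 to eta. The error is governed by the oscillation of f'' around
    c. *)
Lemma second_difference f f' f'' (eta c e : R) : 0 < eta ->
  (forall t : R, `|t| <= eta -> is_derive t 1 f (f' t)) ->
  (forall t : R, `|t| <= eta -> is_derive t 1 f' (f'' t)) ->
  (forall t : R, `|t| <= eta -> `|f'' t - c| <= e) ->
  `|f eta + f (- eta) - 2 * f 0 - c * eta ^+ 2| <= 2 * e * eta ^+ 2.
Proof.
move=> eta0 df df' f''c.
have derN (g : R -> R) (y x : R) : is_derive (- x) 1 g y ->
    is_derive x 1 (fun t => g (- t)) (- y).
  move=> dg; have dN := is_deriveNid x (1 : R).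
  by have := is_derive1_comp dg dN; rewrite mulrN1.
have step1 x : 0 <= x <= eta -> `|f' x - f' (- x) - c * (2 * x)| <= e * (2 * x).
  move=> /andP[x0 xe].
  have [] := @mvt (fun t => f' t - c * t) (fun t => f'' t - c) (- x) x.
  - by lra.
  - move=> t /andP[t1 t2]; have te : `|t| <= eta by rewrite ler_norml; lra.
    have := df' t te => ?.
    apply: is_derive_eq.
    by rewrite /= [c *: _]mulr1.
  move=> u /andP[u1 u2] E.
  have ue : `|u| <= eta by rewrite ler_norml; lra.
  have -> : f' x - f' (- x) - c * (2 * x) = (f'' u - c) * (2 * x).
    by rewrite -[2 * x]/(2%:R * x) (_ : 2 * x = x - - x) -?E; ring.
  rewrite normrM [`|2 * x|]ger0_norm ?mulr_ge0 // ler_wpM2r ?mulr_ge0 //.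
  exact: f''c.
have [] := @mvt (fun t => f t + f (- t) - c * t ^+ 2)
   (fun t => f' t - f' (- t) - c * (2 * t)) 0 eta (ltW eta0).
  move=> t /andP[t0 te]; have ta : `|t| <= eta by rewrite ger0_norm.
  have tb : `|- t| <= eta by rewrite normrN.
  have := df t ta => ?; have := derN _ _ _ (df _ tb) => ?.
  apply: is_derive_eq.
  rewrite /= /GRing.scale /=; ring.
move=> u u01 E.
have -> : f eta + f (- eta) - 2 * f 0 - c * eta ^+ 2 =
    (f' u - f' (- u) - c * (2 * u)) * eta.
  rewrite -[eta in RHS]subr0 -E /= oppr0; ring.
rewrite normrM [`|eta|]gtr0_norm //.
apply: le_trans (ler_wpM2r (ltW eta0) (step1 u u01)) _.
have e0 : 0 <= e by apply: le_trans (f''c 0 _); rewrite ?normr0 // ltW.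
have /andP[u0 ue] := u01.
rewrite (_ : e * (2 * u) * eta = 2 * e * eta * u); last by ring.
by rewrite expr2 mulrA ler_wpM2l // !mulr_ge0 // ltW.
Qed.

Lemma antiderivative_exists f (a : R) :
  (forall x, a < x -> {for x, continuous f}) ->
  forall b, a < b -> exists F, forall x, b < x -> is_derive x 1 F (f x).
Proof.
move=> cf b ab.
exists (fun x => \int[lebesgue_measure]_(t in `[b, x]) f t)%R => x bx.
have xu : x < x + 1 by rewrite ltrDl.
have [|dF F'] := @continuous_FTC1_closed R f b x (x + 1) xu _ bx (cf x (lt_trans ab bx)).
  apply: continuous_compact_integrable; first exact: segment_compact.
  apply: continuous_in_subspaceT => y; rewrite inE /= in_itv /= => /andP[yb _].
  exact: cf (lt_le_trans ab yb).
apply: DeriveDef; first exact: dF.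
exact: etrans (esym (derive1E _ _)) F'.
Qed.

End calculus.

(* Pointwise forms of the library's continuity lemmas, whose conclusions are
   stated about [f + g], [f \* g], which unification does not find under a
   lambda. *)
Section pointwise_continuity.
Context {R : realType} {T : topologicalType}.
Implicit Types (f g : T -> R) (x : T).

Lemma cont_cst (c : R) x : {for x, continuous (fun _ : T => c)}.
Proof. exact: cvg_cst. Qed.

Lemma cont_add f g x : {for x, continuous f} -> {for x, continuous g} ->
  {for x, continuous (fun y => f y + g y)}.
Proof. exact: continuousD. Qed.

Lemma cont_sub f g x : {for x, continuous f} -> {for x, continuous g} ->
  {for x, continuous (fun y => f y - g y)}.
Proof. exact: continuousB. Qed.

Lemma cont_mul f g x : {for x, continuous f} -> {for x, continuous g} ->
  {for x, continuous (fun y => f y * g y)}.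
Proof. exact: continuousM. Qed.

Lemma cont_comp (k : R -> R) f x : {for x, continuous f} ->
  {for f x, continuous k} -> {for x, continuous (fun y => k (f y))}.
Proof. exact: continuous_comp. Qed.

End pointwise_continuity.

(** * Restriction to lines, compactness *)

Section lines.
Context {R : realType} {n : nat}.
Implicit Types (x v : 'rV[R]_n.+1) (f : 'rV[R]_n.+1 -> R).

Lemma line_quotient f x v (t : R) :
  (fun h : R => h^-1 *: (((fun s : R => f (x + s *: v)) \o shift t) (h *: 1) -
     f (x + t *: v))) =
  (fun h : R => h^-1 *: ((f \o shift (x + t *: v)) (h *: v) - f (x + t *: v))).
Proof.
apply/funext => h /=; congr (_ *: (f _ - _)).
by rewrite [h *: 1]mulr1 scalerDl addrCA.
Qed.

Lemma is_derive_line f x v (t df : R) :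
  is_derive t 1 (fun s : R => f (x + s *: v)) df <->
  is_derive (x + t *: v) v f df.
Proof.
split=> -[d1 d2]; split.
- by move: d1; rewrite /derivable line_quotient.
- by move: d2; rewrite /derive line_quotient.
- by move: d1; rewrite /derivable -line_quotient.
- by move: d2; rewrite /derive -line_quotient.
Qed.

Lemma is_derive_line0 f x v (df : R) :
  is_derive (0 : R) 1 (fun s : R => f (x + s *: v)) df <-> is_derive x v f df.
Proof. by have := is_derive_line f x v 0 df; rewrite scale0r addr0. Qed.

Lemma continuous_esq : continuous (@esq R n.+1).
Proof.
move=> x; rewrite /continuous_at; apply: cvg_big.
  by move=> z; apply: cvgD; [exact: cvg_fst|exact: cvg_snd].
  exact: (nbhs_filter x).
move=> i _; have c : (fun y : 'rV[R]_n.+1 => y ord0 i) y @[y --> x] --> x ord0 i.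
  exact: coord_continuous.
exact: (cvgM c c).
Qed.

Lemma continuous_enorm : continuous (@enorm R n.+1).
Proof.
move=> x; rewrite /enorm.
exact: (continuous_comp (@continuous_esq x) (@sqrt_continuous R _)).
Qed.

Lemma compact_esq_ball x (S : R) : compact [set y | esq (y - x) <= S].
Proof.
have cI : compact [set v : 'rV[R]_n.+1 | forall i,
    `[x ord0 i - Num.sqrt S, x ord0 i + Num.sqrt S]%classic (v ord0 i)].
  apply: (@rV_compact _ _
    (fun i => `[x ord0 i - Num.sqrt S, x ord0 i + Num.sqrt S]%classic)) => i.
  exact: segment_compact.
apply: (subclosed_compact _ cI); last first.
  move=> y /= yS i; rewrite in_itv /= -ler_distl.
  have S0 : 0 <= S by apply: le_trans yS; exact: esq_ge0.
  have := coord_le_enorm (y - x) i; rewrite !mxE => /le_trans; apply.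
  by rewrite enormE ler_sqrt.
have -> : [set y | esq (y - x) <= S] = (fun y => esq (y - x)) @^-1` [set r | r <= S].
  by [].
apply: preimage_closed; last exact: closed_le.
move=> y _; apply: continuous_comp; last exact: continuous_esq.
exact: (cvgB (@cvg_id _ _) (@cvg_cst _ _ _ _ _)).
Qed.

(** Near-covering compactness: a relation valid for all pairs close to the diagonal of [K] holds for
    shifts of a size uniform over [K]. Applied to closeness of values it yields uniform
    continuity. *)
Lemma compact_shift_near (K : set 'rV[R]_n.+1) (Q : 'rV[R]_n.+1 -> 'rV[R]_n.+1 -> Prop) v :
  compact K ->
  (forall x, K x -> \forall y \near x & z \near x, Q y z) ->
  exists2 eta : R, 0 < eta & forall x (t : R), K x -> `|t| <= eta ->
     Q x (x + t *: v).
Proof.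
move=> /compact_near_coveringP cK KQ.
have := cK R (nbhs (0 : R)) (fun t x => Q x (x + t *: v)) _.
case=> [x Kx|].
  have [[A B] /= [xA xB] AB] := KQ x Kx.
  have cl : (fun p : 'rV[R]_n.+1 * R => p.1 + p.2 *: v) z @[z --> (x, 0 : R)] --> x.
    rewrite -[X in _ --> X]addr0 -[X in _ + X](scale0r v).
    apply: cvgD; first exact: cvg_fst.
    by apply: cvgZl; exact: cvg_snd.
  have [[C D] /= [xC tD] CD] := cl _ xB.
  exists (A `&` C, D) => /=; first by split => //; exact: filterI.
  move=> [y t] /= [[Ay Cy] Dt]; apply: (AB (y, y + t *: v)); split => //=.
  exact: (CD (y, t)).
move=> e /= e0 H; exists (e / 2); first by rewrite divr_gt0.
move=> x t Kx te; apply: (H t) => //=.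
by rewrite sub0r normrN; apply: le_lt_trans te _; lra.
Qed.

End lines.

(** * Summation by parts on a discrete torus *)

Section lattice.
Context {R : realType} {n : nat}.
Implicit Types (x : 'rV[R]_n.+1) (h psi : 'rV[R]_n.+1 -> R) (m : nat) (i : 'I_n.+1).

Definition lattice m := {ffun 'I_n.+1 -> 'I_(m.*2).+1}.

Definition lat_point m (v : lattice m) : 'rV[R]_n.+1 :=
  \row_j ((v j)%:R / m%:R - 1).

Definition unit_vec i : 'rV[R]_n.+1 := delta_mx ord0 i.

(* The lattice is a discrete torus: summation by parts then has no boundary
   terms, and wrapping around is harmless for functions that vanish outside of
   the open cube. *)
Definition lat_shift m i (v : lattice m) : lattice m :=
  [ffun j => if j == i then ordS (v j) else v j].

Lemma lat_shift_inj m i : injective (@lat_shift m i).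
Proof.
apply: (can_inj (g := fun v : lattice m =>
  [ffun j => if j == i then ord_pred (v j) else v j] : lattice m)) => v.
by apply/ffunP => j; rewrite !ffunE; case: eqP => // _; rewrite ordSK.
Qed.

Lemma unit_vecE i j : unit_vec i ord0 j = (j == i)%:R.
Proof. by rewrite mxE eqxx. Qed.

Lemma lat_shiftP m i (v : lattice m) : (0 < m)%N ->
  lat_point (lat_shift i v) = lat_point v + m%:R^-1 *: unit_vec i \/
  (lat_point v ord0 i = 1 /\ lat_point (lat_shift i v) ord0 i = -1).
Proof.
move=> m0; have mR : m%:R != 0 :> R by rewrite pnatr_eq0 -lt0n.
have [vi|vi] := ltnP (v i) m.*2.
  left; apply/rowP => j; rewrite !mxE eqxx ffunE.
  case: eqP => [->|_]; last by rewrite mulr0 addr0.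
  rewrite mulr1.
  rewrite /= modn_small // -natr1 mulrDl mul1r; ring.
right; have {}vi : v i = m.*2 :> nat.
  by apply/eqP; rewrite eqn_leq vi -ltnS ltn_ord.
rewrite !mxE ffunE eqxx /= vi modnn mul0r sub0r; split=> //.
by rewrite -muln2 natrM mulrC mulKf //; ring.
Qed.

Variables (psi : 'rV[R]_n.+1 -> R).
Hypothesis psi0 : forall x i, 1 <= `|x ord0 i| -> psi x = 0.

(** Reindexing by the cyclic shift. Where it wraps around, both sides evaluate [psi] at a point with
    a coordinate of absolute value at least 1, so both terms vanish. *)
Lemma sum_shift_fwd m i h : (0 < m)%N ->
  \sum_(v : lattice m) h (lat_point v) * psi (lat_point v + m%:R^-1 *: unit_vec i) =
  \sum_(v : lattice m) h (lat_point v - m%:R^-1 *: unit_vec i) * psi (lat_point v).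
Proof.
move=> m0; have mR : 0 <= m%:R^-1 :> R by rewrite invr_ge0.
rewrite [RHS](reindex_inj (@lat_shift_inj m i)) /=; apply: eq_bigr => v _.
have [->|[v1 vN1]] := lat_shiftP i v m0; first by rewrite addrK.
rewrite [psi (lat_point (lat_shift i v))](@psi0 _ i); last by rewrite vN1 normrN1.
rewrite (@psi0 _ i) ?mulr0 // mxE v1 mxE unit_vecE eqxx mulr1.
by rewrite ger0_norm ?lerDl // addr_ge0.
Qed.

Lemma sum_shift_bwd m i h : (0 < m)%N ->
  \sum_(v : lattice m) h (lat_point v) * psi (lat_point v - m%:R^-1 *: unit_vec i) =
  \sum_(v : lattice m) h (lat_point v + m%:R^-1 *: unit_vec i) * psi (lat_point v).
Proof.
move=> m0; have mR : 0 <= m%:R^-1 :> R by rewrite invr_ge0.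
rewrite [LHS](reindex_inj (@lat_shift_inj m i)) /=; apply: eq_bigr => v _.
have [->|[v1 vN1]] := lat_shiftP i v m0; first by rewrite addrK.
rewrite [psi (lat_point v)](@psi0 _ i); last by rewrite v1 normr1.
rewrite (@psi0 _ i) ?mulr0 // mxE vN1 !mxE !eqxx mulr1.
by rewrite -opprD normrN ger0_norm ?lerDl // addr_ge0.
Qed.

Definition diff2 h (eta : R) i x :=
  h (x + eta *: unit_vec i) + h (x - eta *: unit_vec i) - 2 * h x.

(** Discrete Green identity: translations by 1 / m and by -1 / m are adjoint to each other, so the
    second difference is symmetric. *)
Lemma summation_by_parts m h : (0 < m)%N ->
  \sum_(v : lattice m) h (lat_point v) *
     (\sum_i diff2 psi m%:R^-1 i (lat_point v)) =
  \sum_(v : lattice m) psi (lat_point v) *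
     (\sum_i diff2 h m%:R^-1 i (lat_point v)).
Proof.
move=> m0; under eq_bigr do rewrite mulr_sumr.
under [RHS]eq_bigr do rewrite mulr_sumr.
rewrite exchange_big [RHS]exchange_big /=; apply: eq_bigr => i _.
rewrite /diff2; under eq_bigr do rewrite mulrBr mulrDr.
rewrite sumrB big_split /= sum_shift_fwd // sum_shift_bwd // -big_split -sumrB /=.
by apply: eq_bigr => v _; ring.
Qed.

End lattice.

Section radial_identity.
Context {R : realType} {n : nat}.
Implicit Types (x y : 'rV[R]_n.+1) (f h : 'rV[R]_n.+1 -> R) (m : nat).

Lemma compact_fun_bounded f (K : set 'rV[R]_n.+1) : compact K ->
  (forall x, K x -> {for x, continuous f}) ->
  exists2 B, 0 < B & forall x, K x -> `|f x| <= B.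
Proof.
move=> /compact_near_coveringP cK cf.
have := cK R (pinfty_nbhs R) (fun B x => `|f x| <= B) _.
case=> [x Kx|M [_ /= HM]].
  exists ([set y | `|f y| <= `|f x| + 1], [set B | `|f x| + 1 < B]) => /=.
    split; last by exists (`|f x| + 1); split => //; exact: num_real.
    have /cvgr_dist_lt/(_ 1 ltr01) := cf x Kx.
    apply: filterS => y /ltW h.
    have := ler_normD (f x) (f y - f x); rewrite subrKC => /le_trans; apply.
    by rewrite lerD2l distrC.
  by move=> [y B] /= [h1 h2]; exact: (le_trans h1 (ltW h2)).
exists (`|M| + 1); first by rewrite ltr_wpDl.
move=> x Kx; apply: (HM (`|M| + 1)) => //.
by apply: le_lt_trans (ler_norm M) _; rewrite ltrDl.
Qed.

Lemma common_lower_bound (k : nat) (f : 'I_k -> R) : (forall i, 0 < f i) ->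
  exists2 eta : R, 0 < eta & forall i, eta <= f i.
Proof.
move=> f0; exists (\big[Num.min/1]_i f i).
  by rewrite lt_bigmin //= ltr01; apply/forallP.
by move=> i; exact: bigmin_le.
Qed.

Lemma continuous_shift_near f (K U : set 'rV[R]_n.+1) v (e : R) :
  compact K -> open U -> K `<=` U -> 0 < e ->
  (forall x, U x -> {for x, continuous f}) ->
  exists2 eta : R, 0 < eta & forall x (t : R), K x -> `|t| <= eta ->
     U (x + t *: v) /\ `|f (x + t *: v) - f x| <= e.
Proof.
move=> cK oU KU e0 cf.
have [|eta eta0 H] := @compact_shift_near R n K (fun x y => U y /\ `|f y - f x| <= e) v cK.
  move=> x Kx; have Ux := KU x Kx.
  have e20 : 0 < e / 2 by rewrite divr_gt0.
  have /cvgr_dist_lt/(_ _ e20) near_x := cf x Ux.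
  exists ([set y | `|f x - f y| < e / 2], [set y | U y /\ `|f x - f y| < e / 2]) => /=.
    by split => //; apply: filterI => //; exact: open_nbhs_nbhs.
  move=> [y z] /= [h1 [Uz h2]]; split => //.
  rewrite -(subrKA (f x)); apply: le_trans (ler_normD _ _) _.
  by rewrite [`|f z - _|]distrC; move: h1 h2; lra.
by exists eta.
Qed.

(** The main terms, eta^2 times the pure second derivatives, cancel in the sum over [i] by
    harmonicity. Compactness makes the remainder uniform; [e1] shares it among n + 1 directions,
    with the factor 2 of [second_difference]. *)
Lemma harmonic_diff2 h (U K : set 'rV[R]_n.+1) (e : R) :
  harmonic_on U h -> open U -> compact K -> K `<=` U -> 0 < e ->
  exists2 eta0 : R, 0 < eta0 & forall eta x, 0 < eta <= eta0 -> K x ->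
    `|\sum_i diff2 h eta i x| <= e * eta ^+ 2.
Proof.
move=> [C2 lap] oU cK KU e0.
pose e1 := e / (2 * n.+1%:R).
have e10 : 0 < e1 by rewrite divr_gt0 // mulr_gt0.
have /choice[E EP] : forall i : 'I_n.+1, exists eta : R, 0 < eta /\
    forall x (t : R), K x -> `|t| <= eta -> U (x + t *: unit_vec i) /\
      `|partial i (partial i h) (x + t *: unit_vec i) - partial i (partial i h) x| <= e1.
  move=> i; have [|eta eta0 H] :=
    @continuous_shift_near (partial i (partial i h)) K U (unit_vec i) e1 cK oU KU e10.
    by move=> x /C2[_ /(_ i)[_ _ /(_ i)[]]].
  by exists eta.
have [i|eta0 eta00 Emin] := @common_lower_bound _ E; first by case: (EP i).
exists eta0 => // eta x /andP[eta_gt0 eta_le] Kx.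
have Ux := KU x Kx.
have -> : \sum_i diff2 h eta i x =
    \sum_i (diff2 h eta i x - partial i (partial i h) x * eta ^+ 2).
  have := lap _ Ux; rewrite /laplacian => lapx.
  by rewrite [RHS]sumrB -mulr_suml lapx mul0r subr0.
apply: le_trans (ler_norm_sum _ _ _) _.
apply: (@le_trans _ _ (\sum_(i < n.+1) 2 * e1 * eta ^+ 2)); last first.
  rewrite sumr_const card_ord -[leLHS]mulr_natr le_eqVlt; apply/orP; left.
  have N0 : 0 < n.+1%:R :> R by [].
  apply/eqP; rewrite /e1; move: (n.+1%:R) N0 => N N0.
  by field; rewrite gt_eqF.
apply: ler_sum => i _.
have [_ Ei] := EP i.
have inE' (t : R) : `|t| <= eta -> `|t| <= E i.
  by move=> te; exact: (le_trans te (le_trans eta_le (Emin i))).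
have := @second_difference R (fun t => h (x + t *: unit_vec i))
  (fun t => partial i h (x + t *: unit_vec i))
  (fun t => partial i (partial i h) (x + t *: unit_vec i)) eta
  (partial i (partial i h) x) e1 eta_gt0.
rewrite scaleNr scale0r addr0; apply => t /inE' tE.
- have [Ut _] := Ei x t Kx tE; apply/is_derive_line/derivableP.
  by have [_ /(_ i)[]] := C2 _ Ut.
- have [Ut _] := Ei x t Kx tE; apply/is_derive_line/derivableP.
  by have [_ /(_ i)[_ _ /(_ i)[]]] := C2 _ Ut.
- by have [] := Ei x t Kx tE.
Qed.

Lemma card_lattice_le m : (0 < m)%N -> #|lattice (n := n) m|%:R <= 3 ^+ n.+1 * m%:R ^+ n.+1 :> R.
Proof.
move=> m0; rewrite card_ffun !card_ord natrX -exprMn lerXn2r ?nnegrE ?mulr_ge0 //.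
rewrite -natrM ler_nat; lia.
Qed.

End radial_identity.

(** * Testing harmonicity against radial functions *)

Section radial_test_functions.
Context {R : realType} {n : nat}.
Implicit Types (x y : 'rV[R]_n.+1) (m : nat) (i : 'I_n.+1).

Lemma esq_line x x0 i (t : R) :
  esq (x + t *: unit_vec i - x0) =
  esq (x - x0) + 2 * (x - x0) ord0 i * t + t ^+ 2.
Proof.
rewrite /esq (bigD1 i) //= [in RHS](bigD1 i) //=.
rewrite (eq_bigr (fun j => (x - x0) ord0 j ^+ 2)); last first.
  by move=> j ji; rewrite !mxE (negbTE ji) andbF mulr0 addr0.
by rewrite !mxE !eqxx mulr1; ring.
Qed.

Variables (k k' : R -> R) (a S S' : R) (x0 : 'rV[R]_n.+1).
Hypothesis a0 : 0 < a.
Hypothesis dk : forall q : R, - a < q -> is_derive q 1 k (k' q).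
Hypothesis ck' : forall q : R, - a < q -> {for q, continuous k'}.
Hypothesis S0 : 0 < S.
Hypothesis SS' : S < S'.
Hypothesis kS : forall q, S <= q -> k q = 0.

Lemma esq_gtNa y : - a < esq (y - x0).
Proof. by apply: lt_le_trans (esq_ge0 _); rewrite oppr_lt0. Qed.

(** The second derivative in direction [i] of g(|y - x0|^2), for a profile g with g' = -k. *)
Definition radial_dd i y : R :=
  - 4 * (y - x0) ord0 i ^+ 2 * k' (esq (y - x0)) - 2 * k (esq (y - x0)).

(** The Laplacian of the same function: 4 q g'' + 2 (n + 1) g' at q = |y - x0|^2. *)
Definition radial_lap y : R :=
  - 4 * esq (y - x0) * k' (esq (y - x0)) - 2 * n.+1%:R * k (esq (y - x0)).

Lemma sum_radial_dd y : \sum_i radial_dd i y = radial_lap y.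
Proof.
rewrite /radial_dd /radial_lap sumrB sumr_const card_ord -[X in _ - X]mulr_natl.
by rewrite -mulr_suml -mulr_sumr -/(esq (y - x0)); ring.
Qed.

Lemma k_continuous q : - a < q -> {for q, continuous k}.
Proof.
by move=> /dk[d _]; apply/differentiable_continuous/derivable1_diffP.
Qed.

Lemma k'S q : S < q -> k' q = 0.
Proof.
move=> Sq; have qa : - a < q.
  by apply: lt_trans Sq; apply: lt_trans S0; rewrite oppr_lt0.
have [_ <-] := dk qa.
rewrite (@near_eq_derive _ _ _ _ (cst 0)) ?derive_cst //.
by near=> r; apply: kS; apply: ltW; near: r; exact: lt_nbhsr.
Unshelve. all: by end_near. Qed.

(** The domain of [k] extends to the left of 0 to have two-sided derivatives at the centre q = 0.
    Half of this margin is given up so that the integral starts where [k] is continuous; subtracting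
    the value at [S] makes the profile vanish where [k] does. *)
Lemma antiderivative_radial : exists g : R -> R,
  (forall q, - a / 2 < q -> is_derive q 1 g (- k q)) /\
  (forall q, S <= q -> g q = 0).
Proof.
have aa : - a < - a / 2 by have := a0; lra.
have [|F dF] := @antiderivative_exists R (fun q => - k q) (- a) _ (- a / 2) aa.
  by move=> q qa; apply: continuousN; exact: k_continuous.
exists (fun q => F q - F S); split.
  move=> q qa; have ? := dF q qa.
  by apply: is_derive_eq; rewrite subr0.
move=> q Sq.
have [r Sr|c /andP[Sc _] E] := @mvt R F (fun q => - k q) S q Sq.
  by apply: dF; have := a0; have := S0; case/andP: Sr; lra.
by rewrite E kS // oppr0 mul0r.
Qed.

Lemma continuous_dist2 : continuous (fun y => esq (y - x0)).
Proof.
move=> y; apply: continuous_comp; last exact: continuous_esq.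
exact: (cvgB (@cvg_id _ _) (@cvg_cst _ _ _ _ _)).
Qed.

Lemma continuous_radial_dd i : continuous (radial_dd i).
Proof.
move=> y; rewrite /radial_dd.
have cq := @continuous_dist2 y.
have ck : {for y, continuous (fun y => k (esq (y - x0)))}.
  by apply: continuous_comp; [exact: cq|exact/k_continuous/esq_gtNa].
have ck1 : {for y, continuous (fun y => k' (esq (y - x0)))}.
  by apply: continuous_comp; [exact: cq|exact/ck'/esq_gtNa].
have cc : {for y, continuous (fun y : 'rV[R]_n.+1 => (y - x0) ord0 i)}.
  apply: (@continuous_comp _ _ _ (fun y => y - x0) (fun z : 'rV[R]_n.+1 => z ord0 i)).
    exact: (cvgB (@cvg_id _ _) (@cvg_cst _ _ _ _ _)).
  exact: coord_continuous.
have cc2 : {for y, continuous (fun y : 'rV[R]_n.+1 => (y - x0) ord0 i ^+ 2)}.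
  exact: (continuousM cc cc).
suff : {for y, continuous (fun y => - 4 * (y - x0) ord0 i ^+ 2 *
    k' (esq (y - x0)) - 2 * k (esq (y - x0)))} by [].
apply: cont_sub; apply: cont_mul => //; last exact: cont_cst.
by apply: cont_mul => //; exact: cont_cst.
Qed.

Lemma radial_diff2 (g : R -> R) (K : set 'rV[R]_n.+1) (e : R) :
  (forall q, - a / 2 < q -> is_derive q 1 g (- k q)) ->
  compact K -> 0 < e ->
  exists2 eta0 : R, 0 < eta0 & forall eta y i, 0 < eta <= eta0 -> K y ->
    `|diff2 (fun y => g (esq (y - x0))) eta i y - radial_dd i y * eta ^+ 2|
      <= 2 * e * eta ^+ 2.
Proof.
move=> dg cK e0.
have /choice[E EP] : forall i : 'I_n.+1, exists eta : R, 0 < eta /\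
    forall x (t : R), K x -> `|t| <= eta ->
      `|radial_dd i (x + t *: unit_vec i) - radial_dd i x| <= e.
  move=> i; have [|eta eta0 H] := @continuous_shift_near R n (radial_dd i) K setT
    (unit_vec i) e cK openT (@subsetT _ _) e0.
    by move=> x _; exact: continuous_radial_dd.
  by exists eta; split => // x t Kx te; have [] := H x t Kx te.
have [i|eta0 eta00 Emin] := @common_lower_bound _ _ E; first by case: (EP i).
exists eta0 => // eta y i /andP[eta_gt0 eta_le] Ky.
have inE' (t : R) : `|t| <= eta -> `|t| <= E i.
  by move=> te; exact: (le_trans te (le_trans eta_le (Emin i))).
pose z := (y - x0) ord0 i.
pose Q (t : R) := esq (y - x0) + 2 * z * t + t ^+ 2.
have QE t : esq (y + t *: unit_vec i - x0) = Q t by rewrite esq_line.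
have Qa t : - a < Q t by rewrite -QE esq_gtNa.
have Qa2 t : - a / 2 < Q t.
  by rewrite -QE; apply: lt_le_trans (esq_ge0 _); have := a0; lra.
have dQ (t : R) : is_derive t 1 Q (2 * (z + t)).
  apply: is_derive_eq; rewrite /= /GRing.scale /=; ring.
have := @second_difference R (fun t => g (Q t))
  (fun t => - k (Q t) * (2 * (z + t)))
  (fun t => radial_dd i (y + t *: unit_vec i)) eta
  (radial_dd i y) e eta_gt0.
have -> : diff2 (fun y => g (esq (y - x0))) eta i y =
    g (Q eta) + g (Q (- eta)) - 2 * g (Q 0).
  by rewrite /diff2 -!QE scaleNr scale0r addr0.
apply => t te.
- exact: (is_derive1_comp (dg _ (Qa2 t)) (dQ t)).
- have h1 := is_derive1_comp (dk (Qa t)) (dQ t).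
  have -> : radial_dd i (y + t *: unit_vec i) =
      - (k' (Q t) * (2 * (z + t))) * (2 * (z + t)) + - k (Q t) * 2.
    rewrite /radial_dd QE (_ : (y + t *: unit_vec i - x0) ord0 i = z + t).
      by ring.
    by rewrite !mxE !eqxx mulr1 /z !mxE; ring.
  pose u := k \o Q.
  have hu : is_derive t 1 u (k' (Q t) * (2 * (z + t))) := h1.
  apply: (@is_derive_eq _ _ _ (fun t => - u t * (2 * (z + t)))).
  rewrite /= /GRing.scale /= /u /=; ring.
- by have [_ H] := EP i; apply: H => //; exact: inE'.
Qed.

Hypothesis ball_S' : forall y, esq (y - x0) <= S' -> enorm y < 1.

Lemma open_unit_ball : open (unit_ball R n).
Proof.
have -> : unit_ball R n = @enorm R n.+1 @^-1` [set r | r < 1] by [].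
by apply: open_comp; [move=> y _; exact: continuous_enorm|exact: open_lt].
Qed.

Lemma coord_out_dist y i : 1 <= `|y ord0 i| -> S' < esq (y - x0).
Proof.
move=> y1; rewrite ltNge; apply/negP => /ball_S'.
by apply/negP; rewrite -leNgt; apply: le_trans y1 (coord_le_enorm y i).
Qed.

(** The gap between [S] and [S'] keeps the lattice neighbours of a point outside the larger ball
    away from the support of the test function. *)
Lemma dist2_shift y (eta : R) i : S' < esq (y - x0) ->
  `|eta| <= Num.sqrt S' - Num.sqrt S -> S < esq (y + eta *: unit_vec i - x0).
Proof.
move=> yS' etaS; have S'0 : 0 < S' := lt_trans S0 SS'.
have s0 : 0 <= Num.sqrt S by exact: sqrtr_ge0.
have h1 : Num.sqrt S' < enorm (y - x0) by rewrite enormE ltr_sqrt // (lt_trans S'0).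
have h2 : enorm (eta *: unit_vec i : 'rV[R]_n.+1) = `|eta|.
  rewrite enormZ enormE (_ : esq _ = 1) ?sqrtr1 ?mulr1 //.
  rewrite /esq (bigD1 i) //= big1 ?addr0 ?unit_vecE ?eqxx ?expr1n //.
  by move=> j ji; rewrite unit_vecE (negbTE ji) expr0n.
have h3 : enorm (y - x0) <= enorm (y + eta *: unit_vec i - x0) + `|eta|.
  rewrite -h2 -(enormN (eta *: _)); apply: le_trans (ler_enormD _ _).
  by rewrite [_ - x0 - _]addrAC addrK.
rewrite -sqr_enorm -[S]sqr_sqrtr ?(ltW S0) // ltr_sqr ?nnegrE ?enorm_ge0 //.
lra.
Qed.

Lemma radial_lap_out y : S' < esq (y - x0) -> radial_lap y = 0.
Proof.
move=> yS'; have yS := lt_trans SS' yS'.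
by rewrite /radial_lap k'S // kS ?(ltW yS) // !mulr0 subr0.
Qed.

(** Riemann-sum form of the vanishing of the integral of h times the Laplacian of a compactly
    supported psi. That Laplacian is replaced by m^2 times second differences, summation by parts
    moves these onto h, and there they are negligible by [harmonic_diff2]. Off [K] every term
    vanishes, so h is only estimated on a compact set. *)
Lemma radial_identity (h : 'rV[R]_n.+1 -> R) (e : R) :
  harmonic_on (unit_ball R n) h -> 0 < e ->
  exists M, forall m, (M <= m)%N ->
    `|\sum_(v : lattice m) h (lat_point v) * radial_lap (lat_point v)|
       <= e * m%:R ^+ n.+1.
Proof.
move=> hh e0.
pose K : set 'rV[R]_n.+1 := [set y | esq (y - x0) <= S'].
have cK : compact K by exact: compact_esq_ball.
have KU : K `<=` unit_ball R n by move=> y; exact: ball_S'.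
have [H H0 hH] : exists2 B, 0 < B & forall y, K y -> `|h y| <= B.
  by apply: compact_fun_bounded cK _ => y /KU /(proj1 hh)[].
have [g [dg gS]] := antiderivative_radial.
pose psi y := g (esq (y - x0)).
have psi_out y : S < esq (y - x0) -> psi y = 0 by move=> /ltW /gS.
have [G G0 pG] : exists2 B, 0 < B & forall y, K y -> `|psi y| <= B.
  apply: compact_fun_bounded cK _ => y _.
  apply: (@cont_comp _ _ g (fun y => esq (y - x0))); first exact: continuous_dist2.
  have qa : - a / 2 < esq (y - x0).
    by apply: lt_le_trans (esq_ge0 _); have := a0; lra.
  have [d _] := dg _ qa.
  exact/differentiable_continuous/derivable1_diffP.
have psi0 y i : 1 <= `|y ord0 i| -> psi y = 0.
  by move=> /coord_out_dist h1; apply: psi_out; apply: lt_trans h1.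
pose N : R := n.+1%:R; have N0 : 0 < N by rewrite ltr0n.
pose c3 : R := 3 ^+ n.+1; have c30 : 0 < c3 by rewrite exprn_gt0.
(* [e1] and [e2] keep each of the two errors below e / (2 c3) per lattice point, and there are at
   most c3 m^(n+1) points. *)
pose e1 := e / (4 * H * N * c3).
have e10 : 0 < e1 by rewrite divr_gt0 // !mulr_gt0.
pose e2 := e / (2 * G * c3).
have e20 : 0 < e2 by rewrite divr_gt0 // !mulr_gt0.
have [eta1 eta10 P1] := @radial_diff2 g K e1 dg cK e10.
have [eta2 eta20 P2] := harmonic_diff2 hh open_unit_ball cK KU e20.
have eta30 : 0 < Num.sqrt S' - Num.sqrt S.
  by rewrite subr_gt0 ltr_sqrt // (lt_trans S0).
pose eta0 := Num.min eta1 (Num.min eta2 (Num.sqrt S' - Num.sqrt S)).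
have eta00 : 0 < eta0 by rewrite !lt_min eta10 eta20 eta30.
exists (Num.truncn eta0^-1).+1 => m Mm.
have mbig : eta0^-1 < m%:R.
  by apply: lt_le_trans (Num.Theory.truncnS_gt _) _; rewrite ler_nat.
have mR : 0 < m%:R :> R by apply: lt_trans mbig; rewrite invr_gt0.
have m0 : (0 < m)%N by rewrite -(ltr_nat R).
pose eta : R := m%:R^-1; have eta_gt0 : 0 < eta by rewrite invr_gt0.
have : eta <= eta0 by rewrite -[eta0]invrK lef_pV2 ?posrE ?invr_gt0 // ltW.
rewrite !le_min => /and3P[le1 le2 le3].
have etam : eta ^+ 2 * m%:R ^+ 2 = 1 by rewrite -exprMn mulVf ?expr1n // gt_eqF.
pose L (v : lattice m) := @lat_point R n m v.
have card := @card_lattice_le R n m m0.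
have -> : \sum_(v : lattice m) h (L v) * radial_lap (L v) =
    \sum_(v : lattice m) (h (L v) * (radial_lap (L v) -
        m%:R ^+ 2 * \sum_i diff2 psi eta i (L v)) +
      m%:R ^+ 2 * psi (L v) * \sum_i diff2 h eta i (L v)).
  have sbp := summation_by_parts psi0 h m0.
  transitivity (\sum_(v : lattice m) h (L v) * radial_lap (L v) -
     m%:R ^+ 2 * (\sum_(v : lattice m) h (L v) * (\sum_i diff2 psi eta i (L v))) +
     m%:R ^+ 2 * (\sum_(v : lattice m) psi (L v) * (\sum_i diff2 h eta i (L v)))).
    by rewrite -sbp subrK.
  rewrite !mulr_sumr -sumrB -big_split /=; apply: eq_bigr => v _; ring.
apply: le_trans (ler_norm_sum _ _ _) _.
apply: (@le_trans _ _ (\sum_(v : lattice m) (H * (N * (2 * e1)) + G * e2))); last first.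
  rewrite sumr_const -[leLHS]mulr_natl.
  apply: le_trans (_ : c3 * m%:R ^+ n.+1 * (e / c3) <= _); last first.
    by rewrite mulrAC [c3 * _]mulrC divfK ?gt_eqF.
  rewrite (_ : H * (N * (2 * e1)) + G * e2 = e / c3); last first.
    by rewrite /e1 /e2; field; rewrite !gt_eqF.
  apply: ler_wpM2r; last exact: card.
  by rewrite divr_ge0 ?(ltW e0) ?(ltW c30).
apply: ler_sum => v _; apply: le_trans (ler_normD _ _) _; apply: lerD.
  have [Kv|] := pselect (K (L v)); last first.
    move=> /negP; rewrite -ltNge => vS'.
    rewrite radial_lap_out // sub0r big1 ?mulr0 ?oppr0 ?mulr0 ?normr0.
      exact: (ltW (mulr_gt0 H0 (mulr_gt0 N0 (mulr_gt0 (ltr0Sn _ 1) e10)))).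
    move=> i _; rewrite /diff2 -scaleNr !psi_out ?mulr0 ?addr0 ?subr0 //.
    - exact: lt_trans vS'.
    - by apply: dist2_shift => //; rewrite normrN gtr0_norm.
    - by apply: dist2_shift => //; rewrite gtr0_norm.
  rewrite normrM ler_pM // ?hH // -sum_radial_dd mulr_sumr -sumrB.
  apply: le_trans (ler_norm_sum _ _ _) _.
  apply: (@le_trans _ _ (\sum_(i < n.+1) 2 * e1)); last first.
    by rewrite sumr_const card_ord -[leLHS]mulr_natl.
  apply: ler_sum => i _.
  have := P1 eta (L v) i _ Kv; rewrite eta_gt0 le1 => /(_ isT) D.
  rewrite -(ler_pM2r (exprn_gt0 2 eta_gt0)); apply: le_trans D.
  rewrite -[X in _ * X <= _]ger0_norm ?exprn_ge0 ?(ltW eta_gt0) // -normrM distrC.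
  rewrite mulrBl mulrAC [m%:R ^+ 2 * _]mulrC etam mul1r; exact: lexx.
have [Kv|] := pselect (K (L v)); last first.
  move=> /negP; rewrite -ltNge => vS'.
  rewrite psi_out ?(lt_trans SS') // mulr0 mul0r normr0.
  exact: (ltW (mulr_gt0 G0 e20)).
have := P2 eta (L v) _ Kv; rewrite eta_gt0 le2 => /(_ isT) D.
rewrite [m%:R ^+ 2 * _]mulrC -mulrA normrM ler_pM // ?pG //.
rewrite normrM ger0_norm ?exprn_ge0 ?(ltW mR) //.
apply: le_trans (ler_wpM2l _ D) _; first by rewrite exprn_ge0 // ltW.
by rewrite mulrCA [_ * eta ^+ 2]mulrC etam mulr1.
Qed.

End radial_test_functions.

(** * A cutoff of class C1 *)

Section cutoff.
Context {R : realType}.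
Implicit Types t q : R.

(** The square of the positive part of t in closed form; its derivative t + |t| is continuous. *)
Definition sqpos t : R := t * (t + `|t|) / 2.

Lemma sqpos_le0 t : t <= 0 -> sqpos t = 0.
Proof. by move=> t0; rewrite /sqpos ler0_norm // subrr mulr0 mul0r. Qed.

Lemma sqpos_ge0E t : 0 <= t -> sqpos t = t ^+ 2.
Proof. by move=> t0; rewrite /sqpos ger0_norm //; field. Qed.

Lemma sqpos_ge0 t : 0 <= sqpos t.
Proof.
by case: (leP t 0) => [/sqpos_le0->//|/ltW /sqpos_ge0E ->]; exact: sqr_ge0.
Qed.

Lemma is_derive_sqpos t : is_derive t 1 sqpos (t + `|t|).
Proof.
have [t0|t0|->] := ltgtP t 0.
- rewrite ltr0_norm // subrr; apply: (@near_eq_is_derive _ _ _ (cst 0)).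
  by near=> u; rewrite /= sqpos_le0 // ltW //; near: u; exact: lt_nbhsl.
- rewrite gtr0_norm //; apply: (@near_eq_is_derive _ _ _ (fun u : R => u ^+ 2 : R)).
    by near=> u; rewrite sqpos_ge0E // ltW //; near: u; exact: lt_nbhsr.
  by apply: is_derive_eq; rewrite /= /GRing.scale /=; ring.
- rewrite normr0 addr0.
  have c : (fun h : R => h^-1 *: ((sqpos \o shift 0) (h *: 1) - sqpos 0)) h
      @[h --> 0^'] --> (0 : R).
    apply/cvgrPdist_lt => e e0; near=> h.
    have h0 : h != 0 by near: h; exact: nbhs_dnbhs_neq.
    rewrite /= sub0r normrN /GRing.scale /= mulr1 addr0 (sqpos_le0 (lexx 0)) subr0.
    have -> : h^-1 * sqpos h = (h + `|h|) / 2 by rewrite /sqpos !mulrA mulVf // mul1r.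
    rewrite normrM; apply: le_lt_trans (_ : (`|h| + `|h|) * `|2^-1| < _).
      by rewrite ler_wpM2r // (le_trans (ler_normD _ _)) // normr_id.
    rewrite ger0_norm ?invr_ge0 // (_ : _ * _ = `|h|); last by field.
    by near: h; exact: dnbhs0_lt.
  split; first by apply/cvg_ex; exists 0.
  exact: cvg_lim c.
Unshelve. all: by end_near. Qed.

Lemma continuous_add_abs : continuous (fun t => t + `|t|).
Proof. by move=> t; apply: cont_add => //; exact: norm_continuous. Qed.

Lemma continuous_sqpos : continuous sqpos.
Proof.
move=> t; have [d _] := is_derive_sqpos t.
exact/differentiable_continuous/derivable1_diffP.
Qed.

End cutoff.

(** * Mass of a nonnegative harmonic function in a thin shell *)

Section shell_estimate.
Context {R : realType} {n : nat}.
Implicit Types (q t delta : R) (m : nat).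

Let N : R := n.+1%:R.

Definition ramp t : R := sqpos t / (1 + sqpos t).
Definition ramp' t : R := (t + `|t|) / (1 + sqpos t) ^+ 2.

Lemma ramp_den_gt0 t : 0 < 1 + sqpos t.
Proof. by rewrite ltr_wpDr // sqpos_ge0. Qed.

Lemma is_derive_ramp t : is_derive t 1 ramp (ramp' t).
Proof.
have d0 := ramp_den_gt0 t; have ds := is_derive_sqpos t.
have dn0 : 1 + sqpos t != 0 by rewrite gt_eqF.
have d1 : is_derive t 1 (fun u => 1 + sqpos u) (t + `|t|).
  by apply: is_derive_eq; rewrite add0r mul1r.
have dV := @is_deriveV _ (fun u => 1 + sqpos u) t _ 1 dn0 d1.
apply: (is_derive_eq (is_deriveM ds dV)).
by rewrite /ramp' /GRing.scale /=; field.
Qed.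

Lemma ramp_bounds t : 0 <= ramp t <= 1.
Proof.
have d0 := ramp_den_gt0 t; apply/andP; split.
  exact: (divr_ge0 (sqpos_ge0 _) (ltW d0)).
by rewrite /ramp ler_pdivrMr // mul1r lerDr.
Qed.

Lemma ramp'_ge0 t : 0 <= ramp' t.
Proof.
apply: divr_ge0; last by rewrite exprn_ge0 // (ltW (ramp_den_gt0 _)).
by have := ler_norm (- t); rewrite normrN; lra.
Qed.

(** The interval is the range of the argument over the shell; 1 / 50 is the quotient of 2 t >= 1 / 2
    by (1 + t^2)^2 <= 25. *)
Lemma ramp'_ge t : 1 / 4 <= t <= 2 -> 1 / 50 <= ramp' t.
Proof.
move=> /andP[t1 t2]; have t0 : 0 <= t by lra.
have d0 := ramp_den_gt0 t.
rewrite /ramp' ler_pdivlMr ?exprn_gt0 // sqpos_ge0E // ger0_norm //.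
have : (1 + t ^+ 2) ^+ 2 <= 5 ^+ 2 by rewrite lerXn2r ?nnegrE //; nra.
lra.
Qed.

Lemma continuous_ramp' : continuous ramp'.
Proof.
move=> t; rewrite /ramp'.
suff : {for t, continuous (fun t : R => (t + `|t|) * ((1 + sqpos t) * (1 + sqpos t))^-1)}.
  by [].
have c1 : {for t, continuous (fun t : R => 1 + sqpos t)}.
  by apply: cont_add; [exact: cont_cst|exact: continuous_sqpos].
apply: cont_mul; first exact: continuous_add_abs.
apply: (@continuousV _ _ (fun t => (1 + sqpos t) * (1 + sqpos t))); last exact: cont_mul.
by rewrite mulf_neq0 // gt_eqF // ramp_den_gt0.
Qed.

(** In the Laplacian, the exponential turns the coefficient of [ramp] into a positive multiple of 2
    q - 1, nonnegative for q >= 1 / 2. The term with [ramp'] has order 1 / delta on the shell. *)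
Definition shell_k delta q : R :=
  expR (- N * q) * ramp ((1 - delta / 4 - q) / delta).
Definition shell_k' delta q : R :=
  - N * expR (- N * q) * ramp ((1 - delta / 4 - q) / delta)
  - expR (- N * q) * ramp' ((1 - delta / 4 - q) / delta) / delta.

Lemma is_derive_shell delta q : is_derive q 1 (shell_k delta) (shell_k' delta q).
Proof.
have de : is_derive q 1 (fun u => expR (- N * u)) (- N * expR (- N * q)).
  have dl : is_derive q 1 (fun u : R => - N * u) (- N).
    by apply: is_derive_eq; rewrite /GRing.scale /= mulr1.
  have := is_derive1_comp (is_derive_expR _) dl.
  by rewrite mulrC.
have dr : is_derive q 1 (fun u => ramp ((1 - delta / 4 - u) / delta))
    (ramp' ((1 - delta / 4 - q) / delta) * - delta^-1).
  have dl : is_derive q 1 (fun u : R => (1 - delta / 4 - u) / delta) (- delta^-1).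
    by apply: is_derive_eq; rewrite /GRing.scale /=; ring.
  exact: (is_derive1_comp (is_derive_ramp _) dl).
apply: (is_derive_eq (is_deriveM de dr)).
by rewrite /shell_k' /GRing.scale /=; ring.
Qed.

Lemma continuous_shell_k' delta : continuous (shell_k' delta).
Proof.
move=> q.
have cl : {for q, continuous (fun u : R => (1 - delta / 4 - u) / delta)}.
  by apply: cont_mul; [apply: cont_sub; [exact: cont_cst|exact: cvg_id]|exact: cont_cst].
have ce : {for q, continuous (fun u => expR (- N * u))}.
  apply: cont_comp; last exact: continuous_expR.
  by apply: cont_mul; [exact: cont_cst|exact: cvg_id].
have cr : {for q, continuous (fun u : R => ramp ((1 - delta / 4 - u) / delta))}.
  apply: cont_comp => //; set z := (_ / _); have [d _] := is_derive_ramp z.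
  exact/differentiable_continuous/derivable1_diffP.
have cr1 : {for q, continuous (fun u : R => ramp' ((1 - delta / 4 - u) / delta))}.
  by apply: cont_comp => //; exact: continuous_ramp'.
suff : {for q, continuous (fun q =>
  - N * expR (- N * q) * ramp ((1 - delta / 4 - q) / delta)
  - expR (- N * q) * ramp' ((1 - delta / 4 - q) / delta) * delta^-1)} by [].
apply: cont_sub; apply: cont_mul => //.
- by apply: cont_mul => //; exact: cont_cst.
- exact: cont_mul.
- exact: cont_cst.
Qed.

Lemma shell_radial_lap delta (y : 'rV[R]_n.+1) (q := esq y)
    (t := (1 - delta / 4 - q) / delta) :
  radial_lap (shell_k delta) (shell_k' delta) 0 y =
  expR (- N * q) * (2 * N * (2 * q - 1) * ramp t + 4 * q / delta * ramp' t).
Proof.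
rewrite /radial_lap subr0 -/q /shell_k /shell_k' -/t -/N.
rewrite /N; move: (expR _) (ramp t) (ramp' t) (delta^-1) => *; ring.
Qed.

(** The Laplacian of the test function is at least of order 1 / delta on the shell, nonnegative for
    q >= 1 / 2, and at least -2 N for smaller q, where h is bounded by [H] independently of [delta].
    The shell is the one of radii from 1 - delta to 1 - delta / 2, enlarged by delta / 8 on both
    sides. *)
Lemma shell_sum_le (h : 'rV[R]_n.+1 -> R) :
  harmonic_on (unit_ball R n) h -> (forall x, 0 <= h x) ->
  exists2 C, 0 < C & forall delta, 0 < delta <= 1 / 8 -> exists M, forall m, (M <= m)%N ->
   \sum_(v : lattice m | 1 - 9 / 8 * delta <= enorm (@lat_point R n m v) <= 1 - 3 / 8 * delta)
      h (lat_point v) <= C * delta * m%:R ^+ n.+1.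
Proof.
move=> hh h0.
pose K : set 'rV[R]_n.+1 := [set y | esq (y - 0) <= 1 / 2].
have esq_ball (y : 'rV[R]_n.+1) c : 0 <= c < 1 -> esq (y - 0) <= c -> enorm y < 1.
  move=> /andP[c0 c1]; rewrite subr0 => yc.
  by rewrite enorm_lt // expr1n; apply: le_lt_trans c1.
have [H H0 hH] : exists2 B, 0 < B & forall y, K y -> `|h y| <= B.
  apply: compact_fun_bounded; first exact: compact_esq_ball.
  move=> y Ky; have /(proj1 hh)[] // : unit_ball R n y.
  by apply: esq_ball Ky; lra.
have N0 : 0 < N by rewrite ltr0n.
pose c3 : R := 3 ^+ n.+1; have c30 : 0 < c3 by rewrite exprn_gt0.
exists (25 * expR N * (1 + 2 * N * H * c3)).
  by rewrite !mulr_gt0 ?expR_gt0 // ltr_wpDr // ltW // !mulr_gt0.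
move=> delta /andP[d0 d8].
have Na (q : R) : -1 < q -> is_derive q 1 (shell_k delta) (shell_k' delta q).
  by move=> _; exact: is_derive_shell.
have kS q : 1 - delta / 4 <= q -> shell_k delta q = 0.
  move=> Sq; rewrite /shell_k /ramp sqpos_le0 ?mul0r ?mulr0 //.
  by rewrite mulr_le0_ge0 ?invr_ge0 ?(ltW d0) //; lra.
have [|||M HM] := @radial_identity R n _ _ 1 (1 - delta / 4) (1 - delta / 8) 0
  ltr01 Na (fun q _ => @continuous_shell_k' delta q) _ _ kS _ h 1 hh ltr01.
- lra.
- lra.
- by move=> y; apply: esq_ball; lra.
exists (maxn M 1) => m; rewrite geq_max => /andP[/HM {}HM m0].
have key (v : lattice m) (y := @lat_point R n m v) :
   (if 1 - 9 / 8 * delta <= enorm y <= 1 - 3 / 8 * delta then h y else 0) <=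
   25 * delta * expR N * (h y * radial_lap (shell_k delta) (shell_k' delta) 0 y + 2 * N * H).
  have hy := h0 y.
  have b0 : 0 <= 2 * N * H by rewrite mulr_ge0 ?(ltW H0) // mulr_ge0 // ltW.
  have c0 : 0 < 25 * delta * expR N by rewrite !mulr_gt0 // expR_gt0.
  rewrite shell_radial_lap; set q := esq y; set t := (1 - delta / 4 - q) / delta.
  have q0 : 0 <= q by exact: esq_ge0.
  have /andP[r0 r1] := ramp_bounds t.
  have r'0 := ramp'_ge0 t.
  have r'50 := @ramp'_ge t.
  move: (ramp t) (ramp' t) r0 r1 r'0 r'50 => A B r0 r1 r'0 r'50.
  have eN0 : 0 < expR (- N * q) by exact: expR_gt0.
  have d'0 : 0 < delta^-1 by rewrite invr_gt0.
  have [q12|q12] := leP q (1 / 2).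
    have -> : (1 - 9 / 8 * delta <= enorm y <= 1 - 3 / 8 * delta) = false.
      apply/negP => /andP[y1 _]; have : (1 - 9 / 8 * delta) ^+ 2 <= q.
        by rewrite /q -sqr_enorm lerXn2r ?nnegrE ?enorm_ge0 //; lra.
      have : (55 / 64) ^+ 2 <= (1 - 9 / 8 * delta) ^+ 2.
        by rewrite lerXn2r ?nnegrE //; lra.
      lra.
    rewrite mulr_ge0 ?(ltW c0) //.
    have hH' : h y <= H.
      by apply: le_trans (ler_norm _) (hH _ _); rewrite /K /= subr0.
    have e1 : expR (- N * q) <= 1 by rewrite -expR0 ler_expR mulNr oppr_le0 mulr_ge0 // ltW.
    have l1 : - (2 * N) <= expR (- N * q) * (2 * N * (2 * q - 1) * A + 4 * q / delta * B).
      have p1 : 0 <= 4 * q / delta * B.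
        exact: (mulr_ge0 (mulr_ge0 (mulr_ge0 (ler0n _ 4) q0) (ltW d'0)) r'0).
      have p2 : - 1 <= (2 * q - 1) * A by nra.
      have p3 : - (2 * N) <= 2 * N * ((2 * q - 1) * A) by nra.
      rewrite -[2 * N * _ * A]mulrA.
      move: (expR _) (4 * q / delta * _) ((2 * q - 1) * A) e1 p1 p2 p3 eN0
        => E X Y e1 p1 p2 p3 E0; nra.
    move: (expR _ * _) l1 => F l1; nra.
  have p1 : 0 <= expR (- N * q) * (2 * N * (2 * q - 1) * A + 4 * q / delta * B).
    have q21 : 0 <= 2 * q - 1 by lra.
    apply: mulr_ge0 (ltW eN0) (addr_ge0 _ _).
      exact: (mulr_ge0 (mulr_ge0 (mulr_ge0 (ler0n _ 2) (ltW N0)) q21) r0).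
    exact: (mulr_ge0 (mulr_ge0 (mulr_ge0 (ler0n _ 4) q0) (ltW d'0)) r'0).
  case: ifP => [/andP[y1 y2]|_]; last first.
    by rewrite mulr_ge0 ?(ltW c0) // addr_ge0 // mulr_ge0.
  have t14 : 1 / 4 <= t <= 2.
    have u1 : q <= (1 - 3 / 8 * delta) ^+ 2.
      by rewrite /q -sqr_enorm lerXn2r ?nnegrE ?enorm_ge0 //; lra.
    have u2 : (1 - 9 / 8 * delta) ^+ 2 <= q.
      by rewrite /q -sqr_enorm lerXn2r ?nnegrE ?enorm_ge0 //; lra.
    by apply/andP; split; [rewrite ler_pdivlMr // | rewrite ler_pdivrMr //]; nra.
  have {}r'50 := r'50 t14.
  have qlt1 : q <= 1.
    case/andP: t14 => + _; rewrite ler_pdivlMr //; lra.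
  have eN : expR (- N) <= expR (- N * q) by rewrite ler_expR; nra.
  have p2 : expR (- N) / (25 * delta) <=
      expR (- N * q) * (2 * N * (2 * q - 1) * A + 4 * q / delta * B).
    apply: ler_pM => //.
      by rewrite invr_ge0 mulr_ge0 // ltW.
    have w1 : 0 <= 2 * N * (2 * q - 1) * A.
      have q21 : 0 <= 2 * q - 1 by lra.
      exact: (mulr_ge0 (mulr_ge0 (mulr_ge0 (ler0n _ 2) (ltW N0)) q21) r0).
    (* Here 25 comes from 4 q [B] >= 4 (1 / 2) (1 / 50). *)
    have w2 : (25 * delta)^-1 <= 4 * q / delta * B.
      have z : 25^-1 <= 4 * q * B by nra.
      by rewrite invfM mulrAC ler_wpM2r // ltW.
    lra.
  have p3 : h y <= 25 * delta * expR N * (h y * (expR (- N) / (25 * delta))).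
    rewrite expRN le_eqVlt; apply/orP; left; apply/eqP; field.
    by rewrite !gt_eqF ?expR_gt0.
  apply: le_trans p3 _; rewrite ler_pM2l //.
  by apply: le_trans (ler_wpM2l hy p2) _; rewrite lerDl.
rewrite big_mkcond /=; apply: le_trans (ler_sum _ (fun v _ => key v)) _.
rewrite -mulr_sumr big_split /= sumr_const -[X in _ + X]mulr_natl.
have cl := @card_lattice_le R n m m0.
have b0 : 0 <= 2 * N * H by rewrite mulr_ge0 ?(ltW H0) // mulr_ge0 // ltW.
rewrite (_ : 25 * expR N * (1 + 2 * N * H * c3) * delta * m%:R ^+ n.+1 =
  25 * delta * expR N * (1 * m%:R ^+ n.+1 + c3 * m%:R ^+ n.+1 * (2 * N * H))); last by ring.
rewrite ler_pM2l; last by rewrite !mulr_gt0 // expR_gt0.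
apply: lerD; first exact: le_trans (ler_norm _) HM.
by apply: ler_wpM2r b0 _ _ _; exact: cl.
Qed.

End shell_estimate.

(** * A regularized fundamental solution *)

Section local_mean_estimate.
Context {R : realType} {n : nat}.
Implicit Types (q s eps : R) (m : nat).

Let N : R := n.+1%:R.
Let N0 : 0 < N. Proof. by rewrite ltr0n. Qed.

(** Up to a constant, minus the derivative in q of the fundamental solution in dimension N, with q
    replaced by eps^2 + q, times a cutoff at q = s^2. The exponent n + 1 in the cutoff keeps its
    contribution to the Laplacian bounded independently of [eps]. *)
Definition peak_k eps s q : R :=
  (eps ^+ 2 + q) `^ (- (N / 2)) * sqpos (1 - (q / s ^+ 2) ^+ n.+1).
Definition peak_k' eps s q : R :=
  - (N / 2) * (eps ^+ 2 + q) `^ (- (N / 2) - 1) * sqpos (1 - (q / s ^+ 2) ^+ n.+1)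
  - (eps ^+ 2 + q) `^ (- (N / 2)) *
    ((1 - (q / s ^+ 2) ^+ n.+1 + `|1 - (q / s ^+ 2) ^+ n.+1|) *
      (N * (q / s ^+ 2) ^+ n / s ^+ 2)).

Lemma is_derive_peak eps s q : 0 < eps -> 0 < s -> - eps ^+ 2 < q ->
  is_derive q 1 (peak_k eps s) (peak_k' eps s q).
Proof.
move=> e0 s0 qe; have b0 : 0 < eps ^+ 2 + q by lra.
have dl : is_derive q 1 (fun u : R => eps ^+ 2 + u) 1.
  by apply: is_derive_eq; rewrite add0r ?mulr1.
have dp := is_derive1_comp (is_derive1_powR (- (N / 2)) b0) dl.
have du : is_derive q 1 (fun u : R => 1 - (u / s ^+ 2) ^+ n.+1)
    (- (N * (q / s ^+ 2) ^+ n / s ^+ 2)).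
  have d1 : is_derive q 1 (fun u : R => u / s ^+ 2) (s ^- 2).
    by apply: is_derive_eq; rewrite /GRing.scale /=; ring.
  have := is_deriveX n.+1 d1; rewrite exprfctE => d2.
  pose w (u : R) := (u / s ^+ 2) ^+ n.+1.
  have d3 : is_derive q 1 w ((n.+1%:R * (q / s ^+ 2) ^+ n.+1.-1) *: s ^- 2) := d2.
  apply: (@is_derive_eq _ _ _ (fun u : R => 1 - w u)).
  rewrite /GRing.scale /= /N; ring.
have ds := is_derive1_comp (is_derive_sqpos _) du.
apply: (is_derive_eq (is_deriveM dp ds)).
by rewrite /peak_k' /GRing.scale /=; ring.
Qed.

Lemma continuous_peak_k' eps s q : 0 < eps -> 0 < s -> - eps ^+ 2 < q ->
  {for q, continuous (peak_k' eps s)}.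
Proof.
move=> e0 s0 qe; have b0 : 0 < eps ^+ 2 + q by lra.
have cl : {for q, continuous (fun u : R => eps ^+ 2 + u)}.
  by apply: cont_add; [exact: cont_cst|exact: cvg_id].
have cp c : {for q, continuous (fun u : R => (eps ^+ 2 + u) `^ c)}.
  apply: (@cont_comp _ _ (fun v => v `^ c) (fun u => eps ^+ 2 + u)) => //.
  have [d _] := is_derive1_powR c b0.
  exact/differentiable_continuous/derivable1_diffP.
have cX k : {for q, continuous (fun u : R => (u / s ^+ 2) ^+ k)}.
  have c1 : {for q, continuous (fun u : R => u / s ^+ 2)}.
    by apply: cont_mul; [exact: cvg_id|exact: cont_cst].
  apply: (@cont_comp R R (fun v : R => v ^+ k) (fun u : R => u / s ^+ 2)) => //.
  exact: exprn_continuous.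
have cu : {for q, continuous (fun u : R => 1 - (u / s ^+ 2) ^+ n.+1)}.
  by apply: cont_sub; [exact: cont_cst|exact: cX].
have cs : {for q, continuous (fun u : R => sqpos (1 - (u / s ^+ 2) ^+ n.+1))}.
  by apply: (@cont_comp R R sqpos) => //; exact: continuous_sqpos.
have ca : {for q, continuous (fun u : R => 1 - (u / s ^+ 2) ^+ n.+1 +
    `|1 - (u / s ^+ 2) ^+ n.+1|)}.
  by apply: (@cont_comp R R (fun v : R => v + `|v|)) => //; exact: continuous_add_abs.
suff : {for q, continuous (fun q =>
  - (N / 2) * (eps ^+ 2 + q) `^ (- (N / 2) - 1) * sqpos (1 - (q / s ^+ 2) ^+ n.+1)
  - (eps ^+ 2 + q) `^ (- (N / 2)) *
    ((1 - (q / s ^+ 2) ^+ n.+1 + `|1 - (q / s ^+ 2) ^+ n.+1|) *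
      (N * (q / s ^+ 2) ^+ n * (s ^+ 2)^-1)))} by [].
apply: cont_sub; apply: cont_mul => //.
  by apply: cont_mul => //; exact: cont_cst.
apply: cont_mul => //; apply: cont_mul; last exact: cont_cst.
by apply: cont_mul => //; exact: cont_cst.
Qed.

(** The terms in k' and k nearly cancel, leaving a negative bump concentrated at distance [eps] from
    [x0]; the second summand is due to the derivative of the cutoff. *)
Lemma peak_radial_lap eps s (x0 y : 'rV[R]_n.+1) (q := esq (y - x0)) :
  0 < eps -> 0 < s ->
  radial_lap (peak_k eps s) (peak_k' eps s) x0 y =
  - 2 * N * eps ^+ 2 * (eps ^+ 2 + q) `^ (- (N / 2) - 1) *
    sqpos (1 - (q / s ^+ 2) ^+ n.+1) +
  4 * N * (q / s ^+ 2) ^+ n.+1 * (eps ^+ 2 + q) `^ (- (N / 2)) *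
    (1 - (q / s ^+ 2) ^+ n.+1 + `|1 - (q / s ^+ 2) ^+ n.+1|).
Proof.
move=> e0 s0; rewrite /radial_lap -/q /peak_k /peak_k' -/N (exprSr (q / _)).
have b0 : 0 < eps ^+ 2 + q by rewrite ltr_wpDr ?esq_ge0 // exprn_gt0.
have -> : (eps ^+ 2 + q) `^ (- (N / 2)) =
    (eps ^+ 2 + q) * (eps ^+ 2 + q) `^ (- (N / 2) - 1).
  transitivity ((eps ^+ 2 + q) `^ 1 * (eps ^+ 2 + q) `^ (- (N / 2) - 1)).
    by rewrite -powRD ?(gt_eqF b0) ?implybT //; congr (_ `^ _); ring.
  by rewrite powRr1 ?(ltW b0).
move: (_ `^ _) (sqpos _) `|_| => P Q A.
by field; rewrite gt_eqF.
Qed.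

(** With u = q / s^2 <= 1 one has eps^2 + q >= (u s)^2, so the factor u^(n+1) of the positive term
    cancels the singularity. For q <= eps^2 one has u <= 1 / 4, hence a squared cutoff of at least 9
    / 16, and eps^2 + q <= 2 eps^2 bounds the bump from below. *)
Lemma peak_radial_lap_le eps s (x0 y : 'rV[R]_n.+1) (q := esq (y - x0)) :
  0 < eps -> 0 < s -> eps <= s / 2 ->
  radial_lap (peak_k eps s) (peak_k' eps s) x0 y <=
  (if q < s ^+ 2 then 8 * N * s ^- n.+1 else 0) -
  (if q <= eps ^+ 2 then N / 2 * (2 * eps) ^- n.+1 else 0).
Proof.
move=> e0 s0 es; rewrite peak_radial_lap // -/q.
have q0 : 0 <= q by exact: esq_ge0.
have e20 : 0 < eps ^+ 2 by rewrite exprn_gt0.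
have s20 : 0 < s ^+ 2 by rewrite exprn_gt0.
have b0 : 0 < eps ^+ 2 + q by rewrite ltr_wpDr.
have es2 : eps ^+ 2 <= s ^+ 2 / 4 by nra.
have [qs|qs] := ltP q (s ^+ 2); last first.
  have u1 : 1 <= (q / s ^+ 2) ^+ n.+1 by rewrite exprn_ege1 // ler_pdivlMr // mul1r.
  rewrite sqpos_le0 ?subr_le0 // ler0_norm ?subr_le0 // subrr !mulr0 addr0.
  have -> : (q <= eps ^+ 2) = false by apply/negbTE; rewrite -ltNge; lra.
  by rewrite subr0.
pose u := q / s ^+ 2.
have u0 : 0 <= u by rewrite divr_ge0 // ltW.
have u1 : u < 1 by rewrite ltr_pdivrMr // mul1r.
have un0 : 0 <= u ^+ n.+1 by rewrite exprn_ge0.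
have un1 : u ^+ n.+1 <= u by rewrite exprS ler_piMr // exprn_ile1 // ltW.
rewrite -/u.
have N2 : 0 <= N / 2 by rewrite divr_ge0 // ltW.
have half (b : R) : 0 <= b -> (b ^+ 2) `^ (- (N / 2)) = b ^- n.+1.
  move=> b0'; rewrite -powR_mulrn // -powRrM (_ : 2%:R * - (N / 2) = - N); last by field.
  by rewrite powR_invn.
have P1 : u ^+ n.+1 * (eps ^+ 2 + q) `^ (- (N / 2)) <= s ^- n.+1.
  have [->|un] := eqVneq u 0.
    by rewrite expr0n mul0r invr_ge0 exprn_ge0 // ltW.
  have up : 0 < u by rewrite lt_def un.
  have us : (u * s) ^+ 2 <= eps ^+ 2 + q.
    have -> : q = u * s ^+ 2 by rewrite divfK // gt_eqF.
    rewrite exprMn; nra.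
  apply: (@le_trans _ _ (u ^+ n.+1 * ((u * s) ^+ 2) `^ (- (N / 2)))).
    have us0 : 0 < (u * s) ^+ 2 by rewrite exprn_gt0 // mulr_gt0.
    rewrite ler_pM2l ?exprn_gt0 // !powRN lef_pV2 ?posrE ?(powR_gt0 _ us0) ?(powR_gt0 _ b0) //.
    by apply: (ge0_ler_powR N2); rewrite ?nnegrE ?(ltW b0) ?sqr_ge0.
  rewrite (half _ (mulr_ge0 u0 (ltW s0))).
  rewrite (_ : (u * s) ^+ n.+1 = u ^+ n.+1 * s ^+ n.+1); last exact: exprMn.
  rewrite invfM mulrA divff ?mul1r //.
  by rewrite gt_eqF // exprn_gt0.
have w0 : 0 <= 1 - u ^+ n.+1 by lra.
rewrite (ger0_norm w0) (sqpos_ge0E w0).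
have Ppos : 0 <= (eps ^+ 2 + q) `^ (- (N / 2) - 1) by exact: powR_ge0.
have second : 4 * N * u ^+ n.+1 * (eps ^+ 2 + q) `^ (- (N / 2)) *
    (1 - u ^+ n.+1 + (1 - u ^+ n.+1)) <= 8 * N * s ^- n.+1.
  have z0 : 0 <= u ^+ n.+1 * (eps ^+ 2 + q) `^ (- (N / 2)) by rewrite mulr_ge0 ?powR_ge0.
  move: P1 z0; rewrite -[4 * N * _ * _]mulrA.
  move: (u ^+ n.+1 * _) (s ^- _) => z w zw z0.
  rewrite (_ : _ * _ = 8 * N * (z * (1 - u ^+ n.+1))); last by ring.
  rewrite ler_wpM2l ?mulr_ge0 ?(ltW N0) //.
  by apply: le_trans zw; rewrite ler_piMr //; lra.
have [qe|qe] := leP q (eps ^+ 2); last first.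
  rewrite subr0; apply: le_trans second; rewrite gerDr.
  have := mulr_ge0 (mulr_ge0 (mulr_ge0 (ltW N0) (ltW e20)) Ppos) (sqr_ge0 (1 - u ^+ n.+1)).
  by lra.
rewrite [leLHS]addrC; apply: lerD second _.
rewrite -lerN2 opprK.
have u4 : u <= 1 / 4 by rewrite ler_pdivrMr //; lra.
have w34 : 9 / 16 <= (1 - u ^+ n.+1) ^+ 2 by nra.
have P2 : (2 * eps) ^- n.+1 / (2 * eps ^+ 2) <= (eps ^+ 2 + q) `^ (- (N / 2) - 1).
  have two : eps ^+ 2 + q <= 2 * eps ^+ 2 by lra.
  rewrite powRD ?(gt_eqF b0) ?implybT // powR_inv1 ?(ltW b0) //.
  apply: ler_pM.
  - by rewrite invr_ge0 exprn_ge0 // mulr_ge0 // ltW.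
  - by rewrite invr_ge0 mulr_ge0 // ltW.
  - rewrite -half; last by rewrite mulr_ge0 // ltW.
    have ee0 : 0 < (2 * eps) ^+ 2 by rewrite exprn_gt0 // mulr_gt0.
    rewrite !powRN lef_pV2 ?posrE ?(powR_gt0 _ ee0) ?(powR_gt0 _ b0) //.
    by apply: (ge0_ler_powR N2); rewrite ?nnegrE ?(ltW b0) ?sqr_ge0 //; nra.
  - by rewrite lef_pV2 ?posrE // mulr_gt0.
have -> : - (- 2 * N * eps ^+ 2 * (eps ^+ 2 + q) `^ (- (N / 2) - 1) *
    (1 - u ^+ n.+1) ^+ 2) = 2 * N * ((eps ^+ 2 * (eps ^+ 2 + q) `^ (- (N / 2) - 1)) *
    (1 - u ^+ n.+1) ^+ 2) by ring.
have P3 : (2 * eps) ^- n.+1 / 2 <= eps ^+ 2 * (eps ^+ 2 + q) `^ (- (N / 2) - 1).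
  rewrite -ler_pdivrMl //; apply: le_trans P2.
  rewrite (_ : (2 * eps) ^- n.+1 / (2 * eps ^+ 2) =
    (eps ^+ 2)^-1 * ((2 * eps) ^- n.+1 / 2)) // invfM.
  by move: ((2 * eps) ^- n.+1) (eps ^- 2) => Z W; ring.
have z0 : 0 <= (2 * eps) ^- n.+1 by rewrite invr_ge0 exprn_ge0 // mulr_ge0 // ltW.
move: P3 w34 z0; move: (eps ^+ 2 * _) ((1 - _) ^+ 2) ((2 * eps) ^- n.+1) => X W Z XZ W9 Z0.
have XW : Z / 4 <= X * W by nra.
have := N0; nra.
Qed.

End local_mean_estimate.

(** * Sums over separated points of a shell *)

Section separated_points.
Context {R : realType} {n : nat}.
Implicit Types (z : 'rV[R]_n.+1) (s eps e : R) (m : nat) (h : 'rV[R]_n.+1 -> R).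

Let N : R := n.+1%:R.
Let N0 : 0 < N. Proof. by rewrite ltr0n. Qed.
Let N1 : 1 <= N. Proof. by rewrite ler1n. Qed.

(** The cube of half-side r = eps / N lies in the Euclidean ball; each coordinate offers at least 2
    r m - 1 >= r m indices. *)
Lemma card_lattice_ball z eps m : 0 < eps ->
  (forall i, `|z ord0 i| + eps / N <= 1) -> N / eps <= m%:R ->
  (eps * m%:R / N) ^+ n.+1 <=
  #|[set v : lattice m | esq (lat_point v - z) <= eps ^+ 2]%SET|%:R.
Proof.
move=> e0 ze mN.
have mR : 0 < m%:R :> R by apply: lt_le_trans mN; rewrite divr_gt0.
pose r := eps / N; have r0 : 0 < r by rewrite divr_gt0.
have mr : 1 <= r * m%:R.
  by rewrite /r mulrAC ler_pdivlMr // mul1r -ler_pdivrMl // mulrC.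
pose S i := [set k : 'I_(m.*2).+1 | m%:R * (1 + z ord0 i - r) <= k%:R <=
   m%:R * (1 + z ord0 i + r)]%SET.
pose X := [set v : {ffun 'I_n.+1 -> 'I_(m.*2).+1} | [forall i, v i \in S i]]%SET.
apply: (@le_trans _ _ #|X|%:R); last first.
  rewrite ler_nat; apply: subset_leq_card; apply/fintype.subsetP => v.
  rewrite !inE => /forallP vS.
  have -> : eps = N * r by rewrite /r mulrC divfK // gt_eqF.
  rewrite -enorm_le; last exact: (mulr_ge0 (ltW N0) (ltW r0)).
  apply: enorm_le_coord; first exact: ltW.
  move=> i; have := vS i; rewrite inE !mxE => /andP[h1 h2].
  rewrite ler_norml; apply/andP; split.
    have : 1 + z ord0 i - r <= (v i)%:R / m%:R by rewrite ler_pdivlMr // mulrC.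
    lra.
  have : (v i)%:R / m%:R <= 1 + z ord0 i + r by rewrite ler_pdivrMr // mulrC.
  lra.
rewrite /X card_ffun_prod natr_prod -[X in _ ^+ X]card_ord -prodr_const.
apply: ler_prod => i _; apply/andP; split.
  by rewrite divr_ge0 ?(ltW N0) // mulr_ge0 // ltW.
have := ze i; rewrite -/r => zir.
have := ler_norm (z ord0 i); have := ler_norm (- z ord0 i); rewrite normrN => l1 l2.
apply: le_trans (card_ord_itv_ge _ _); last 2 first.
- by rewrite mulr_ge0 ?(ltW mR) //; lra.
- rewrite -natr1 -muln2 natrM.
  have : m%:R * (1 + z ord0 i + r) <= m%:R * 2 by rewrite ler_pM2l //; lra.
  lra.
rewrite (_ : eps * m%:R / N = r * m%:R); last by rewrite /r mulrAC.
lra.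
Qed.

(** By continuity h is at least h z / 2 on a ball whose radius [eps] depends on h and z. The
    dependence disappears from the result: the weight (2 eps)^(-n-1) of the bump meets at least (eps
    m / N)^(n+1) lattice points. *)
Lemma local_mean_le h z s e :
  harmonic_on (unit_ball R n) h -> (forall x, 0 <= h x) -> 0 < s -> 0 < e ->
  (forall y, esq (y - z) <= (2 * s) ^+ 2 -> enorm y < 1) ->
  exists M, forall m, (M <= m)%N ->
    N / 4 * (2 * N) ^- n.+1 * h z * m%:R ^+ n.+1 <=
    8 * N * s ^- n.+1 *
      \sum_(v : lattice m | esq (lat_point v - z) < s ^+ 2) h (lat_point v) +
    e * m%:R ^+ n.+1.
Proof.
move=> hh h0 s0 e0 zball.
have zU : unit_ball R n z.
  by apply: zball; rewrite subrr -sqr_enorm enorm0 expr0n /= sqr_ge0.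
have [r r0 hr] : exists2 r : R, 0 < r & forall y, enorm (y - z) <= r -> h z / 2 <= h y.
  have [hz|hz] := leP (h z) 0.
    exists 1 => // y _; apply: le_trans (h0 y); lra.
  have /cvgr_dist_lt/(_ (h z / 2)) : {for z, continuous h} by case: (proj1 hh z zU).
  rewrite divr_gt0 // => /(_ isT) /nbhs_ballP[r /= r0 hr].
  exists (r / 2); first by rewrite divr_gt0.
  move=> y yr; have : `|h z - h y| < h z / 2.
    apply: hr; split => // i j; rewrite (ord1 i) /ball /= distrC.
    have := coord_le_enorm (y - z) j; rewrite !mxE => h1.
    by apply: le_lt_trans h1 _; lra.
  have := ler_norm (h z - h y); lra.
pose eps : R := Num.min r (s / 2).
have eps0 : 0 < eps by rewrite lt_min r0 divr_gt0.
have epsr : eps <= r by rewrite ge_min lexx.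
have epss : eps <= s / 2 by rewrite ge_min lexx orbT.
have e20 : 0 < eps ^+ 2 by rewrite exprn_gt0.
have zi i : `|z ord0 i| + eps / N <= 1.
  have en : eps / N <= eps by rewrite ler_pdivrMr // ler_peMr // ltW.
  have key (t : R) : `|t| = eps -> `|z ord0 i + t| <= 1.
    move=> te; have zt : enorm (z + t *: unit_vec i : 'rV[R]_n.+1) < 1.
      apply: zball; rewrite esq_line subrr /esq.
      rewrite big1 ?mxE; last by move=> j _; rewrite mxE expr0n.
      rewrite mulr0 mul0r !add0r -sqr_normr te lerXn2r ?nnegrE ?(ltW eps0) //; lra.
    have := coord_le_enorm (z + t *: unit_vec i) i.
    by rewrite !mxE !eqxx mulr1 => /le_trans; apply; exact: ltW.
  have k1 := key eps (gtr0_norm eps0).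
  have k2 : `|z ord0 i - eps| <= 1 by apply: key; rewrite normrN gtr0_norm.
  have [zp|zn] := leP 0 (z ord0 i).
    by rewrite (ger0_norm zp); apply: le_trans (ler_normlW k1); rewrite lerD2l.
  rewrite (ltr0_norm zn); apply: (@le_trans _ _ (- z ord0 i + eps)).
    by rewrite lerD2l.
  have := lerNnormlW k2; lra.
have kS q : s ^+ 2 <= q -> peak_k (n := n) eps s q = 0.
  move=> sq; rewrite /peak_k sqpos_le0 ?mulr0 // subr_le0 exprn_ege1 //.
  by rewrite ler_pdivlMr ?exprn_gt0 // mul1r.
have [|M HM] := @radial_identity R n _ _ (eps ^+ 2) (s ^+ 2) ((2 * s) ^+ 2) z
  e20 (fun q => @is_derive_peak R n eps s q eps0 s0)
  (fun q => @continuous_peak_k' R n eps s q eps0 s0)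
  (exprn_gt0 2 s0) _ kS zball h e hh e0.
  by rewrite exprMn; have := exprn_gt0 2 s0; lra.
exists (maxn M (Num.truncn (N / eps)).+1) => m; rewrite geq_max => /andP[/HM {}HM mN].
have {}mN : N / eps <= m%:R.
  by apply: ltW; apply: lt_le_trans (Num.Theory.truncnS_gt _) _; rewrite ler_nat.
have mR : 0 < m%:R :> R by apply: lt_le_trans mN; rewrite divr_gt0.
have cnt := card_lattice_ball eps0 zi mN.
have key : - (e * m%:R ^+ n.+1) <=
    \sum_(v : lattice m) (8 * N * s ^- n.+1 *
       (if esq (lat_point v - z) < s ^+ 2 then h (lat_point v) else 0)
     - N / 2 * (2 * eps) ^- n.+1 *
       (if esq (lat_point v - z) <= eps ^+ 2 then h z / 2 else 0)).
  apply: (@le_trans _ _ (\sum_(v : lattice m) h (lat_point v) *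
      radial_lap (peak_k (n := n) eps s) (peak_k' (n := n) eps s) z (lat_point v))).
    by have := ler_norm (- (\sum_(v : lattice m) h (lat_point v) *
      radial_lap (peak_k (n := n) eps s) (peak_k' (n := n) eps s) z (lat_point v)));
     rewrite normrN; lra.
  apply: ler_sum => v _.
  have := peak_radial_lap_le z (lat_point v) eps0 s0 epss.
  move=> /(ler_wpM2l (h0 (lat_point v))) /le_trans; apply.
  rewrite mulrBr; apply: lerB.
    by case: ifP => _; rewrite ?mulr0 // mulrC.
  case: ifP => [ve|_]; last by rewrite !mulr0.
  rewrite [leRHS]mulrC ler_wpM2l //.
    rewrite mulr_ge0 ?divr_ge0 ?(ltW N0) // invr_ge0 exprn_ge0 // mulr_ge0 //.
    exact: ltW.
  by apply: hr; apply: le_trans epsr; rewrite enorm_le // ltW.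
move: key; rewrite sumrB -!mulr_sumr -big_mkcond -big_mkcond /= sumr_const.
rewrite -[X in _ - _ * X]mulr_natl.
set A := \sum_(v | _) _; set B := #|_|%:R.
have cB : (eps * m%:R / N) ^+ n.+1 <= B.
  by apply: le_trans cnt _; rewrite /B ler_nat; apply: subset_leq_card;
    apply/fintype.subsetP => v; rewrite inE.
have cB' : N / 4 * (2 * N) ^- n.+1 * h z * m%:R ^+ n.+1 <=
    N / 2 * (2 * eps) ^- n.+1 * (B * (h z / 2)).
  apply: (@le_trans _ _ (N / 2 * (2 * eps) ^- n.+1 * ((eps * m%:R / N) ^+ n.+1 * (h z / 2)))).
    rewrite !exprMn exprVn.
    have E0 : eps ^+ n.+1 != 0 by rewrite gt_eqF // exprn_gt0.
    have NN0 : N ^+ n.+1 != 0 by rewrite gt_eqF // exprn_gt0.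
    have T0 : 2 ^+ n.+1 != 0 :> R by rewrite gt_eqF // exprn_gt0.
    move: (eps ^+ n.+1) (N ^+ n.+1) (2 ^+ n.+1) (m%:R ^+ n.+1) E0 NN0 T0.
    move=> E F T X E0 F0 T0.
    rewrite le_eqVlt; apply/orP; left; apply/eqP; field.
    by rewrite E0 F0 T0.
  apply: ler_wpM2l.
    rewrite mulr_ge0 ?divr_ge0 ?(ltW N0) // invr_ge0 exprn_ge0 // mulr_ge0 //.
    exact: ltW.
  by apply: ler_wpM2r => //; rewrite divr_ge0.
lra.
Qed.

(** [local_mean_le] is applied on balls of radius delta / 8, disjoint by separation and contained in
    the shell of [shell_sum_le]. Dividing a shell mass of order delta by a ball volume of order
    delta^(n+1) gives delta^(-n), whatever the number of points. *)
Lemma separated_sum_le h :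
  harmonic_on (unit_ball R n) h -> (forall x, 0 <= h x) ->
  exists2 C : R, 0 < C & forall (delta : R) (K : nat) (x : 'I_K -> 'rV[R]_n.+1),
    0 < delta <= 1 / 8 ->
    (forall i, 1 - delta <= enorm (x i) <= 1 - delta / 2) ->
    (forall i j, i != j -> delta / 4 <= enorm (x i - x j)) ->
    \sum_i h (x i) <= C * delta ^- n.
Proof.
move=> hh h0; have [C1 C10 shell] := shell_sum_le hh h0.
pose c0 := N / 4 * (2 * N) ^- n.+1.
have c00 : 0 < c0.
  by apply: mulr_gt0; [rewrite divr_gt0|rewrite invr_gt0 exprn_gt0 // mulr_gt0].
exists ((8 * N * C1 + 1) * 8 ^+ n.+1 / c0).
  apply: divr_gt0 => //; apply: mulr_gt0; last by rewrite exprn_gt0.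
  by rewrite ltr_wpDl // !mulr_ge0 // ltW.
move=> delta K x d01 xshell xsep; have [d0 d8] := andP d01.
pose s := delta / 8; have s0 : 0 < s by rewrite divr_gt0.
have [M0 HM0] := shell delta d01.
(* The admissible error is shared among the [K] points, whose number is not bounded beforehand;
   [K.+1] keeps the quotient positive when [K] is 0. *)
pose e := delta * s ^- n.+1 / K.+1%:R.
have sn0 : 0 < s ^- n.+1 by rewrite invr_gt0 exprn_gt0.
have e0 : 0 < e by rewrite divr_gt0 // mulr_gt0.
have /choice[M HM] : forall i, exists M, forall m, (M <= m)%N ->
    c0 * h (x i) * m%:R ^+ n.+1 <= 8 * N * s ^- n.+1 *
      \sum_(v : lattice m | esq (lat_point v - x i) < s ^+ 2) h (lat_point v) +
    e * m%:R ^+ n.+1.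
  move=> i; apply: local_mean_le => // y; have /andP[_ xi] := xshell i.
  rewrite -enorm_le; last exact: (mulr_ge0 (ler0n _ 2) (ltW s0)).
  move=> ys.
  have := ler_enormB y (x i); move: ys; rewrite /s; lra.
pose m := maxn 1 (maxn M0 (\max_i M i)).
have m0 : (0 < m)%N by rewrite leq_max.
have mM0 : (M0 <= m)%N by rewrite !leq_max leqnn !orbT.
have mM i : (M i <= m)%N.
  by rewrite !leq_max (leq_bigmax_cond (F := M)) ?orbT.
have mR : 0 < m%:R ^+ n.+1 :> R by rewrite exprn_gt0 // ltr0n.
have {}HM := HM _ m (mM _).
have {}HM0 := HM0 m mM0.
have disj : \sum_i \sum_(v : lattice m | esq (lat_point v - x i) < s ^+ 2) h (lat_point v)
    <= C1 * delta * m%:R ^+ n.+1.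
  apply: le_trans HM0; under eq_bigr do rewrite big_mkcond.
  rewrite exchange_big /= [leRHS]big_mkcond; apply: ler_sum => v _.
  case: (pickP (fun i => esq (lat_point v - x i) < s ^+ 2)) => [i vi|none]; last first.
    rewrite big1; last by move=> i _; rewrite none.
    by case: ifP.
  rewrite (bigD1 i) //= vi big1 ?addr0; last first.
    move=> j ji; case: ifP => // vj; exfalso.
    have := xsep _ _ ji; rewrite leNgt => /negP; apply.
    apply: le_lt_trans (ler_enorm_dist (lat_point v) _ _) _.
    rewrite enorm_distC; move: vi vj; rewrite -!enorm_lt ?(ltW s0) // /s; lra.
  rewrite ifT //; move: vi; rewrite -enorm_lt ?(ltW s0) // => vi.
  have /andP[x1 x2] := xshell i.
  have := ler_enormB (lat_point v) (x i).
  have := ler_enormB (x i) (lat_point v); rewrite [enorm (x i - _)]enorm_distC.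
  by move: vi; rewrite /s => ? ? ?; apply/andP; split; lra.
have total : c0 * (\sum_i h (x i)) * m%:R ^+ n.+1 <=
    (8 * N * C1 + 1) * s ^- n.+1 * delta * m%:R ^+ n.+1.
  apply: (@le_trans _ _ (8 * N * s ^- n.+1 * (C1 * delta * m%:R ^+ n.+1) +
      K%:R * (e * m%:R ^+ n.+1))).
    rewrite mulr_sumr mulr_suml; apply: le_trans (ler_sum _ (fun i _ => HM i)) _.
    rewrite big_split /= -mulr_sumr sumr_const card_ord -[X in _ + X]mulr_natl.
    by rewrite lerD2r ler_wpM2l // !mulr_ge0 // ltW.
  have Ke : K%:R * e <= delta * s ^- n.+1.
    rewrite /e mulrCA ler_piMr //; first exact: (ltW (mulr_gt0 d0 sn0)).
    by rewrite ler_pdivrMr // mul1r ler_nat.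
  rewrite [K%:R * _]mulrA.
  rewrite (_ : (8 * N * C1 + 1) * s ^- n.+1 * delta * m%:R ^+ n.+1 =
    8 * N * s ^- n.+1 * (C1 * delta) * m%:R ^+ n.+1 +
    delta * s ^- n.+1 * m%:R ^+ n.+1); last by ring.
  apply: lerD; last by rewrite ler_pM2r.
  by rewrite le_eqVlt; apply/orP; left; apply/eqP; ring.
move: total; rewrite ler_pM2r // -ler_pdivlMl // => /le_trans; apply.
rewrite le_eqVlt; apply/orP; left; apply/eqP.
have -> : s ^- n.+1 = 8 ^+ n.+1 / (delta * delta ^+ n).
  by rewrite /s expr_div_n invf_div -exprS.
have dn0 : delta ^+ n != 0 by rewrite gt_eqF // exprn_gt0.
move: (8 ^+ n.+1) (delta ^+ n) dn0 (8 * N * C1 + 1) => E D dn0 A.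
suff gen (c : R) : c != 0 ->
    c^-1 * (A * (E / (delta * D)) * delta) = A * E / c / D.
  by apply: gen; rewrite gt_eqF.
by move=> cn; field; rewrite cn dn0 gt_eqF.
Qed.

End separated_points.

(** * Covering the points of large growth *)

Section upper_bound.
Context {R : realType} {n : nat}.
Implicit Types (x y : 'rV[R]_n.+1) (h : 'rV[R]_n.+1 -> R).

Lemma maximal_separated (X : set 'rV[R]_n.+1) (r B : R) : 0 < r ->
  (forall K (x : 'I_K -> 'rV[R]_n.+1), (forall i, X (x i)) ->
    (forall i j, i != j -> r <= enorm (x i - x j)) -> K%:R <= B) ->
  exists K (x : 'I_K -> 'rV[R]_n.+1), K%:R <= B /\
    forall y, X y -> exists i, enorm (y - x i) < r.
Proof.
move=> r0 bound.
pose P K := `[< exists x : 'I_K -> 'rV[R]_n.+1, (forall i, X (x i)) /\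
  (forall i j, i != j -> r <= enorm (x i - x j)) >].
have P0 : exists K, P K.
  by exists 0%N; apply/asboolP; exists (fun=> 0); split=> [[]|[]].
have PB K : P K -> (K <= Num.truncn B)%N.
  move=> /asboolP[x [Xx sx]]; have := bound K x Xx sx => KB.
  by rewrite Num.Theory.truncn_ge_nat //; exact: le_trans KB.
case: (ex_maxnP P0 PB) => K /asboolP[x [Xx sx]] Kmax.
exists K, x; split; first exact: bound sx.
move=> y Xy; apply: contrapT => /forallNP far.
have {}far i : r <= enorm (y - x i) by rewrite leNgt; apply/negP; exact: far.
suff : P K.+1 by move=> /Kmax; rewrite ltnn.
apply/asboolP.
exists (fun i : 'I_K.+1 => if unlift ord_max i is Some j then x j else y); split.
  by move=> i; case: unliftP.
move=> i j; case: unliftP => [i' ->|->]; case: unliftP => [j' ->|->] //.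
- by move=> ij; apply: sx; apply: contraNneq ij => ->.
- by move=> _; rewrite enorm_distC.
- by rewrite eqxx.
Qed.

Lemma dyadic_scale (u : R) (J : nat) : 0 < u <= 2^-1 ^+ J ->
  exists2 j, (J <= j)%N & 2^-1 ^+ j.+1 <= u <= 2^-1 ^+ j.
Proof.
move=> /andP[u0 uJ]; have h0 : 0 <= 2^-1 :> R by lra.
have h1 : 2^-1 <= 1 :> R by lra.
have [k ku] := exists_half_pow_lt u0.
elim: k ku => [|k IH] ku.
  exists J => //; rewrite uJ andbT; apply: le_trans (ltW ku).
  by rewrite expr0 exprn_ile1.
have [kJ|Jk] := ltnP k J.
  exists J => //; rewrite uJ andbT; apply: le_trans (ltW ku).
  by rewrite ler_wiXn2l // (leq_trans kJ).
have [h|h] := ltP (2^-1 ^+ k) u; first exact: IH.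
by exists k => //; rewrite h (ltW ku).
Qed.

Definition growth_ratio h y (r : R) : \bar R :=
  (lne (h (r *: y))%:E / (- ln (1 - r))%:E)%E.

Definition growth h y : \bar R := limf_esup (growth_ratio h y) (1%R : R)^'-.

Lemma growth_ratio_gt h y (r b : R) : 0 < r < 1 ->
  (b%:E < growth_ratio h y r)%E -> expR (b * - ln (1 - r)) < h (r *: y).
Proof.
move=> /andP[r0 r1]; rewrite /growth_ratio.
have L0 : 0 < - ln (1 - r) by rewrite oppr_gt0 ln_lt0 //; lra.
move: (- ln (1 - r)) L0 => L L0.
have [hv|hv] := leP (h (r *: y)) 0.
  (* [lne] is -oo at nonpositive values and the denominator is positive, so the ratio would be
     -oo. *)
  rewrite le0_lneNy ?lee_fin // => H; exfalso; move: H.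
  by rewrite inver gt_eqF // gt0_mulNye ?lte_fin ?invr_gt0 // ltNge leNye.
rewrite lne_EFin // inver gt_eqF // -EFinM lte_fin ltr_pdivlMr // => H.
by rewrite -ltr_ln ?posrE ?expR_gt0 // expRK.
Qed.

Lemma le_growth_ratio h y (r b : R) : 0 < r < 1 ->
  expR (b * - ln (1 - r)) <= h (r *: y) -> (b%:E <= growth_ratio h y r)%E.
Proof.
move=> /andP[r0 r1]; rewrite /growth_ratio.
have L0 : 0 < - ln (1 - r) by rewrite oppr_gt0 ln_lt0 //; lra.
move: (- ln (1 - r)) L0 => L L0 H.
have hv : 0 < h (r *: y) by apply: lt_le_trans H; exact: expR_gt0.
rewrite lne_EFin // inver gt_eqF // -EFinM lee_fin ler_pdivlMr //.
by rewrite -[leLHS]expRK ler_ln ?posrE ?expR_gt0.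
Qed.

Lemma growth_frequently_gt h y (b : R) (J : nat) : (b%:E < growth h y)%E ->
  exists2 r, 1 - 2^-1 ^+ J < r < 1 & (b%:E < growth_ratio h y r)%E.
Proof.
move=> bg; have J0 : 0 < 2^-1 ^+ J :> R by rewrite exprn_gt0 // invr_gt0.
pose V : set R := [set r | 1 - 2^-1 ^+ J < r < 1].
have VF : (1 : R)^'- V.
  near=> r; apply/andP; split.
    by near: r; apply: nbhs_left_gt; lra.
  by near: r; exact: nbhs_left_lt.
have : (b%:E < ereal_sup (growth_ratio h y @` V))%E.
  apply: lt_le_trans bg _; rewrite /growth limf_esupE.
  by apply: ereal_inf_lbound; exists V.
by move=> /ereal_sup_gt[_ [r Vr <-] br]; exists r.
Unshelve. all: by end_near. Qed.

Lemma le_growth h y (b : R) :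
  (forall u : R, 0 < u -> exists2 r, 1 - u < r < 1 & (b%:E <= growth_ratio h y r)%E) ->
  (b%:E <= growth h y)%E.
Proof.
move=> H; rewrite /growth limf_esupE; apply: le_ereal_inf_tmp => _ [V VF <-].
have [u /= u0 uV] := VF.
have [r /andP[r1 r2] br] := H u u0.
apply: le_trans br _; apply: ereal_sup_ubound; exists r => //.
apply: uV => //=; rewrite ger0_norm; lra.
Qed.

(** With [b] strictly between n - s and [b0], scale 2^(-j) uses of order 2^(j (n - b)) sets of
    diameter 4 * 2^(-j), at a cost of order 2^(-j tau) with tau = s - n + b > 0. A tail of this
    geometric series is as small as desired, and each point of the set appears in it. *)
Lemma limsup_set_coverable h (b0 s : R) :
  harmonic_on (unit_ball R n) h -> (forall x, 0 <= h x) -> 0 < s ->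
  n%:R - b0 < s -> forall e, 0 < e ->
  coverable (fun u : R => u `^ s)
    [set y | unit_sphere R n y /\ (b0%:E <= growth h y)%E] e.
Proof.
move=> hh h0 s0 sb e e0.
have [C C0 HC] := separated_sum_le hh h0.
pose b := (b0 + (n%:R - s)) / 2.
have bb0 : b < b0 by rewrite /b; lra.
pose tau := s - (n%:R - b); have tau0 : 0 < tau by rewrite /tau /b; lra.
pose delta j : R := 2^-1 ^+ j.
have delta0 j : 0 < delta j by rewrite exprn_gt0 // invr_gt0.
(* The radius r found for a point satisfies delta_j / 2 <= 1 - r <= delta_j; the factor 2^(-|b|)
   absorbs this imprecision for either sign of [b]. *)
pose T j := 2 `^ (- `|b|) * delta j `^ (- b).
have T0 j : 0 < T j by rewrite mulr_gt0 // powR_gt0.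
pose X j : set 'rV[R]_n.+1 := [set x | 1 - delta j <= enorm x <= 1 - delta j / 2 /\ T j <= h x].
pose E j : set 'rV[R]_n.+1 := [set y | unit_sphere R n y /\ exists r, 1 - delta j <= r <= 1 - delta j / 2 /\ T j <= h (r *: y)].
pose B j := C * delta j ^- n / T j.
pose c := C * 2 `^ `|b| * 4 `^ s.
have c0 : 0 < c by rewrite !mulr_gt0 // powR_gt0.
pose q : R := 2^-1 `^ tau.
have q0 : 0 < q by rewrite powR_gt0 // invr_gt0.
have h0' : 0 <= 2^-1 :> R by lra.
have h1' : 2^-1 <= 1 :> R by lra.
have q1 : q < 1.
  have := @gt0_ltr_powR R tau tau0 2^-1 1.
  by rewrite powR1 !nnegrE; apply => //; lra.
have qE j : q ^+ j = delta j `^ tau.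
  by rewrite /q -powR_mulrn ?powR_ge0 // -powRrM mulrC powRrM powR_mulrn.
have Bq j : B j * (4 * delta j) `^ s = c * q ^+ j.
  have dj := delta0 j.
  have dE : delta j `^ tau = delta j ^- n * delta j `^ b * delta j `^ s.
    rewrite -powR_invn ?(ltW dj) // -!powRD ?(gt_eqF dj) ?implybT //.
    by congr (_ `^ _); rewrite /tau; ring.
  rewrite qE dE /B /T /c powRM ?(ltW dj) // !(powRN _ `|b|) !powRN invfM !invrK.
  by move: (delta j ^- n) => Z; ring.
have coverE j e' : (3 <= j)%N -> 0 < e' ->
    coverable (fun u : R => u `^ s) (E j) (c * q ^+ j + e').
  move=> j3 e'0.
  have d18 : 0 < delta j <= 1 / 8.
    rewrite delta0 /=; apply: (@le_trans _ _ (2^-1 ^+ 3)); first by rewrite ler_wiXn2l.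
    by rewrite !exprS expr0; lra.
  have d40 : 0 < delta j / 4 by rewrite divr_gt0.
  have [|K [x [KB near]]] := @maximal_separated (X j) (delta j / 4) (B j) d40.
    move=> K x Xx sx; rewrite ler_pdivlMr //.
    apply: le_trans (HC (delta j) K x d18 (fun i => (Xx i).1) sx).
    apply: le_trans (_ : \sum_(i < K) T j <= _).
      by rewrite sumr_const card_ord -[leRHS]mulr_natl.
    by apply: ler_sum => i _; exact: (Xx i).2.
  (* y is within delta_j of r y, which is within delta_j / 4 of a net point; [insub] completes the
     finite net by empty sets. *)
  pose F i : set 'rV[R]_n.+1 := if insub i is Some k then [set y | enorm (y - x k) <= 2 * delta j] else set0.
  apply: (@coverable_le _ _ _ _ (K%:R * (4 * delta j) `^ s + e')).
    by rewrite lerD2r -Bq ler_wpM2r // powR_ge0.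
  apply: (@coverable_sub _ _ _ _ (\bigcup_(i in `I_K) F i)).
    move=> y [yS [r [/andP[r1 r2] hr]]].
    have rpos : 0 < r by case/andP: d18; lra.
    have yr : enorm (r *: y) = r by rewrite enormZ yS mulr1 gtr0_norm.
    have [|k xk] := near (r *: y).
      by split; rewrite ?yr ?r1.
    exists (k : nat); first exact: ltn_ord.
    rewrite /F (valK k) /=; apply: le_trans (ler_enorm_dist (r *: y) _ _) _.
    have -> : y - r *: y = (1 - r) *: y by rewrite scalerBl scale1r.
    have d0 := delta0 j.
    rewrite enormZ yS mulr1 ger0_norm; last by lra.
    by move: xk; lra.
  apply: coverable_finite => //; first by rewrite mulr_gt0.
  move=> i y y'; rewrite /F; case: insubP => // k _ _ /= yk y'k.
  have := ler_enorm_dist (x k) y y'; rewrite [enorm (x k - _)]enorm_distC.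
  by move: yk y'k; lra.
have [J [J3 Jq]] : exists J, (3 <= J)%N /\ c * q ^+ J / (1 - q) <= e / 2.
  pose z := e / 2 * (1 - q) / c.
  have z0 : 0 < z by rewrite divr_gt0 // mulr_gt0 ?divr_gt0 // subr_gt0.
  have zp : 0 < z `^ tau^-1 by rewrite powR_gt0.
  have [k kz] := exists_half_pow_lt zp.
  exists (maxn 3 k); split; first by rewrite leq_maxl.
  rewrite ler_pdivrMr ?subr_gt0 // -ler_pdivlMl // mulrC -/z qE.
  have -> : z = (z `^ tau^-1) `^ tau by rewrite -powRrM mulVf ?gt_eqF // powRr1 // ltW.
  apply: (ge0_ler_powR (ltW tau0)); rewrite ?nnegrE ?(ltW zp) ?(ltW (delta0 _)) //.
  by apply: le_trans (ltW kz); rewrite ler_wiXn2l // leq_maxr.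
apply: (@coverable_bigcup _ _ _ _ (fun j => E (J + j)%N)
   (fun j => c * q ^+ (J + j) + e / 2 * 2^-1 ^+ j.+1)).
- by move=> x _; exact: powR_ge0.
- move=> y [yS by0].
  have bg : (b%:E < growth h y)%E by apply: lt_le_trans by0; rewrite lte_fin.
  have [r /andP[r1 r2] br] := @growth_frequently_gt h y b J bg.
  have J1 : 2^-1 ^+ J <= 1 :> R by rewrite exprn_ile1.
  have hr := @growth_ratio_gt h y r b _ br.
  have uJ : 0 < 1 - r <= 2^-1 ^+ J by clear -r1 r2 J1; apply/andP; split; lra.
  have [j Jj /andP[ju uj]] := dyadic_scale uJ.
  exists (j - J)%N => //; rewrite subnKC //.
  have jj : delta j.+1 = delta j / 2 by rewrite /delta exprS mulrC.
  have dj := delta0 j.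
  split => //; exists r; split.
    by move: ju uj; rewrite -/(delta j) -/(delta j.+1) jj => u1 u2; clear -u1 u2 dj; apply/andP; split; lra.
  apply: ltW; apply: le_lt_trans (hr _); last by clear -r1 r2 J1; apply/andP; split; lra.
  rewrite -[T j]lnK ?posrE // ler_expR /T lnM ?posrE ?powR_gt0 // !ln_powR.
  move: uJ => /andP[u0 _]; move: ju uj; rewrite -/(delta j) -/(delta j.+1) jj.
  move: (1 - r) u0 => u u0 ju uj.
  have l1 : ln u <= ln (delta j) by rewrite ler_ln ?posrE.
  have l2 : ln (delta j) - ln 2 <= ln u.
    by rewrite -ln_div ?posrE // ler_ln ?posrE // divr_gt0.
  have : b * (ln u - ln (delta j)) <= `|b| * ln 2.
    apply: le_trans (ler_norm _) _; rewrite normrM ler_wpM2l //.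
    by rewrite ler_norml; clear -l1 l2; apply/andP; split; lra.
  lra.
- move=> j; apply: coverE; first by rewrite (leq_trans J3) // leq_addr.
  by rewrite mulr_gt0 ?divr_gt0 // exprn_gt0 // invr_gt0.
- move=> M; rewrite big_split /= [leRHS](splitr e) lerD //.
    apply: le_trans Jq; rewrite ler_pdivlMr ?subr_gt0 //.
    under eq_bigr do rewrite exprD mulrA.
    have geo : (\sum_(i < M) q ^+ i) * (1 - q) = 1 - q ^+ M.
      elim: (M) => [|k IH]; first by rewrite big_ord0 mul0r expr0 subrr.
      by rewrite big_ord_recr /= mulrDl IH exprS; ring.
    rewrite -mulr_sumr -[leLHS]mulrA geo ler_piMr //.
      exact: (mulr_ge0 (ltW c0) (exprn_ge0 _ (ltW q0))).
    by rewrite lerBlDr lerDl exprn_ge0 // ltW.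
  rewrite -mulr_sumr -[leRHS]mulr1 ler_pM2l ?divr_gt0 //.
  exact: sum_half_pow_le.
Qed.

End upper_bound.

(** * Harmonicity from explicit derivatives *)

Section harmonic_functions.
Context {R : realType} {n : nat}.
Implicit Types (x y : 'rV[R]_n.+1) (f g : 'rV[R]_n.+1 -> R) (U : set 'rV[R]_n.+1).

Lemma near_eq_continuous_at f g x : (\near x, f x = g x) ->
  {for x, continuous f} -> {for x, continuous g}.
Proof.
move=> fg cf; have fgx : f x = g x by exact: nbhs_singleton fg.
rewrite /prop_for /continuous_at -fgx.
apply: (cvg_trans _ cf); apply: near_eq_cvg; first exact: (nbhs_filter x).
exact: fg.
Qed.

(** [partial i f] agrees with [f1 i] near each point of the open set, so derivability and continuity
    pass from the formulas to the iterated partial derivatives. *)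
Lemma harmonic_of_derivatives U f (f1 : 'I_n.+1 -> 'rV[R]_n.+1 -> R)
    (f2 : 'I_n.+1 -> 'I_n.+1 -> 'rV[R]_n.+1 -> R) : open U ->
  (forall x, U x -> {for x, continuous f}) ->
  (forall x i, U x -> is_derive x (unit_vec i) f (f1 i x)) ->
  (forall x i, U x -> {for x, continuous (f1 i)}) ->
  (forall x i j, U x -> is_derive x (unit_vec j) (f1 i) (f2 i j x)) ->
  (forall x i j, U x -> {for x, continuous (f2 i j)}) ->
  (forall x, U x -> \sum_i f2 i i x = 0) -> harmonic_on U f.
Proof.
move=> oU cf d1 c1 d2 c2 lap.
have nearU x : U x -> \near x, U x by move=> Ux; exact: open_nbhs_nbhs.
have p1 x i : U x -> partial i f x = f1 i x by move=> Ux; have [_ <-] := d1 x i Ux.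
have n1 x i : U x -> \near x, f1 i x = partial i f x.
  by move=> Ux; apply: (filterS _ (nearU x Ux)) => z Uz; rewrite p1.
have dp x i j : U x -> is_derive x (unit_vec j) (partial i f) (f2 i j x).
  by move=> Ux; exact: near_eq_is_derive (n1 x i Ux) (d2 x i j Ux).
have p2 x i j : U x -> partial j (partial i f) x = f2 i j x.
  by move=> Ux; have [_ <-] := dp x i j Ux.
split=> [x Ux|x Ux]; last first.
  transitivity (\sum_i f2 i i x); last exact: lap.
  by apply: eq_bigr => i _; exact: p2.
split; first exact: cf.
move=> i; split.
- by have [] := d1 x i Ux.
- exact: near_eq_continuous_at (n1 x i Ux) (c1 x i Ux).
- move=> j; split; first by have [] := dp x i j Ux.
  apply: near_eq_continuous_at (c2 x i j Ux).
  by apply: (filterS _ (nearU x Ux)) => z Uz; rewrite p2.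
Qed.

Lemma harmonic_derivatives U f x i j : harmonic_on U f -> U x ->
  [/\ {for x, continuous f},
      is_derive x (unit_vec i) f (partial i f x),
      {for x, continuous (partial i f)},
      is_derive x (unit_vec j) (partial i f) (partial j (partial i f) x) &
      {for x, continuous (partial j (partial i f))}].
Proof.
move=> [C2 _] Ux; have [cf /(_ i)[d1 c1 /(_ j)[d2 c2]]] := C2 x Ux.
split; [exact: cf|exact: derivableP d1|exact: c1|exact: derivableP d2|exact: c2].
Qed.

Lemma harmonic_eq_on U f g : open U -> (forall x, U x -> f x = g x) ->
  harmonic_on U f -> harmonic_on U g.
Proof.
move=> oU fg hf.
have nearfg x : U x -> \near x, f x = g x.
  by move=> Ux; apply: (filterS _ (open_nbhs_nbhs (conj oU Ux))).
apply: (@harmonic_of_derivatives U g (fun i => partial i f)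
  (fun i j => partial j (partial i f)) oU).
- move=> x Ux; have [cf _ _ _ _] := harmonic_derivatives ord0 ord0 hf Ux.
  exact: near_eq_continuous_at (nearfg x Ux) cf.
- move=> x i Ux; have [_ d1 _ _ _] := harmonic_derivatives i ord0 hf Ux.
  exact: near_eq_is_derive (nearfg x Ux) d1.
- by move=> x i Ux; have [] := harmonic_derivatives i ord0 hf Ux.
- by move=> x i j Ux; have [] := harmonic_derivatives i j hf Ux.
- by move=> x i j Ux; have [] := harmonic_derivatives i j hf Ux.
- by move=> x Ux; exact: (proj2 hf).
Qed.

Lemma harmonic0 U : open U -> harmonic_on U (fun=> 0 : R).
Proof.
move=> oU; apply: (@harmonic_of_derivatives U _ (fun _ _ => 0) (fun _ _ _ => 0) oU);
  try by move=> *; exact: cont_cst.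
by move=> x _; apply: big1.
Qed.

Lemma harmonicD U f g : open U -> harmonic_on U f -> harmonic_on U g ->
  harmonic_on U (fun x => f x + g x).
Proof.
move=> oU hf hg.
apply: (@harmonic_of_derivatives U _ (fun i x => partial i f x + partial i g x)
  (fun i j x => partial j (partial i f) x + partial j (partial i g) x) oU).
- move=> x Ux; have [cf _ _ _ _] := harmonic_derivatives ord0 ord0 hf Ux.
  have [cg _ _ _ _] := harmonic_derivatives ord0 ord0 hg Ux.
  exact: (cont_add cf cg).
- move=> x i Ux; have [_ df _ _ _] := harmonic_derivatives i ord0 hf Ux.
  have [_ dg _ _ _] := harmonic_derivatives i ord0 hg Ux.
  exact: is_deriveD df dg.
- move=> x i Ux; have [_ _ cf _ _] := harmonic_derivatives i ord0 hf Ux.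
  have [_ _ cg _ _] := harmonic_derivatives i ord0 hg Ux.
  exact: (cont_add cf cg).
- move=> x i j Ux; have [_ _ _ df _] := harmonic_derivatives i j hf Ux.
  have [_ _ _ dg _] := harmonic_derivatives i j hg Ux.
  exact: is_deriveD df dg.
- move=> x i j Ux; have [_ _ _ _ cf] := harmonic_derivatives i j hf Ux.
  have [_ _ _ _ cg] := harmonic_derivatives i j hg Ux.
  exact: (cont_add cf cg).
- move=> x Ux; transitivity (laplacian f x + laplacian g x).
    by rewrite /laplacian -big_split.
  by rewrite (proj2 hf x Ux) (proj2 hg x Ux) addr0.
Qed.

Lemma harmonicZ U f (c : R) : open U -> harmonic_on U f ->
  harmonic_on U (fun x => c * f x).
Proof.
move=> oU hf.
apply: (@harmonic_of_derivatives U _ (fun i x => c * partial i f x)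
  (fun i j x => c * partial j (partial i f) x) oU).
- move=> x Ux; have [cf _ _ _ _] := harmonic_derivatives ord0 ord0 hf Ux.
  by apply: cont_mul; [exact: cont_cst|exact: cf].
- move=> x i Ux; have [_ df _ _ _] := harmonic_derivatives i ord0 hf Ux.
  exact: (is_deriveZ c df).
- move=> x i Ux; have [_ _ cf _ _] := harmonic_derivatives i ord0 hf Ux.
  by apply: cont_mul; [exact: cont_cst|exact: cf].
- move=> x i j Ux; have [_ _ _ df _] := harmonic_derivatives i j hf Ux.
  exact: (is_deriveZ c df).
- move=> x i j Ux; have [_ _ _ _ cf] := harmonic_derivatives i j hf Ux.
  by apply: cont_mul; [exact: cont_cst|exact: cf].
- move=> x Ux; transitivity (c * laplacian f x).
    by rewrite /laplacian mulr_sumr.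
  by rewrite (proj2 hf x Ux) mulr0.
Qed.

Lemma harmonic_sum U (I : Type) (r : seq I) (F : I -> 'rV[R]_n.+1 -> R) : open U ->
  (forall i, harmonic_on U (F i)) -> harmonic_on U (fun x => \sum_(i <- r) F i x).
Proof.
move=> oU hF; elim: r => [|i r IH].
  apply: harmonic_eq_on (harmonic0 oU) => // x _; by rewrite big_nil.
apply: harmonic_eq_on (harmonicD oU (hF i) IH) => // x _; by rewrite big_cons.
Qed.

Lemma is_derive_comp_dir (k : R -> R) f x v (df dk : R) :
  is_derive (f x) 1 k dk -> is_derive x v f df ->
  is_derive x v (fun y => k (f y)) (dk * df).
Proof.
move=> dkf /is_derive_line0 dfl; apply/is_derive_line0.
pose fl (t : R) := f (x + t *: v).
have dkl : is_derive (fl 0) 1 k dk by rewrite /fl scale0r addr0.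
exact: (is_derive1_comp dkl dfl).
Qed.

Lemma is_derive_coord x i j :
  is_derive x (unit_vec j) (fun y : 'rV[R]_n.+1 => y ord0 i) (i == j)%:R.
Proof.
apply/is_derive_line0.
have -> : (fun s : R => (x + s *: unit_vec j) ord0 i) = (fun s : R => x ord0 i + (i == j)%:R * s).
  by apply/funext => s; rewrite !mxE eqxx /= mulrC.
apply: is_derive_eq; rewrite /GRing.scale /=; ring.
Qed.

Lemma is_derive_esq x y0 j :
  is_derive x (unit_vec j) (fun y => esq (y - y0)) (2 * (x ord0 j - y0 ord0 j)).
Proof.
apply/is_derive_line0.
have -> : (fun s : R => esq (x + s *: unit_vec j - y0)) =
    (fun s : R => esq (x - y0) + 2 * (x ord0 j - y0 ord0 j) * s + s ^+ 2).
  by apply/funext => s; rewrite esq_line !mxE.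
apply: is_derive_eq; rewrite /GRing.scale /=; ring.
Qed.

End harmonic_functions.

(** * Poisson kernels *)

Section poisson.
Context {R : realType} {n : nat}.
Implicit Types (x y : 'rV[R]_n.+1).

Let N : R := n.+1%:R.

(** The Poisson kernel of the ball with pole y, without normalizing constant; the power -N / 2 of
    the squared distance is |x - y|^(-n-1). *)
Definition poisson y x : R := (1 - esq x) * esq (x - y) `^ (- (N / 2)).

Lemma unit_ball_away y x : unit_sphere R n y -> unit_ball R n x -> 0 < esq (x - y).
Proof.
move=> yS xB; rewrite -sqr_enorm exprn_gt0 // enorm_distC.
by apply: lt_le_trans (ler_enormB _ _); rewrite yS subr_gt0.
Qed.

Let D y x := esq (x - y).
Let w x : R := 1 - esq x.
Let pw y (c : R) x := D y x `^ c.

Lemma poisson_harmonic y : unit_sphere R n y ->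
  harmonic_on (unit_ball R n) (poisson y).
Proof.
move=> yS.
pose g i x : R := x ord0 i - y ord0 i.
pose f1 i x : R := - 2 * (x ord0 i * pw y (- (N / 2)) x)
   - N * (w x * (g i x * pw y (- (N / 2) - 1) x)).
pose f2 (i j : 'I_n.+1) x : R :=
  - 2 * ((i == j)%:R * pw y (- (N / 2)) x - N * (x ord0 i * (g j x * pw y (- (N / 2) - 1) x)))
  - N * ((- 2 * x ord0 j) * (g i x * pw y (- (N / 2) - 1) x) +
      w x * ((i == j)%:R * pw y (- (N / 2) - 1) x
       - (N + 2) * (g i x * (g j x * pw y (- (N / 2) - 2) x)))).
have Dp x : unit_ball R n x -> 0 < D y x by exact: unit_ball_away.
have dD x j : is_derive x (unit_vec j) (D y) (2 * g j x) := is_derive_esq x y j.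
have dw x j : is_derive x (unit_vec j) w (- 2 * x ord0 j).
  have := is_derive_esq x 0 j; rewrite mxE subr0 => d.
  have d' : is_derive x (unit_vec j) (fun z : 'rV[R]_n.+1 => esq z) (2 * x ord0 j).
    suff -> : (fun z : 'rV[R]_n.+1 => esq z) = (fun z => esq (z - 0)) by [].
    by apply/funext => z; rewrite subr0.
  apply: (is_derive_eq (is_deriveB (is_derive_cst (1 : R) x (unit_vec j)) d')).
  by rewrite sub0r mulNr.
have dg x i j : is_derive x (unit_vec j) (g i) (i == j)%:R.
  apply: (is_derive_eq (is_deriveB (is_derive_coord x i j)
    (is_derive_cst (y ord0 i) x (unit_vec j)))).
  by rewrite subr0.
have dp c x j : unit_ball R n x ->
    is_derive x (unit_vec j) (pw y c) (2 * c * (g j x * pw y (c - 1) x)).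
  move=> /Dp D0.
  apply: (is_derive_eq (is_derive_comp_dir (is_derive1_powR c D0) (dD x j))).
  by rewrite /pw; ring.
have cD x : {for x, continuous (D y)} by exact: continuous_dist2.
have cesq x : {for x, continuous w}.
  by apply: cont_sub; [exact: cont_cst|exact: continuous_esq].
have cg i x : {for x, continuous (g i)}.
  by apply: cont_sub; [exact: coord_continuous|exact: cont_cst].
have cc i x : {for x, continuous (fun x : 'rV[R]_n.+1 => x ord0 i)}.
  exact: coord_continuous.
have cp c x : unit_ball R n x -> {for x, continuous (pw y c)}.
  move=> /Dp D0; apply: (@cont_comp _ _ (fun v => v `^ c) (D y)) => //.
  have [d _] := is_derive1_powR c D0.
  exact/differentiable_continuous/derivable1_diffP.
have cst c x : {for x, continuous (fun _ : 'rV[R]_n.+1 => c : R)} by exact: cont_cst.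
apply: (@harmonic_of_derivatives _ _ _ _ f1 f2 open_unit_ball).
- by move=> x xU; apply: cont_mul => //; exact: cp.
- move=> x i xU.
  apply: (is_derive_eq (is_deriveM (dw x i) (dp (- (N / 2)) x i xU))).
  rewrite /f1 /GRing.scale /=.
  by field.
- move=> x i xU; have ? := cp (- (N / 2)) x xU; have ? := cp (- (N / 2) - 1) x xU.
  by apply: cont_sub; repeat (apply: cont_mul => //).
- move=> x i j xU.
  have d1 := is_deriveZ (- 2) (is_deriveM (is_derive_coord x i j) (dp (- (N / 2)) x j xU)).
  have d2 := is_deriveZ N (is_deriveM (dw x j)
     (is_deriveM (dg x i j) (dp (- (N / 2) - 1) x j xU))).
  apply: (is_derive_eq (is_deriveB d1 d2)).
  rewrite /f2 /GRing.scale /= (_ : - (N / 2) - 1 - 1 = - (N / 2) - 2); last by ring.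
  rewrite -[(g i * _) x]/(g i x * pw y (- (N / 2) - 1) x).
  by field.
- move=> x i j xU; have ? := cp (- (N / 2)) x xU; have ? := cp (- (N / 2) - 1) x xU.
  have ? := cp (- (N / 2) - 2) x xU.
  apply: cont_sub; apply: cont_mul => //.
    by apply: cont_sub; repeat (apply: cont_mul => //).
  apply: cont_add; apply: cont_mul => //.
  + exact: cont_mul.
  + exact: cont_mul.
  + by apply: cont_sub; repeat (apply: cont_mul => //).
- move=> x xU; have D0 := Dp x xU.
  have P1 : pw y (- (N / 2) - 1) x = D y x * pw y (- (N / 2) - 2) x.
    rewrite /pw; transitivity (D y x `^ 1 * D y x `^ (- (N / 2) - 2)).
      by rewrite -powRD ?(gt_eqF D0) ?implybT //; congr (_ `^ _); ring.
    by rewrite powRr1 // ltW.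
  have P2 : pw y (- (N / 2)) x = D y x * pw y (- (N / 2) - 1) x.
    rewrite /pw; transitivity (D y x `^ 1 * D y x `^ (- (N / 2) - 1)).
      by rewrite -powRD ?(gt_eqF D0) ?implybT //; congr (_ `^ _); ring.
    by rewrite powRr1 // ltW.
  (* With all powers of the distance reduced to one, the Laplacian is a polynomial in |x|^2, the
     inner product [s] and [a]. It vanishes because |y| = 1, in the form |x|^2 = a + 2 s - 1. *)
  rewrite /f2; under eq_bigr do rewrite eqxx /= P2 P1.
  move: (pw _ _ _) => P.
  pose s := \sum_(i < n.+1) x ord0 i * y ord0 i.
  have DE : D y x = esq x - 2 * s + 1.
    have y1 : esq y = 1 by rewrite -sqr_enorm yS expr1n.
    transitivity (esq x - 2 * s + esq y); last by rewrite y1.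
    rewrite /D /esq /s mulr_sumr -sumrB -big_split /=.
    by apply: eq_bigr => i _; rewrite !mxE; ring.
  pose a := D y x.
  transitivity (\sum_(i < n.+1) ((- 2 * a * a * P - N * w x * a * P)
     + (4 * N * a * P) * (x ord0 i ^+ 2) - (4 * N * a * P) * (x ord0 i * y ord0 i)
     + N * (N + 2) * w x * P * (x - y) ord0 i ^+ 2)).
    by apply: eq_bigr => i _; rewrite /g /a !mxE; ring.
  have sx : \sum_(i < n.+1) x ord0 i ^+ 2 = esq x by [].
  have sd : \sum_(i < n.+1) (x - y) ord0 i ^+ 2 = a by [].
  rewrite big_split sumrB big_split /= -!mulr_sumr sumr_const card_ord sx sd -/s.
  rewrite -[_ *+ n.+1]mulr_natl -/N /w.
  have -> : esq x = a + 2 * s - 1 by rewrite /a DE; ring.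
  by ring.
Qed.

End poisson.

Section poisson_bounds.
Context {R : realType} {n : nat}.
Implicit Types (x y : 'rV[R]_n.+1).

Let N : R := n.+1%:R.

Lemma sqr_powR_half (b : R) : 0 <= b -> (b ^+ 2) `^ (- (N / 2)) = b ^- n.+1.
Proof.
move=> b0; rewrite -powR_mulrn // -powRrM (_ : 2%:R * - (N / 2) = - N); last by field.
by rewrite powR_invn.
Qed.

Lemma poisson_gt0 y x : unit_sphere R n y -> unit_ball R n x -> 0 < poisson y x.
Proof.
move=> yS xB; rewrite mulr_gt0 ?powR_gt0 ?unit_ball_away // subr_gt0.
have x1 : enorm x < 1 := xB.
by rewrite -sqr_enorm expr_lt1 // ?enorm_ge0.
Qed.

Lemma powR_half_anti (a b : R) : 0 < a -> a <= b -> b `^ (- (N / 2)) <= a `^ (- (N / 2)).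
Proof.
move=> a0 ab; have b0 : 0 < b by exact: lt_le_trans ab.
have N2 : 0 <= N / 2 by rewrite divr_ge0.
rewrite !powRN lef_pV2 ?posrE ?powR_gt0 //.
by apply: (ge0_ler_powR N2); rewrite ?nnegrE ?(ltW a0) ?(ltW b0).
Qed.

Lemma poisson_le y x (c : R) : unit_sphere R n y -> 0 < c -> enorm x <= 1 - c ->
  poisson y x <= c ^- n.+1.
Proof.
move=> yS c0 xc.
have cxy : c ^+ 2 <= esq (x - y).
  rewrite -sqr_enorm lerXn2r ?nnegrE ?enorm_ge0 ?(ltW c0) // enorm_distC.
  by apply: le_trans (ler_enormB _ _); rewrite yS; lra.
rewrite -[leRHS]mul1r /poisson; apply: ler_pM.
- rewrite subr_ge0 -sqr_enorm expr_le1 ?enorm_ge0 //; lra.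
- exact: powR_ge0.
- by rewrite lerBlDr lerDl esq_ge0.
- by rewrite -sqr_powR_half ?(ltW c0) // powR_half_anti // exprn_gt0.
Qed.

(** At depth rho below z, the factor 1 - |x|^2 is 2 rho - rho^2 >= rho and the distance to the pole
    is at most 2 rho. *)
Lemma poisson_peak y z (rho : R) : unit_sphere R n y -> unit_sphere R n z ->
  0 < rho < 1 -> enorm (z - y) <= rho ->
  rho * (2 * rho) ^- n.+1 <= poisson y ((1 - rho) *: z).
Proof.
move=> yS zS /andP[r0 r1] zy.
have xB : unit_ball R n ((1 - rho) *: z).
  by rewrite /unit_ball /= enormZ zS mulr1 ger0_norm; lra.
have far : esq ((1 - rho) *: z - y) <= (2 * rho) ^+ 2.
  rewrite -enorm_le ?mulr_ge0 ?(ltW r0) //.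
  rewrite (_ : (1 - rho) *: z - y = (z - y) + (- rho) *: z); last first.
    by rewrite scalerBl scale1r scaleNr addrAC.
  apply: le_trans (ler_enormD _ _) _.
  by rewrite enormZ zS mulr1 normrN gtr0_norm //; lra.
apply: ler_pM.
- exact: ltW.
- by rewrite invr_ge0 exprn_ge0 // mulr_ge0 // ltW.
- by rewrite esqZ -(sqr_enorm z) zS expr1n mulr1; nra.
- rewrite -sqr_powR_half; last by rewrite mulr_ge0 // ltW.
  exact: powR_half_anti (unit_ball_away yS xB) far.
Qed.

End poisson_bounds.

(** * A chart of a cap of the sphere *)

Section chart.
Context {R : realType} {n : nat}.
Implicit Types x z : 'rV[R]_n.

(** The upper hemisphere as a graph, with height in coordinate [ord0]. The other coordinates recover
    x, so pulling back a cover does not increase coordinate diameters. *)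
Definition chart x : 'rV[R]_n.+1 :=
  \row_i (if unlift ord0 i is Some j then x ord0 j else Num.sqrt (1 - esq x)).

Lemma chart0 x : chart x ord0 ord0 = Num.sqrt (1 - esq x).
Proof. by rewrite mxE unlift_none. Qed.

Lemma chartS x j : chart x ord0 (lift ord0 j) = x ord0 j.
Proof. by rewrite mxE liftK. Qed.

Lemma chart_sphere x : esq x <= 1 -> unit_sphere R n (chart x).
Proof.
move=> x1; rewrite /unit_sphere /= enormE /esq big_ord_recl chart0.
under eq_bigr do rewrite chartS.
by rewrite sqr_sqrtr ?subr_ge0 // subrK sqrtr1.
Qed.

Lemma chart_expands x z j : `|x ord0 j - z ord0 j| <= enorm (chart x - chart z).
Proof.
apply: le_trans (coord_le_enorm (chart x - chart z) (lift ord0 j)).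
by rewrite !mxE !liftK.
Qed.

(** The cube of this side at the origin lies in the ball of radius 1 / 2, where the height stays
    above 1 / 2 and the chart is Lipschitz. *)
Definition side : R := (2 * n%:R)^-1.

Lemma side_bounds : (0 < n)%N -> 0 < side <= 1 /\ n%:R * side = 2^-1.
Proof.
move=> n0; have nR : 1 <= n%:R :> R by rewrite ler1n.
split; last by rewrite /side; field; rewrite pnatr_eq0 -lt0n.
rewrite invr_gt0 invf_le1; last by lra.
by apply/andP; split; lra.
Qed.

Lemma esq_side x : (0 < n)%N -> (forall i, 0 <= x ord0 i <= side) -> esq x <= 1 / 4.
Proof.
move=> n0 xs; have [/andP[s0 _] sE] := side_bounds n0.
rewrite (_ : 1 / 4 = (n%:R * side) ^+ 2); last by rewrite sE; field.
rewrite -enorm_le; last by rewrite sE; lra.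
apply: enorm_le_coord; first exact: ltW.
by move=> i; have /andP[x0 x1] := xs i; rewrite ger0_norm.
Qed.

Lemma chart_lip x z (r : R) : (0 < n)%N ->
  (forall i, 0 <= x ord0 i <= side) -> (forall i, 0 <= z ord0 i <= side) ->
  (forall i, `|x ord0 i - z ord0 i| <= r) ->
  enorm (chart x - chart z) <= n.+1%:R * r.
Proof.
move=> n0 xs zs xz; have [/andP[s0 _] sE] := side_bounds n0.
have r0 : 0 <= r by apply: le_trans (xz (Ordinal n0)).
apply: enorm_le_coord => // i; rewrite !mxE.
case: unliftP => [j _|_]; first exact: xz.
have x4 := esq_side n0 xs; have z4 := esq_side n0 zs.
have half (a : R) : a <= 1 / 4 -> 1 / 2 <= Num.sqrt (1 - a).
  move=> a4; have : Num.sqrt ((1 / 2) ^+ 2) <= Num.sqrt (1 - a).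
    by rewrite ler_sqrt; lra.
  by rewrite sqrtr_sqr ger0_norm.
have hx := half _ x4; have hz := half _ z4.
set A := Num.sqrt _ in hx *; set B := Num.sqrt _ in hz *.
(* As A + B >= 1, it suffices to bound the difference of the squares; each coordinate contributes at
   most 2 side r, and 2 n side = 1. *)
have AB : (A - B) * (A + B) = esq z - esq x.
  rewrite -subr_sqr !sqr_sqrtr; [ring| |]; lra.
have zx : `|esq z - esq x| <= r.
  rewrite /esq -sumrB; apply: le_trans (ler_norm_sum _ _ _) _.
  apply: (@le_trans _ _ (\sum_(i < n) r * (2 * side))).
    apply: ler_sum => k _; rewrite subr_sqr normrM.
    have /andP[x0 x1] := xs k; have /andP[z0 z1] := zs k.
    apply: ler_pM => //; first by rewrite distrC.
    by rewrite ger0_norm; lra.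
  rewrite sumr_const card_ord -[leLHS]mulr_natl mulrCA (_ : n%:R * (2 * side) = 1) ?mulr1 //.
  by rewrite mulrCA sE; field.
apply: le_trans zx; rewrite -AB normrM ler_peMr // ger0_norm; lra.
Qed.

End chart.

(** * Combs of Poisson kernels *)

Section combs.
Context {R : realType} {n : nat}.
Hypothesis n0 : (0 < n)%N.
Implicit Types (x y z : 'rV[R]_n.+1) (j : nat) (h : 'rV[R]_n.+1 -> R).

(** This is 2^(j^2), so that 2^(-j) eventually exceeds every fixed negative power of the mesh. *)
Definition mesh j : nat := ((2 ^ j) ^ j)%N.

Definition comb_pole j (k : {ffun 'I_n -> 'I_(mesh j)}) : 'rV[R]_n.+1 :=
  chart (grid_point (@side R n) k).

(* Poisson kernels with equal weights at about [mesh j ^ n] regularly spaced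
   poles; the total mass [2 ^ - j] tends to 0, but is a negligible power of
   the mesh. *)
Definition comb j x : R :=
  2^-1 ^+ j * ((mesh j)%:R ^- n * \sum_k poisson (@comb_pole j k) x).

Lemma mesh_gt0 j : (0 < mesh j)%N.
Proof. by rewrite /mesh !expn_gt0. Qed.

Lemma meshR_gt0 j : 0 < (mesh j)%:R :> R.
Proof. by rewrite ltr0n mesh_gt0. Qed.

Lemma grid_point_side j (k : {ffun 'I_n -> 'I_(mesh j)}) i :
  0 <= grid_point (@side R n) k ord0 i <= @side R n.
Proof.
have [/andP[s0 _] _] := side_bounds (R := R) n0.
rewrite grid_pointE; apply/andP; split.
  by rewrite mulr_ge0 // divr_ge0 // ltW.
rewrite mulrAC -[leRHS]mulr1 -mulrA ler_pM2l // ler_pdivrMr ?meshR_gt0 // mul1r.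
by rewrite ler_nat ltnW.
Qed.

Lemma comb_pole_sphere j k : unit_sphere R n (@comb_pole j k).
Proof.
apply: chart_sphere; apply: le_trans (esq_side n0 (@grid_point_side j k)) _.
lra.
Qed.

Lemma comb_gt0 j x : unit_ball R n x -> 0 < comb j x.
Proof.
move=> xB; have p k : 0 < poisson (@comb_pole j k) x.
  exact: poisson_gt0 (comb_pole_sphere k) xB.
rewrite mulr_gt0 ?exprn_gt0 ?invr_gt0 // mulr_gt0 ?invr_gt0 ?exprn_gt0 ?meshR_gt0 //.
pose k0 : {ffun 'I_n -> 'I_(mesh j)} := [ffun=> Ordinal (mesh_gt0 j)].
by rewrite (bigD1 k0) //= ltr_wpDr ?p // sumr_ge0 // => k _; rewrite ltW.
Qed.

Lemma comb_le j x (c : R) : 0 < c -> enorm x <= 1 - c ->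
  comb j x <= 2^-1 ^+ j * c ^- n.+1.
Proof.
move=> c0 xc; rewrite ler_pM2l ?exprn_gt0 ?invr_gt0 //.
rewrite ler_pdivrMl ?exprn_gt0 ?meshR_gt0 //.
apply: (@le_trans _ _ (\sum_(k : {ffun 'I_n -> 'I_(mesh j)}) c ^- n.+1)).
  by apply: ler_sum => k _; exact: poisson_le (comb_pole_sphere k) c0 xc.
by rewrite sumr_const card_ffun !card_ord -[leLHS]mulr_natl natrX.
Qed.

Lemma comb_peak j k z (rho : R) : unit_sphere R n z -> 0 < rho < 1 ->
  enorm (z - @comb_pole j k) <= rho ->
  2^-1 ^+ j * ((mesh j)%:R ^- n * (rho * (2 * rho) ^- n.+1)) <=
  comb j ((1 - rho) *: z).
Proof.
move=> zS r01 zk; have /andP[r0 r1] := r01.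
have xB : unit_ball R n ((1 - rho) *: z).
  by rewrite /unit_ball /= enormZ zS mulr1 ger0_norm; lra.
rewrite ler_pM2l ?exprn_gt0 ?invr_gt0 // ler_pM2l ?invr_gt0 ?exprn_gt0 ?meshR_gt0 //.
apply: le_trans (poisson_peak (comb_pole_sphere k) zS r01 zk) _.
rewrite [leRHS](bigD1 k) //= lerDl sumr_ge0 // => k' _.
by rewrite ltW // poisson_gt0 //; exact: comb_pole_sphere.
Qed.

Lemma comb_harmonic j : harmonic_on (unit_ball R n) (comb j).
Proof.
have oU := @open_unit_ball R n.
do 2!apply: harmonicZ => //.
apply: harmonic_sum => // k; exact: poisson_harmonic (comb_pole_sphere k).
Qed.

(** Below mesh^(-n/t) for every t > 0 once j is large: a single domination condition serves all
    exponents. *)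
Definition depth j : R := (mesh j)%:R^-1 ^+ j.

Lemma depth_gt0 j : 0 < depth j.
Proof. by rewrite exprn_gt0 // invr_gt0 meshR_gt0. Qed.

(** Strictness on a compact ball makes the condition stable under locally uniform perturbations;
    halving the comb makes it hold strictly for h + [comb j] even where h vanishes. *)
Definition dominates_comb j h :=
  forall x, enorm x <= 1 - depth j -> comb j x / 2 < h x.

End combs.

(** * The residual set *)

Section residual_set.
Context {R : realType} {n : nat}.
Hypothesis n0 : (0 < n)%N.
Local Notation fspace := {family compactly_in (unit_ball R n), 'rV[R]_n.+1 -> R}.
Local Notation Hplus := (set_type (nonneg_harmonic R n)).

Lemma harmonic_continuous (h : 'rV[R]_n.+1 -> R) x :
  harmonic_on (unit_ball R n) h -> unit_ball R n x -> {for x, continuous h}.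
Proof. by move=> hh xB; have [cf _ _ _ _] := harmonic_derivatives ord0 ord0 hh xB. Qed.

Lemma compact_inner_ball (c : R) : 0 < c ->
  compactly_in (unit_ball R n) [set x | enorm x <= 1 - c].
Proof.
move=> c0; split; first by move=> x /= xc; rewrite /unit_ball /=; lra.
have [c1|c1] := leP c 1.
  have -> : [set x : 'rV[R]_n.+1 | enorm x <= 1 - c] =
      [set x | esq (x - 0) <= (1 - c) ^+ 2].
    by apply/seteqP; split => x /=; rewrite subr0 -enorm_le //; lra.
  exact: compact_esq_ball.
have -> : [set x : 'rV[R]_n.+1 | enorm x <= 1 - c] = set0.
  by apply/seteqP; split => // x /=; have := enorm_ge0 x; lra.
exact: compact0.
Qed.

Lemma compactly_in_ball_inner (K : set 'rV[R]_n.+1) :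
  compactly_in (unit_ball R n) K ->
  exists2 c : R, 0 < c & forall x, K x -> enorm x <= 1 - c.
Proof.
move=> [KB cK].
have [B B0 HB] : exists2 B, 0 < B & forall x, K x -> `|(1 - enorm x)^-1| <= B.
  apply: (@compact_fun_bounded R n (fun x => (1 - enorm x)^-1) K cK) => x /KB xB.
  have x1 : 0 < 1 - enorm x by rewrite subr_gt0.
  apply: (@continuousV _ _ (fun x => 1 - enorm x)); first by rewrite gt_eqF.
  by apply: cont_sub; [exact: cont_cst|exact: continuous_enorm].
exists B^-1; first by rewrite invr_gt0.
move=> x Kx; have xB := KB x Kx; have x1 : 0 < 1 - enorm x by rewrite subr_gt0.
have := HB x Kx; rewrite ger0_norm ?invr_ge0 ?(ltW x1) // => h.
have : B^-1 <= 1 - enorm x by rewrite -[leRHS]invrK lef_pV2 ?posrE ?invr_gt0.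
lra.
Qed.

Definition comb_dominators (J : nat) : set Hplus :=
  [set h | exists2 j, (J <= j)%N & dominates_comb j (set_val h)].

Lemma nonneg_harmonicP (h : Hplus) : nonneg_harmonic R n (set_val h).
Proof. exact: set_valP. Qed.

(** The continuous function [u] is positive on a compact ball, so its inverse is bounded there by
    some [B]; functions within 1 / B of h on that ball still dominate. *)
Lemma dominates_comb_nbhs j (h : fspace) : nonneg_harmonic R n h ->
  dominates_comb j h -> nbhs h [set g : fspace | dominates_comb j g].
Proof.
move=> [hh _ _] hj.
have [KB cK] := compact_inner_ball (@depth_gt0 R j).
pose u x : R := h x - comb j x / 2.
have u0 x : enorm x <= 1 - depth j -> 0 < u x by move=> /hj; rewrite subr_gt0.
have cu x : unit_ball R n x -> {for x, continuous u}.
  move=> xB; apply: cont_sub; first exact: harmonic_continuous.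
  apply: cont_mul; last exact: cont_cst.
  exact: harmonic_continuous (comb_harmonic n0 j) xB.
have [B B0 HB] : exists2 B, 0 < B &
    forall x, [set x | enorm x <= 1 - depth j] x -> `|(u x)^-1| <= B.
  apply: (@compact_fun_bounded R n (fun x => (u x)^-1) _ cK) => x Kx.
  apply: (@continuousV _ _ u); first by rewrite gt_eqF ?u0.
  exact/cu/KB.
pose E : set (R * R) := [set p | `|p.1 - p.2| < B^-1].
have entE : entourage E.
  by rewrite -entourage_ballE; exists B^-1 => //=; rewrite invr_gt0.
apply: filterS (fam_nbhs h entE (conj KB cK)) => g hg x xj.
have := hg x xj; rewrite /E /= => hgx.
have ux := u0 x xj.
have : B^-1 <= u x.
  have := HB x xj; rewrite ger0_norm ?invr_ge0 ?(ltW ux) // => h1.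
  by rewrite -[leRHS]invrK lef_pV2 ?posrE ?invr_gt0.
have := ler_norm (h x - g x); rewrite /u; lra.
Qed.

Lemma open_comb_dominators J : open (comb_dominators J).
Proof.
rewrite openE => h [j Jj hj].
have c : continuous (set_val : Hplus -> fspace) by exact: initial_continuous.
have H : nbhs h (set_val @^-1` [set g : fspace | dominates_comb j g]).
  exact: (c h _ (dominates_comb_nbhs (nonneg_harmonicP h) hj)).
by apply: (filterS _ H) => g gj; exists j.
Qed.

(** The sum is cut off outside the ball to respect the encoding by extension by 0. *)
Definition add_comb j (h : fspace) : fspace :=
  fun x => if enorm x < 1 then h x + comb j x else 0.

Lemma add_comb_nonneg j (h : fspace) : nonneg_harmonic R n h ->
  nonneg_harmonic R n (add_comb j h).
Proof.
move=> [hh h0 hout]; split.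
- apply: harmonic_eq_on (@open_unit_ball R n) _ (harmonicD (@open_unit_ball R n) hh (comb_harmonic n0 j)).
  by move=> x xB; rewrite /add_comb ifT.
- move=> x xB; rewrite /add_comb ifT //.
  by rewrite addr_ge0 ?h0 // ltW // comb_gt0.
- by move=> x xB; rewrite /add_comb; case: ifP.
Qed.

Lemma add_comb_cvg (h : fspace) : (fun j => add_comb j h) @ \oo --> h.
Proof.
apply/fam_cvgP => K cK; have [c c0 Kc] := compactly_in_ball_inner cK.
move=> P /uniform_nbhs[E [entE EP]].
have [e e0 eE] : exists2 e : R, 0 < e & forall a b : R, `|a - b| < e -> E (a, b).
  move: entE; rewrite -entourage_ballE => -[e /= e0 eE].
  by exists e => // a b ab; apply: eE.
have ec0 : 0 < e * c ^+ n.+1 by rewrite mulr_gt0 // exprn_gt0.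
have [k kc] := exists_half_pow_lt ec0.
exists k => // j /= kj; apply: EP => x Kx; apply: eE.
have xc := Kc x Kx.
rewrite /add_comb ifT; last by lra.
rewrite opprD addNKr normrN gtr0_norm; last by apply: comb_gt0 => //; rewrite /unit_ball /=; lra.
apply: le_lt_trans (comb_le n0 j c0 xc) _.
rewrite ltr_pdivrMr ?exprn_gt0 //; apply: le_lt_trans kc.
by rewrite ler_wiXn2l //; lra.
Qed.

(** Adding [comb j] to h makes it dominate that comb, since h >= 0; the perturbation tends to 0
    because the total mass does. *)
Lemma dense_comb_dominators J : dense (comb_dominators J).
Proof.
move=> U [h Uh] [V oV UV].
pose g j : Hplus := SigSub (mem_set (add_comb_nonneg j (nonneg_harmonicP h))).
have Vh : V (set_val h) by move: Uh; rewrite -UV.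
have /add_comb_cvg[k _ kV] : nbhs (set_val h : fspace) V by exact: open_nbhs_nbhs.
exists (g (maxn k J)); split; first by rewrite -UV; apply: kV => /=; rewrite leq_maxl.
exists (maxn k J); first by rewrite leq_maxr.
move=> x xd.
have d0 := @depth_gt0 R (maxn k J).
have xB : unit_ball R n x by rewrite /unit_ball /=; lra.
have cp := comb_gt0 n0 (maxn k J) xB.
have -> : set_val (g (maxn k J)) = add_comb (maxn k J) (set_val h) by [].
rewrite /add_comb ifT //.
have [_ /(_ x xB) h0 _] := nonneg_harmonicP h; lra.
Qed.

Lemma residual_comb_dominators : residual (\bigcap_J comb_dominators J).
Proof.
exists (\bigcap_J comb_dominators J) => //; exists comb_dominators => // J.
by split; [exact: open_comb_dominators|exact: dense_comb_dominators].
Qed.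

End residual_set.

(** * From powers to the gauge *)

Section gauge_coverings.
Context {R : realType} {n : nat}.
Implicit Types (A : set 'rV[R]_n) (t s e : R).

(* Constant beyond 1, where [gauge] stops being monotone: a covering of small
   total cost then consists of sets of diameter at most 1. *)
Definition capped_gauge t (u : R) := if u <= 1 then gauge t u else gauge t 1.

Lemma capped_gauge_ge0 t (u : R) : 0 < t -> 0 < u -> 0 <= capped_gauge t u.
Proof.
move=> t0 u0; rewrite /capped_gauge; case: ifP => u1; apply/ltW/gauge_gt0 => //.
  by rewrite u0 u1.
by rewrite ltr01 lexx.
Qed.

(** A cost of at most c^s forces all sizes below [c], where the gauge is at most the s-th power.
    Thus sets of dimension less than t are negligible for the gauge. *)
Lemma coverable_capped_gauge A s t : 0 < s -> s < t ->
  (forall e, 0 < e -> coverable (fun u : R => u `^ s) A e) ->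
  forall e, 0 < e -> coverable (capped_gauge t) A e.
Proof.
move=> s0 st cA e e0; have t0 : 0 < t by exact: lt_trans st.
have [c /andP[c0 c1] gc] := gauge_le_powR st t0.
have e'0 : 0 < Num.min e (c `^ s) by rewrite lt_min e0 powR_gt0.
have [U [d [d0 AU Ud sd]]] := cA _ e'0.
have dc i : d i <= c.
  have : d i `^ s <= c `^ s.
    apply: le_trans (_ : d i `^ s <= Num.min e (c `^ s)) _.
      apply: le_trans (sd i.+1); rewrite big_ord_recr /= lerDr.
      by rewrite sumr_ge0 // => k _; exact: powR_ge0.
    by rewrite ge_min lexx orbT.
  apply: contraTT; rewrite -!ltNge => h.
  by rewrite gt0_ltr_powR // nnegrE ltW.
exists U, d; split => // M; apply: le_trans (_ : \sum_(i < M) d i `^ s <= _).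
  apply: ler_sum => i _; rewrite /capped_gauge ifT; last exact: le_trans c1.
  by rewrite gc // d0 dc.
by apply: le_trans (sd M) _; rewrite ge_min lexx.
Qed.

End gauge_coverings.

(** * Growth near the poles *)

Section dimension.
Context {R : realType} {n : nat}.
Hypothesis n0 : (0 < n)%N.
Implicit Types (h : 'rV[R]_n.+1 -> R) (b t s : R).

Lemma mesh_mono (i j : nat) : (i <= j)%N -> (mesh i <= mesh j)%N.
Proof. by move=> ij; rewrite /mesh -!expnM leq_exp2l // leq_mul. Qed.

Lemma leq_mesh j : (j <= mesh j)%N.
Proof.
case: j => // j; rewrite /mesh -expnM; apply: leq_trans (ltnW (ltn_expl _ (ltnSn 1))) _.
by rewrite leq_exp2l // leq_pmulr.
Qed.

(** At depth rho = cb m^(-n/t) the nearest kernel alone gives the comb about 2^(-j) m^(-n) rho^(-n),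
    and m^(-n) >= rho^t turns this into 2^(-j) rho^(-b). The factor 2^(-j) and the constants are
    absorbed by rho^e, because rho <= 2^(-j^2). *)
Lemma growth_near_poles h b (x : 'rV[R]_n) :
  0 <= b < n%:R -> (forall i, 0 <= x ord0 i <= @side R n) ->
  (forall J, exists j (k : {ffun 'I_n -> 'I_(mesh j)}),
     [/\ (J <= j)%N, dominates_comb j h &
       cube (grid_point (@side R n) k)
         (@side R n / 4 * (mesh j)%:R `^ (- (n%:R / (n%:R - b)))) x]) ->
  (b%:E <= growth h (chart x))%E.
Proof.
move=> /andP[b0 bn] xs freq.
pose t := n%:R - b; have t0 : 0 < t by rewrite subr_gt0.
have nt : 1 <= n%:R / t by rewrite ler_pdivlMr // mul1r /t; lra.
have [/andP[s0 s1] sE] := side_bounds (R := R) n0.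
pose N : R := n.+1%:R.
have nR : 1 <= n%:R :> R by rewrite ler1n.
have NE : N = n%:R + 1 by rewrite /N -natr1.
(* Radius coefficient of the cube times the Lipschitz constant of the chart, that is (n + 1) / (8
   n). *)
pose cb := N * (@side R n / 4).
have cb8 : 1 / 8 <= cb <= 1 / 4.
  rewrite /cb NE; apply/andP; split; nra.
apply/lee_addgt0Pr => e e0; rewrite -leeBlDr //.
rewrite -EFinB; apply: le_growth => u u0.
(* The summands make j larger than n / t + 1 for the depth, (N + 2) / e for the loss and 1 / u for
   closeness to the sphere; 8 gives m >= 8. *)
have [j [k [Jj dom xk]]] := freq ((Num.truncn (n%:R / t)).+2 + (Num.truncn ((N + 2) / e)).+2
   + (Num.truncn u^-1).+2 + 8)%N.
pose m : R := (mesh j)%:R.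
have m0 : 0 < m by exact: meshR_gt0.
have jm : j%:R <= m by rewrite ler_nat leq_mesh.
have jbig (z : R) (l : nat) : (Num.truncn z < l)%N -> (l <= j)%N -> z < j%:R.
  move=> zl lj; apply: lt_le_trans (Num.Theory.truncnS_gt _) _.
  by rewrite ler_nat (leq_trans zl).
have j1 : n%:R / t + 1 < j%:R.
  have : n%:R / t < j.-1%:R.
    apply: lt_le_trans (Num.Theory.truncnS_gt _) _; rewrite ler_nat.
    rewrite -ltnS prednK; last by apply: leq_trans Jj; rewrite addnC.
    by apply: leq_trans Jj; rewrite -!addnA leq_addr.
  have -> : j%:R = j.-1%:R + 1 :> R.
    by rewrite natr1 prednK //; apply: leq_trans Jj; rewrite addnC.
  lra.
have j2 : (N + 2) / e < j%:R.
  apply: (jbig _ (Num.truncn ((N + 2) / e)).+2) => //.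
  by apply: leq_trans Jj; rewrite -!addnA addnCA leq_addr.
have j3 : u^-1 < j%:R.
  apply: (jbig _ (Num.truncn u^-1).+2) => //.
  by apply: leq_trans Jj; rewrite -addnA addnCA leq_addr.
have j8 : 8 <= j%:R :> R.
  by rewrite ler_nat; apply: leq_trans Jj; rewrite leq_addl.
pose p := m `^ (- (n%:R / t)).
have p0 : 0 < p by rewrite powR_gt0.
pose rho := cb * p.
have m1 : 1 <= m by lra.
have pm : p <= m^-1.
  by rewrite -(powR_inv1 (ltW m0)) ler_powR // lerN2.
have cb0 : 0 < cb by case/andP: cb8; lra.
have rho0 : 0 < rho by rewrite mulr_gt0.
have rhom : rho <= m^-1.
  by apply: le_trans pm; rewrite ler_piMl ?(ltW p0) //; case/andP: cb8; lra.
have mu : m^-1 < u by rewrite invf_plt ?posrE //; lra.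
have rho1 : rho < 1.
  by apply: le_lt_trans rhom _; rewrite invf_lt1 //; lra.
have xS : unit_sphere R n (chart x).
  by apply: chart_sphere; apply: le_trans (esq_side n0 xs) _; lra.
have near : enorm (chart x - @comb_pole R n j k) <= rho.
  rewrite /rho /cb -mulrA; apply: chart_lip => //.
  exact: grid_point_side.
exists (1 - rho); first by clear -rho0 rho1 rhom mu; apply/andP; split; lra.
apply: le_growth_ratio; first by clear -rho0 rho1; apply/andP; split; lra.
rewrite subKr.
(* From n / t + 1 < j one gets m^(-j) <= m^(-n/t) / m, and 1 / m <= 1 / 8 <= cb. *)
have deep : depth j <= rho.
  rewrite /depth /rho -/m.
  have -> : m^-1 ^+ j = m `^ (- (n%:R / t)) * m `^ (n%:R / t - j%:R).
    rewrite exprVn -powR_invn ?(ltW m0) // -powRD ?(gt_eqF m0) ?implybT //.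
    by congr (_ `^ _); ring.
  rewrite mulrC ler_pM2r //; apply: (@le_trans _ _ (m `^ (- 1))).
    by rewrite ler_powR //; lra.
  rewrite powR_inv1 ?(ltW m0) //; apply: (@le_trans _ _ (1 / 8)); last by case/andP: cb8.
  by rewrite mul1r lef_pV2 ?posrE //; lra.
have hx := dom ((1 - rho) *: chart x).
have hx' : comb j ((1 - rho) *: chart x) / 2 < h ((1 - rho) *: chart x).
  by apply: hx; rewrite enormZ xS mulr1 ger0_norm; clear -rho0 rho1 deep; lra.
have r01 : 0 < rho < 1 by rewrite rho0 rho1.
have peak := comb_peak n0 xS r01 near.
apply: ltW; apply: le_lt_trans hx'.
apply: (@le_trans _ _ (2^-1 ^+ j * (m ^- n * (rho * (2 * rho) ^- n.+1)) / 2)); last first.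
  by rewrite ler_pM2r.
have mE : rho `^ t <= m ^- n.
  rewrite /rho powRM ?(ltW cb0) ?(ltW p0) // /p -powRrM mulNr divfK ?gt_eqF //.
  rewrite powR_invn ?(ltW m0) // ler_piMl ?invr_ge0 ?exprn_ge0 ?(ltW m0) //.
  by apply: powR_le1; rewrite ?(ltW t0) // (ltW cb0) /=; case/andP: cb8; lra.
have -> : expR ((b - e) * - ln rho) = rho `^ e * (rho `^ t * rho ^- n).
  rewrite -[rho ^- n]powR_invn ?(ltW rho0) // -!powRD ?(gt_eqF rho0) ?implybT //.
  by rewrite /powR gt_eqF //; congr expR; rewrite /t; ring.
have key : rho `^ e <= 2^-1 ^+ j * 2 ^- n.+1 / 2.
  have two (l : nat) : 2^-1 ^+ l = 2 `^ (- l%:R) :> R by rewrite exprVn powR_invn.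
  have -> : 2^-1 ^+ j * 2 ^- n.+1 / 2 = 2 `^ (- (j%:R + N + 1)) :> R.
    rewrite -exprVn -exprD -exprSr two; congr (_ `^ (- _)).
    by rewrite -natr1 natrD.
  apply: (@le_trans _ _ (m^-1 `^ e)).
    by apply: (ge0_ler_powR (ltW e0)); rewrite ?nnegrE ?invr_ge0 ?(ltW m0) ?(ltW rho0).
  have -> : m^-1 = 2 `^ (- (j%:R * j%:R)).
    by rewrite /m /mesh -expnM natrX -exprVn two natrM.
  rewrite -powRrM ler_powR ?ler1n // mulNr lerN2.
  have je : N + 2 < j%:R * e by rewrite -ltr_pdivrMr.
  by clear -je j8 nR NE; nra.
apply: (@le_trans _ _ (2^-1 ^+ j * 2 ^- n.+1 / 2 * (m ^- n * rho ^- n))).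
  apply: ler_pM => //; first exact: powR_ge0.
    by rewrite mulr_ge0 ?powR_ge0 // invr_ge0 exprn_ge0 // ltW.
  by rewrite ler_wpM2r // invr_ge0 exprn_ge0 // ltW.
have -> : (2 * rho) ^+ n.+1 = 2 ^+ n.+1 * (rho * rho ^+ n).
  by rewrite -exprS; exact: exprMn.
have rn0 : rho ^+ n != 0 by rewrite gt_eqF // exprn_gt0.
have mn0 : m ^+ n != 0 by rewrite gt_eqF // exprn_gt0.
have tn0 : 2 ^+ n.+1 != 0 :> R by rewrite gt_eqF // exprn_gt0.
rewrite le_eqVlt; apply/orP; left; apply/eqP.
suff gen (r X Y Z W : R) : r != 0 -> X != 0 -> Y != 0 -> Z != 0 ->
    W * Z^-1 / 2 * (Y^-1 * X^-1) = W * (Y^-1 * (r * (Z * (r * X))^-1)) / 2.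
  by apply: gen => //; rewrite gt_eqF.
by move=> r' X' Y' Z'; field; rewrite r' X' Y' Z'.
Qed.

End dimension.

(** * Dimension of the level sets *)

Section hausdorff_dimension.
Context {R : realType} {n : nat}.
Hypothesis n0 : (0 < n)%N.
Implicit Types (h : 'rV[R]_n.+1 -> R) (b t s : R).

Lemma nonneg_harmonic_ge0 h x : nonneg_harmonic R n h -> 0 <= h x.
Proof.
move=> [_ h0 hout]; have [xB|xB] := pselect (unit_ball R n x); first exact: h0.
by rewrite hout.
Qed.

Lemma hausdorff_dim_growth_le h b : nonneg_harmonic R n h -> b <= n%:R ->
  (hausdorff_dim (growth_set b h) <= (n%:R - b)%:E)%E.
Proof.
move=> hH bn; apply/lee_addgt0Pr => e e0; rewrite -EFinD.
have s0 : 0 < n%:R - b + e by lra.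
apply: ereal_inf_lbound; exists (n%:R - b + e) => //; split => //.
apply: coverable_hausdorff_measure0 => // e' e'0.
apply: (@coverable_sub _ _ _ _
  [set y | unit_sphere R n y /\ (b%:E <= growth h y)%E]).
  by move=> y [yS yb]; split => //; rewrite /growth /growth_ratio yb.
apply: limsup_set_coverable => //.
- by case: hH.
- by move=> x; exact: nonneg_harmonic_ge0.
- lra.
Qed.

(** Pulled back through the chart, a cover within the budget of [ubiquity] misses some point lying
    near poles of infinitely many dominated combs, and [growth_near_poles] places the image of that
    point in the set. *)
Lemma limsup_set_not_coverable h b : 0 <= b < n%:R ->
  (forall J, exists2 j, (J <= j)%N & dominates_comb j h) ->
  exists2 e : R, 0 < e & ~ coverable (capped_gauge (n%:R - b))
    [set y | unit_sphere R n y /\ (b%:E <= growth h y)%E] e.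
Proof.
move=> b01 dom; have /andP[b0 bn] := b01.
pose t : R := n%:R - b; have t0 : 0 < t by rewrite subr_gt0.
have t0n : 0 < t <= n%:R by rewrite t0 /t; lra.
have [/andP[s0 s1] sE] := side_bounds (R := R) n0.
have s01 : 0 < @side R n / 2 <= 1 by apply/andP; split; lra.
have /andP[eta0 eta1] := @eta01 R n.
have gs := gauge_gt0 t0 s01.
exists (@eta R n * gauge t (@side R n / 2)); first by rewrite mulr_gt0.
move=> [U [d [d0 AU Ud sd]]].
have g1 : 0 < gauge t 1 by apply: gauge_gt0 => //; rewrite ltr01 lexx.
(* A set of size above 1 would alone cost [gauge t 1], more than the whole budget. *)
have d1 i : d i <= 1.
  rewrite leNgt; apply/negP => di.
  have : gauge t 1 <= @eta R n * gauge t (@side R n / 2).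
    apply: le_trans (sd i.+1); rewrite big_ord_recr /=.
    rewrite {2}/capped_gauge ifF; last by apply/negbTE; rewrite -ltNge.
    by rewrite lerDr sumr_ge0 // => k _; apply: capped_gauge_ge0.
  have := @gauge_le R t (@side R n / 2) 1 t0 (proj1 (andP s01)) (proj2 (andP s01)) (lexx _).
  nra.
have sd' M : \sum_(i < M) gauge t (d i) <= @eta R n * gauge t (@side R n / 2).
  apply: le_trans (sd M); apply: ler_sum => i _.
  by rewrite /capped_gauge ifT.
pose P m := exists2 j, m = mesh j & dominates_comb j h.
have Pinf M : exists2 m, (M <= m)%N & P m.
  have [j Mj jh] := dom M; exists (mesh j); last by exists j.
  by apply: leq_trans Mj (leq_mesh j).
have [] := @ubiquity R n (fun i => [set x | U i (chart x)]) d t (@side R n) (@side R n / 4) P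
  t0n (fun i => introT andP (conj (d0 i) (d1 i))) _ _ _ Pinf sd'.
- by move=> i x z Ux Uz j; apply: le_trans (chart_expands x z j) (Ud i _ _ Ux Uz).
- by rewrite s0 s1.
- by rewrite divr_gt0 //= lexx.
move=> x [xs xV freq].
have yb : (b%:E <= growth h (chart x))%E.
  apply: growth_near_poles b01 xs _ => // J.
  (* [mesh] is monotone, so a mesh larger than [mesh J] has an index of at least [J]. *)
  have [m [k [Jm [j mj jh] xk]]] := freq (mesh J).+1.
  subst m; exists j, k; split => //.
  rewrite leqNgt; apply/negP => jJ.
  by have := mesh_mono (ltnW jJ); rewrite leqNgt Jm.
have [] := AU (chart x).
  by split => //; apply: chart_sphere; apply: le_trans (esq_side n0 xs) _; lra.
by move=> i _ /xV.
Qed.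

Lemma hausdorff_dim_growth_ge h b : nonneg_harmonic R n h -> 0 <= b <= n%:R ->
  (forall J, exists2 j, (J <= j)%N & dominates_comb j h) ->
  ((n%:R - b)%:E <= hausdorff_dim (growth_set b h))%E.
Proof.
move=> hH /andP[b0]; rewrite le_eqVlt => /orP[/eqP->|bn] dom.
  (* For b = n the bound is 0, and only positive exponents compete in the infimum. *)
  by rewrite subrr; apply: le_ereal_inf_tmp => _ [s [s0 _] <-]; rewrite lee_fin ltW.
pose t : R := n%:R - b; have t0 : 0 < t by rewrite subr_gt0.
apply: le_ereal_inf_tmp => _ [s [s0 Hs] <-]; rewrite lee_fin leNgt; apply/negP => st.
have b01 : 0 <= b < n%:R by rewrite b0 bn.
have [e e0] := limsup_set_not_coverable b01 dom; apply.
(* Index 0 is the level set, assumed null for some s < t; index k + 1 collects growth at least b +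
   2^(-k). *)
pose A k : set 'rV[R]_n.+1 := if k is k'.+1 then
  [set y | unit_sphere R n y /\ ((b + 2^-1 ^+ k')%:E <= growth h y)%E]
  else growth_set b h.
apply: (@coverable_bigcup _ _ _ _ A (fun k => e * 2^-1 ^+ k.+1)).
- by move=> u u0; apply: capped_gauge_ge0.
- move=> y [yS]; rewrite le_eqVlt => /orP[/eqP yb|yb].
    by exists 0%N => //; split => //; exact/esym.
  have [k bk] : exists k, ((b + 2^-1 ^+ k)%:E <= growth h y)%E.
    case: (growth h y) yb => [g| |].
    - rewrite lte_fin -subr_gt0 => /exists_half_pow_lt[k kg]; exists k.
      by rewrite lee_fin; lra.
    - by exists 0%N; rewrite leey.
    - by rewrite ltNge leNye.
  by exists k.+1.
- case=> [|k].
    apply: (coverable_capped_gauge s0 st); last by rewrite mulr_gt0 // exprn_gt0 // invr_gt0.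
    exact: hausdorff_measure0_coverable.
  have k0 : 0 < 2^-1 ^+ k :> R by rewrite exprn_gt0 // invr_gt0.
  (* Strictly between t - 2^(-k) and t, and positive even when t - 2^(-k) is not. *)
  pose sk := Num.max (t / 2) (t - 2^-1 ^+ k / 2).
  have sk0 : 0 < sk by rewrite lt_max divr_gt0.
  have skt : sk < t by rewrite gt_max; apply/andP; split; lra.
  apply: (coverable_capped_gauge sk0 skt); last by rewrite mulr_gt0 // exprn_gt0 // invr_gt0.
  apply: limsup_set_coverable => //.
  + by case: hH.
  + by move=> x; exact: nonneg_harmonic_ge0.
  + by rewrite lt_max; apply/orP; right; rewrite /t; lra.
- by move=> M; rewrite -mulr_sumr -[leRHS]mulr1 ler_pM2l // sum_half_pow_le.
Qed.

End hausdorff_dimension.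

Unset Implicit Arguments.

Theorem theorem6 (R : realType) (d : nat) (hd : (1 <= d)%N) :
  exists A : set (set_type (nonneg_harmonic R d)),
    residual A /\
    forall h : set_type (nonneg_harmonic R d), A h ->
    forall beta : R, 0 <= beta <= d%:R ->
      hausdorff_dim (growth_set beta (set_val h)) = (d%:R - beta)%:E.
Proof.
(* Membership means dominating [comb j] for infinitely many j, a condition that does not involve
   beta. *)
exists (\bigcap_J @comb_dominators R d J); split.
  exact: residual_comb_dominators.
move=> h hA beta b01; have /andP[b0 b1] := b01.
have hH := nonneg_harmonicP h.
apply/eqP; rewrite eq_le hausdorff_dim_growth_le //=.
by apply: hausdorff_dim_growth_ge => // J; exact: hA J I.
Qed.
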